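(* Let $\kappa>0$, $q:=e^{-2\kappa}$ and $\gamma_n:=\tanh(\kappa n)$ for $n\in\mathbb{N}$. Consider the infinite system of ordinary differential equations \[ \dot q_n(t)=-q_n(t)+\frac{\gamma_n}{2}\bigl(q_{n-1}(t)+q_{n+1}(t)\bigr),\qquad n\in\mathbb{N}, \] with the boundary condition $q_0(t):=0$. Let $q_{n,0}\in[-1,1]$, $n\in\mathbb{N}$. The unique solution $(q_n(t))_{n\in\mathbb{N}}$ of this system satisfying $q_n(0)=q_{n,0}$ for all $n\in\mathbb{N}$ is given by \[ q_n(t)=\sum_{k=1}^{\infty}q_n^{(k)}(t)\,q_{k,0}, \] where $(q_n^{(k)}(t))_{n\in\mathbb{N}}$ denotes the solution of the system satisfying $q_n^{(k)}(0)=\delta_{k,n}$. Furthermore, \[ q_n^{(k)}(t)=\frac{2}{\pi\gamma_1}\sqrt{\frac{\gamma_n}{\gamma_k}}\int_0^{\pi}e^{-t(1-\cos\theta)}\sin^2(\theta)\,P_n(\theta)P_k(\theta)\left|\frac{(q,qe^{2{\rm i}\theta};q)_\infty}{(-q,-qe^{2{\rm i}\theta};q)_\infty}\right|^2{\rm d}\theta, \] and \[ q_n^{(k)}(t)=\frac{1}{\gamma_1}\sqrt{\frac{2}{\pi}\frac{\gamma_n}{\gamma_k}}\,\frac{(q;q)_\infty^4}{(-q;q)_\infty^4}\,\frac{P_n(0)P_k(0)}{t^{3/2}}+O\!\left(t^{-5/2}\right),\qquad t\to+\infty. \]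
   Context: For $a\in\mathbb{C}$ and $n\in\mathbb{N}_0\cup\{\infty\}$, $(a;q)_n:=\prod_{j=0}^{n-1}(1-aq^j)$, and $(a_1,\dots,a_r;q)_n:=(a_1;q)_n\cdots(a_r;q)_n$. Here $\mathbb{N}=\{1,2,\dots\}$. For $n\in\mathbb{N}$ and $\theta\in\mathbb{R}$, \[ P_n(\theta):=\sqrt{\frac{\gamma_1}{\gamma_n}}\sum_{k=0}^{n-1}\frac{(-q;q)_k(-q;q)_{n-1-k}}{(q;q)_k(q;q)_{n-1-k}}\cos\bigl((2k-n+1)\theta\bigr). \] (The system describes the magnetizations $q_n(t)$ of a semi-infinite kinetic Ising chain with Glauber dynamics and hyperbolically decaying temperature.)
   Formalization: Uniqueness is asserted among solutions bounded uniformly in n on each interval 0≤t≤T; without such a growth condition it fails (take q_1=e^{-1/t} and solve recursively for q_{n+1}, giving a nonzero solution with zero initial data). *)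

(* Defs.v *)
From Stdlib Require Import Reals Lra.
From Coquelicot Require Import Coquelicot.
Open Scope R_scope.

Definition tanh (x : R) : R := (exp x - exp (- x)) / (exp x + exp (- x)).

Fixpoint qpoch (a q : R) (n : nat) : R :=
  match n with
  | O => 1
  | S m => qpoch a q m * (1 - a * q ^ m)
  end.

Definition qpoch_inf (a q : R) : R := real (Lim_seq (fun n => qpoch a q n)).

Fixpoint qpochC (a : C) (q : R) (n : nat) : C :=
  match n with
  | O => 1%C
  | S m => (qpochC a q m * (1 - a * RtoC (q ^ m)))%C
  end.

Definition C_lim (u : nat -> C) : C :=
  (real (Lim_seq (fun n => fst (u n))), real (Lim_seq (fun n => snd (u n)))).

Definition qpochC_inf (a : C) (q : R) : C := C_lim (fun n => qpochC a q n).

Definition Cexpi (x : R) : C := (cos x, sin x).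

Definition weight (q th : R) : R :=
  Cmod ((qpochC_inf (RtoC q) q * qpochC_inf (RtoC q * Cexpi (2 * th)) q)
        / (qpochC_inf (RtoC (- q)) q * qpochC_inf (RtoC (- q) * Cexpi (2 * th)) q))%C ^ 2.

Definition gam (kappa : R) (n : nat) : R := tanh (kappa * INR n).

(* P_n(theta), n >= 1 *)
Definition Ppoly (kappa : R) (n : nat) (th : R) : R :=
  let q := exp (- 2 * kappa) in
  sqrt (gam kappa 1 / gam kappa n) *
  sum_f_R0 (fun k =>
     qpoch (- q) q k * qpoch (- q) q (n - 1 - k) / (qpoch q q k * qpoch q q (n - 1 - k))
     * cos ((2 * INR k - INR n + 1) * th)) (n - 1).

Definition is_solution (kappa : R) (x : nat -> R -> R) : Prop :=
  (forall t, x 0%nat t = 0) /\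
  (forall n, (1 <= n)%nat ->
     filterlim (x n) (at_right 0) (locally (x n 0)) /\
     forall t, 0 < t ->
       is_derive (x n) t
         (- x n t + gam kappa n / 2 * (x (n - 1)%nat t + x (S n) t))).

(* Uniqueness class: locally bounded in time, uniformly in n. *)
Definition locally_bounded (x : nat -> R -> R) : Prop :=
  forall T, 0 <= T -> exists M, forall n t, 0 <= t <= T -> Rabs (x n t) <= M.

(* The kernel q_n^{(k)}(t) given by the integral formula (n, k >= 1). *)
Definition kernel (kappa : R) (k n : nat) (t : R) : R :=
  let q := exp (- 2 * kappa) in
  2 / (PI * gam kappa 1) * sqrt (gam kappa n / gam kappa k) *
  RInt (fun th => exp (- t * (1 - cos th)) * sin th ^ 2 * Ppoly kappa n th
                  * Ppoly kappa k th * weight q th) 0 PI.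

Definition kernel_asympt (kappa : R) (k n : nat) (t : R) : R :=
  let q := exp (- 2 * kappa) in
  1 / gam kappa 1 * sqrt (2 / PI * (gam kappa n / gam kappa k)) *
  (qpoch_inf q q ^ 4 / qpoch_inf (- q) q ^ 4) *
  (Ppoly kappa n 0 * Ppoly kappa k 0 / Rpower t (3 / 2)).

(* Main.v *)
Require Import Defs.
From Stdlib Require Import Reals Bool Lra Lia Factorial FunctionalExtensionality.
From Coquelicot Require Import Coquelicot.
Open Scope R_scope.

(** Let [p_n] be [P_n] without its square root.  It solves [2 cos th p_n = gam_n (p_(n+1) + p_(n-1))],
    so [exp (- t (1 - cos th)) p_n] solves the system and the kernel is a superposition of such
    solutions; what matters is that the [p_n] are orthogonal for [sin^2 th] times the weight [W].
    With [z = exp (i th)], the series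
    [R_n = A_n sum_j (-q)^j (-1;q)_j (q^n;q)_j / ((q;q)_j (-q^(n+1);q)_j) z^(n+2j)],
    [A_n = gam_1 ... gam_n], solves the same recurrence and [R_0 = 1].  The Wronskian
    [Im (R_(n+1) conj R_n)] does not depend on [n]; comparing [n = 0] with [n -> oo], where the
    q-binomial theorem evaluates [R_n], gives [Im R_1 = W sin th], hence [Im R_n = W p_n sin th].
    Integrating against [sin th] shows that [p_n] is orthogonal to [p_1], and the recurrence
    propagates this to all pairs.  A bounded solution with data of size [B] has size at most
    [B exp (2 t)]: this gives uniqueness, the summability of the kernel in [k], and bounds uniform
    in the number of terms that allow differentiating the series.  The asymptotics is Laplace's
    method with [y = 2 sin (th/2)], because [P_n P_k W] differs from its value at [0] by [O(th^2)]. *)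

(** The orthogonality integral contains two polynomials and an infinite product, and cannot be
    evaluated as it stands. The identity [Im R_n = W p_n sin th] removes this obstacle: against
    [p_1 = 1] the integrand becomes [sin th] times one sine series, so the integral reads off a
    single coefficient. The q-binomial theorem enters at the point [- q z^2], of modulus [q], so all
    series converge geometrically and uniformly in [th] although [z] lies on the unit circle. The
    convention [p_0 = 0] makes the recurrence hold at the boundary site and encodes [q_0 = 0]. The
    other obstacle is the infinite number of equations. The direct bound on a single kernel,
    [1 / gam_k], is not summable in [k]; the bound [exp (2 t)] on a finite superposition depends on
    its initial data only, and so not on the number of terms. *)

(** * Bounds on q-Pochhammer products *)

Lemma exp_monotone (x y : R) : x <= y -> exp x <= exp y.
Proof. intros [H|H]; [left; apply exp_increasing, H|rewrite H; apply Rle_refl]. Qed.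

Lemma pow_unit_interval (q : R) (n : nat) : 0 < q < 1 -> 0 < q ^ n <= 1.
Proof.
  intros hq; split.
  - apply pow_lt; lra.
  - rewrite <- (pow1 n); apply pow_incr; lra.
Qed.

Lemma pow_S_lt_1 (q : R) (n : nat) : 0 < q < 1 -> 0 < q ^ S n < 1.
Proof.
  intros hq; pose proof (pow_unit_interval q n hq); simpl; nra.
Qed.

(** The definition splits off the last factor; relations between products with shifted parameter
    need the first one. *)
Lemma qpoch_S_l (a q : R) (n : nat) :
  qpoch a q (S n) = (1 - a) * qpoch (a * q) q n.
Proof.
  induction n as [|n IH]; [simpl; ring|].
  change (qpoch a q (S (S n))) with (qpoch a q (S n) * (1 - a * q ^ S n)).
  rewrite IH; simpl; ring.
Qed.

Lemma qpoch_opp_ge_1 (c q : R) (n : nat) :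
  0 < q < 1 -> 0 <= c -> 1 <= qpoch (- c) q n.
Proof.
  intros hq hc; induction n as [|n IH]; simpl; [lra|].
  pose proof (pow_unit_interval q n hq).
  assert (0 <= c * q ^ n) by nra. nra.
Qed.

Lemma qpoch_opp_le_exp (c q : R) (n : nat) :
  0 < q < 1 -> 0 <= c -> qpoch (- c) q n <= exp (c / (1 - q)).
Proof.
  intros hq hc.
  (* Each factor is at most [exp (c * q ^ n)]. Keeping the finite geometric sum in the exponent
     makes the induction close; [1 - q ^ n <= 1] is used only afterwards. *)
  assert (H : qpoch (- c) q n <= exp (c * (1 - q ^ n) / (1 - q))).
  { induction n as [|n IH].
    - simpl; replace (c * (1 - 1) / (1 - q)) with 0 by (field; lra).
      rewrite exp_0; lra.
    - replace (c * (1 - q ^ S n) / (1 - q))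
        with (c * (1 - q ^ n) / (1 - q) + c * q ^ n) by (simpl; field; lra).
      rewrite exp_plus; simpl.
      pose proof (qpoch_opp_ge_1 c q n hq hc).
      pose proof (pow_unit_interval q n hq).
      assert (0 <= c * q ^ n) by nra.
      apply Rmult_le_compat; try lra.
      pose proof (exp_ineq1_le (c * q ^ n)); lra. }
  eapply Rle_trans; [exact H|].
  pose proof (pow_unit_interval q n hq).
  apply exp_monotone, Rmult_le_compat_r; [left; apply Rinv_0_lt_compat; lra|nra].
Qed.

(* [1 - x >= exp (- x / (1 - x))] bounds the product away from [0]. *)
Definition qpoch_lower (q : R) : R := exp (- (q / (1 - q) ^ 2)).

Lemma qpoch_lower_le (q : R) (n : nat) :
  0 < q < 1 -> qpoch_lower q <= qpoch q q n.
Proof.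
  intros hq; unfold qpoch_lower.
  assert (H : exp (- (q * (1 - q ^ n) / (1 - q) ^ 2)) <= qpoch q q n).
  { induction n as [|n IH].
    - simpl; replace (- (q * (1 - 1) / ((1 - q) * ((1 - q) * 1)))) with 0 by (field; lra).
      rewrite exp_0; lra.
    - replace (- (q * (1 - q ^ S n) / (1 - q) ^ 2))
        with (- (q * (1 - q ^ n) / (1 - q) ^ 2) + - (q ^ S n / (1 - q)))
        by (simpl; field; lra).
      rewrite exp_plus; simpl qpoch.
      pose proof (pow_S_lt_1 q n hq).
      apply Rmult_le_compat; try (left; apply exp_pos); auto.
      change (q * q ^ n) with (q ^ S n).
      pose proof (pow_unit_interval q n hq).
      assert (q ^ S n <= q) by (simpl; nra).
      rewrite exp_Ropp.
      (* With [x = q ^ S n <= q]: [1 / (1 - x) = 1 + x / (1 - x) <= 1 + x / (1 - q)]. *)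
      assert (/ (1 - q ^ S n) <= exp (q ^ S n / (1 - q))).
      { eapply Rle_trans; [|apply exp_ineq1_le].
        replace (/ (1 - q ^ S n)) with (1 + q ^ S n / (1 - q ^ S n)) by (field; lra).
        apply Rplus_le_compat_l, Rmult_le_compat_l; [lra|].
        apply Rinv_le_contravar; lra. }
      rewrite <- (Rinv_inv (1 - q ^ S n)).
      apply Rinv_le_contravar; auto.
      apply Rinv_0_lt_compat; lra. }
  eapply Rle_trans; [|exact H].
  pose proof (pow_unit_interval q n hq).
  apply exp_monotone, Ropp_le_contravar, Rmult_le_compat_r; [|nra].
  left; apply Rinv_0_lt_compat, pow_lt; lra.
Qed.

Lemma qpoch_q_pos (q : R) (n : nat) : 0 < q < 1 -> 0 < qpoch q q n.
Proof.
  intros hq; eapply Rlt_le_trans; [apply exp_pos|apply qpoch_lower_le; exact hq].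
Qed.

(** Coefficient of [v ^ k] in the q-binomial series for [(al v; q)_oo / (v; q)_oo]. The values
    [al = 0], [-1] and [- q] occur below: Euler's series, the weight, and the polynomials. *)
Definition binom_coef (al q : R) (k : nat) : R := qpoch al q k / qpoch q q k.

Lemma binom_coef_S (al q : R) (k : nat) : 0 < q < 1 ->
  binom_coef al q (S k) * (1 - q ^ S k) = (1 - al * q ^ k) * binom_coef al q k.
Proof.
  intros hq; unfold binom_coef; simpl qpoch.
  pose proof (pow_S_lt_1 q k hq); pose proof (qpoch_q_pos q k hq).
  simpl in *; field; lra.
Qed.

Lemma binom_coef_bound (c q : R) (k : nat) : 0 < q < 1 -> 0 <= c ->
  Rabs (binom_coef (- c) q k) <= exp (c / (1 - q)) / qpoch_lower q.
Proof.
  intros hq hc; unfold binom_coef.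
  pose proof (qpoch_q_pos q k hq); pose proof (qpoch_lower_le q k hq).
  pose proof (qpoch_opp_ge_1 c q k hq hc).
  pose proof (qpoch_opp_le_exp c q k hq hc).
  assert (0 < qpoch_lower q) by apply exp_pos.
  rewrite Rabs_pos_eq by (apply Rdiv_le_0_compat; lra).
  apply Rmult_le_compat; try lra.
  - left; apply Rinv_0_lt_compat; lra.
  - apply Rinv_le_contravar; lra.
Qed.

(** * The q-binomial theorem *)

Lemma fst_sum_n (a : nat -> C) (n : nat) :
  fst (sum_n a n) = sum_n (fun k => fst (a k)) n.
Proof.
  induction n as [|n IH]; [rewrite !sum_O; reflexivity|].
  rewrite !sum_Sn, <- IH; reflexivity.
Qed.

Lemma snd_sum_n (a : nat -> C) (n : nat) :
  snd (sum_n a n) = sum_n (fun k => snd (a k)) n.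
Proof.
  induction n as [|n IH]; [rewrite !sum_O; reflexivity|].
  rewrite !sum_Sn, <- IH; reflexivity.
Qed.

Lemma filterlim_C_components (u : nat -> C) (l : C) :
  filterlim u eventually (locally l) ->
  is_lim_seq (fun n => fst (u n)) (fst l) /\ is_lim_seq (fun n => snd (u n)) (snd l).
Proof.
  intros H; destruct l as [x y]; split.
  - exact (filterlim_comp _ _ _ _ _ _ _ _ H (continuous_fst x y)).
  - exact (filterlim_comp _ _ _ _ _ _ _ _ H (continuous_snd x y)).
Qed.

Lemma C_lim_unique (u : nat -> C) (l : C) :
  filterlim u eventually (locally l) -> Defs.C_lim u = l.
Proof.
  intros H; apply filterlim_C_components in H; destruct H as [H1 H2].
  unfold Defs.C_lim.
  rewrite (is_lim_seq_unique _ _ H1), (is_lim_seq_unique _ _ H2).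
  destruct l; reflexivity.
Qed.

Lemma is_series_fst (a : nat -> C) (l : C) :
  @is_series C_AbsRing C_NormedModule a l -> is_series (fun k => fst (a k)) (fst l).
Proof.
  intros H; apply filterlim_C_components in H; destruct H as [H _].
  apply (is_lim_seq_ext _ _ (Finite (fst l)) (fst_sum_n a) H).
Qed.

Lemma is_series_snd (a : nat -> C) (l : C) :
  @is_series C_AbsRing C_NormedModule a l -> is_series (fun k => snd (a k)) (snd l).
Proof.
  intros H; apply filterlim_C_components in H; destruct H as [_ H].
  apply (is_lim_seq_ext _ _ (Finite (snd l)) (snd_sum_n a) H).
Qed.

Definition psum (c : nat -> R) (v : C) : C :=
  Defs.C_lim (sum_n (fun k => (RtoC (c k) * v ^ k)%C)).

Lemma psum_correct (c : nat -> R) (M : R) (v : C) :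
  (forall k, Rabs (c k) <= M) -> Cmod v < 1 ->
  @is_series C_AbsRing C_NormedModule (fun k => (RtoC (c k) * v ^ k)%C) (psum c v).
Proof.
  intros hc hv.
  assert (H : @ex_series C_AbsRing C_CompleteNormedModule
                (fun k => (RtoC (c k) * v ^ k)%C)).
  { apply (@ex_series_le C_AbsRing C_CompleteNormedModule) with (b := fun k => M * Cmod v ^ k).
    - intros k; change (Cmod (RtoC (c k) * v ^ k) <= M * Cmod v ^ k).
      rewrite Cmod_mult, Cmod_R, Cmod_pow.
      apply Rmult_le_compat_r; [apply pow_le, Cmod_ge_0|apply hc].
    - apply (ex_series_scal (V := R_NormedModule)), ex_series_geom.
      rewrite Rabs_pos_eq; [exact hv|apply Cmod_ge_0]. }
  destruct H as [l Hl].
  assert (E : psum c v = l) by exact (C_lim_unique _ l Hl).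
  rewrite E; exact Hl.
Qed.

(** Controls the series near the origin, where iterating the functional equation moves the
    argument. *)
Lemma psum_near_1 (c : nat -> R) (M : R) (v : C) :
  (forall k, Rabs (c k) <= M) -> c 0%nat = 1 -> Cmod v < 1 ->
  Cmod (psum c v - 1) <= M * Cmod v / (1 - Cmod v).
Proof.
  intros hc h0 hv.
  pose proof (psum_correct c M v hc hv) as H.
  assert (H1 : @is_series C_AbsRing C_NormedModule
    (fun k => (RtoC (c (S k)) * v ^ S k)%C) (psum c v - 1)%C).
  { apply (is_series_incr_1 (fun k => (RtoC (c k) * v ^ k)%C)).
    match goal with |- is_series _ ?l => replace l with (psum c v); [exact H|] end.
    unfold plus; simpl; rewrite h0; ring. }
  assert (H2 : @is_series R_AbsRing R_NormedModule
     (fun k => M * Cmod v * Cmod v ^ k) (M * Cmod v / (1 - Cmod v))).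
  { apply (is_series_scal (V := R_NormedModule) (M * Cmod v)), is_series_geom.
    rewrite Rabs_pos_eq; [exact hv|apply Cmod_ge_0]. }
  apply (filterlim_le (F := eventually) (fun n => norm (sum_n (fun k => (RtoC (c (S k)) * v ^ S k)%C : C_NormedModule) n))
          (sum_n (fun k => M * Cmod v * Cmod v ^ k))
          (norm ((psum c v - 1)%C : C_NormedModule)) (M * Cmod v / (1 - Cmod v))).
  - apply filter_forall; intros n.
    eapply Rle_trans; [apply norm_sum_n_m|].
    apply sum_n_m_le; intros k.
    change (Cmod (RtoC (c (S k)) * v ^ S k) <= M * Cmod v * Cmod v ^ k).
    rewrite Cmod_mult, Cmod_R, Cmod_pow, Rmult_assoc.
    apply Rmult_le_compat_r; [apply (pow_le _ (S k)), Cmod_ge_0|apply hc].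
  - exact (filterlim_comp _ _ _ _ _ _ _ _ H1 (filterlim_norm _)).
  - exact H2.
Qed.

(** Multiplying [binom_coef_S] by [v ^ S k] and summing gives
    [f(v) - f(q v) = v f(v) - al v f(q v)], which rearranges to the claim. *)
Lemma psum_functional (al q M : R) (v : C) :
  0 < q < 1 -> (forall k, Rabs (binom_coef al q k) <= M) -> Cmod v < 1 ->
  ((1 - v) * psum (binom_coef al q) v
   = (1 - RtoC al * v) * psum (binom_coef al q) (RtoC q * v))%C.
Proof.
  intros hq hc hv.
  set (c := binom_coef al q).
  assert (hqv : Cmod (RtoC q * v) < 1).
  { rewrite Cmod_mult, Cmod_R, Rabs_pos_eq by lra.
    pose proof (Cmod_ge_0 v); nra. }
  pose proof (psum_correct c M v hc hv) as H1.
  pose proof (psum_correct c M _ hc hqv) as H2.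
  set (f := psum c v) in *; set (g := psum c (RtoC q * v)%C) in *.
  (* The constant terms of [f] and [g] cancel, so the difference may be summed from index one. *)
  assert (H3 : @is_series C_AbsRing C_NormedModule
     (fun k => (RtoC (c (S k)) * v ^ S k - RtoC (c (S k)) * (RtoC q * v) ^ S k)%C) (f - g)%C).
  { apply (is_series_incr_1 (fun k => (RtoC (c k) * v ^ k - RtoC (c k) * (RtoC q * v) ^ k)%C)).
    match goal with |- is_series _ ?l => replace l with (plus f (opp g)) end.
    - exact (is_series_minus (V := C_NormedModule) _ _ _ _ H1 H2).
    - unfold plus, opp; simpl; ring. }
  assert (H4 : @is_series C_AbsRing C_NormedModule
     (fun k => (v * (RtoC (c k) * v ^ k) - RtoC al * v * (RtoC (c k) * (RtoC q * v) ^ k))%C)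
     (v * f - RtoC al * v * g)%C).
  { exact (is_series_minus (V := C_NormedModule) _ _ _ _
       (is_series_scal (V := C_NormedModule) v _ _ H1)
       (is_series_scal (V := C_NormedModule) (RtoC al * v)%C _ _ H2)). }
  assert (E : (f - g = v * f - RtoC al * v * g)%C).
  { eapply (filterlim_locally_unique (F := eventually) (V := C_NormedModule)); [exact H3|].
    eapply filterlim_ext; [|exact H4].
    intros n; apply sum_n_ext; intros k; symmetry.
    match goal with |- ?a = ?b => change (@eq C a b) end.
    assert (Hk := binom_coef_S al q k hq); fold c in Hk.
    apply (f_equal RtoC) in Hk.
    rewrite !RtoC_mult, !RtoC_minus, RtoC_mult, !RtoC_pow in Hk.
    rewrite !Cpow_mult_l; simpl Cpow in *.
    transitivity (v * v ^ k * (RtoC (c (S k)) * (1 - RtoC q * RtoC q ^ k)))%C; [ring|].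
    rewrite Hk; ring. }
  assert (E2 : (f - v * f = g - RtoC al * v * g)%C).
  { replace (f - v * f)%C with ((f - g) + g - v * f)%C by ring.
    rewrite E; ring. }
  transitivity (f - v * f)%C; [ring|rewrite E2; ring].
Qed.

Lemma qpochC_S_l (a : C) (q : R) (n : nat) :
  qpochC a q (S n) = ((1 - a) * qpochC (RtoC q * a) q n)%C.
Proof.
  induction n as [|n IH]; [simpl; ring|].
  change (qpochC a q (S (S n))) with (qpochC a q (S n) * (1 - a * RtoC (q ^ S n)))%C.
  rewrite IH; simpl; rewrite RtoC_mult; ring.
Qed.

(** The functional equation iterated [n] times. The product form avoids dividing by finite
    products. *)
Lemma psum_qpochC (al q M : R) (n : nat) : forall v : C,
  0 < q < 1 -> (forall k, Rabs (binom_coef al q k) <= M) -> Cmod v < 1 ->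
  (qpochC v q n * psum (binom_coef al q) v
   = qpochC (RtoC al * v) q n * psum (binom_coef al q) (RtoC (q ^ n) * v))%C.
Proof.
  induction n as [|n IH]; intros v hq hc hv.
  - simpl; f_equal; f_equal; ring.
  - rewrite !qpochC_S_l.
    assert (hqv : Cmod (RtoC q * v) < 1).
    { rewrite Cmod_mult, Cmod_R, Rabs_pos_eq by lra.
      pose proof (Cmod_ge_0 v); nra. }
    transitivity (qpochC (RtoC q * v) q n * ((1 - v) * psum (binom_coef al q) v))%C; [ring|].
    rewrite (psum_functional al q M v hq hc hv).
    transitivity ((1 - RtoC al * v) * (qpochC (RtoC q * v) q n * psum (binom_coef al q) (RtoC q * v)))%C; [ring|].
    rewrite (IH (RtoC q * v)%C hq hc hqv).
    replace (RtoC (q ^ S n) * v)%C with (RtoC (q ^ n) * (RtoC q * v))%C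
      by (simpl; rewrite RtoC_mult; ring).
    replace (RtoC q * (RtoC al * v))%C with (RtoC al * (RtoC q * v))%C by ring.
    ring.
Qed.

Lemma filterlim_C_squeeze (u : nat -> C) (l : C) (b : nat -> R) :
  (forall n, Cmod (u n - l) <= b n) -> is_lim_seq b 0 ->
  filterlim u eventually (locally l).
Proof.
  intros H Hb; apply (filterlim_locally (F := eventually) u l); intros eps.
  apply is_lim_seq_spec in Hb; destruct (Hb eps) as [N HN].
  exists N; intros n Hn.
  apply C_NormedModule_mixin_compat1.
  specialize (HN n Hn); rewrite Rminus_0_r in HN.
  eapply Rle_lt_trans; [apply H|].
  eapply Rle_lt_trans; [apply Rle_abs|exact HN].
Qed.

Lemma filterlim_C_mult (u w : nat -> C) (l m : C) :
  filterlim u eventually (locally l) -> filterlim w eventually (locally m) ->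
  filterlim (fun n => (u n * w n)%C) eventually (locally (l * m)%C).
Proof.
  intros Hu Hw.
  eapply filterlim_comp_2; [|exact Hw|exact (filterlim_scal (V := C_NormedModule) l m)].
  (* [filterlim_scal] takes its scalar in the absolute-ring topology of [C]; [locally_C] identifies
     it with the product topology. *)
  intros P HP; apply Hu, locally_C, HP.
Qed.

Lemma psum_scaled_cv (al q M : R) (v : C) :
  0 < q < 1 -> (forall k, Rabs (binom_coef al q k) <= M) -> Cmod v < 1 ->
  filterlim (fun n => psum (binom_coef al q) (RtoC (q ^ n) * v)%C) eventually (locally (RtoC 1)).
Proof.
  intros hq hc hv.
  assert (HM : 0 <= M) by (eapply Rle_trans; [apply Rabs_pos|apply (hc 0%nat)]).
  pose proof (Cmod_ge_0 v).
  apply filterlim_C_squeeze with (b := fun n => M / (1 - Cmod v) * q ^ n).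
  - intros n; pose proof (pow_unit_interval q n hq).
    assert (Hm : Cmod (RtoC (q ^ n) * v) = q ^ n * Cmod v)
      by (rewrite Cmod_mult, Cmod_R, Rabs_pos_eq by lra; reflexivity).
    assert (q ^ n * Cmod v <= Cmod v) by nra.
    eapply Rle_trans; [apply (psum_near_1 _ M); auto|].
    + unfold binom_coef; simpl; field.
    + lra.
    + rewrite Hm.
      replace (M / (1 - Cmod v) * q ^ n) with (M * q ^ n / (1 - Cmod v)) by (field; lra).
      apply Rmult_le_compat.
      * apply Rmult_le_pos; nra.
      * left; apply Rinv_0_lt_compat; lra.
      * apply Rmult_le_compat_l; nra.
      * apply Rinv_le_contravar; lra.
  - replace (Finite 0) with (Rbar_mult (M / (1 - Cmod v)) 0) by (simpl; f_equal; ring).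
    apply is_lim_seq_scal_l, is_lim_seq_geom; rewrite Rabs_pos_eq; lra.
Qed.

Lemma qpochC_0 (q : R) (n : nat) : qpochC 0 q n = 1%C.
Proof. induction n as [|n IH]; simpl; [|rewrite IH]; ring. Qed.

(* Euler's series [sum v^k / (q; q)_k] is the reciprocal of the infinite product, which gives
   both the convergence of the product and its non-vanishing. *)
Lemma qpochC_cv (q : R) (v : C) : 0 < q < 1 -> Cmod v < 1 ->
  filterlim (qpochC v q) eventually (locally (qpochC_inf v q)) /\ qpochC_inf v q <> 0%C.
Proof.
  intros hq hv.
  set (M := exp (0 / (1 - q)) / qpoch_lower q).
  assert (hc : forall k, Rabs (binom_coef 0 q k) <= M)
    by (intros k; rewrite <- Ropp_0; apply binom_coef_bound; lra).
  pose proof (psum_scaled_cv 0 q M v hq hc hv) as H.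
  assert (HE : forall n, (qpochC v q n * psum (binom_coef 0 q) v
                = psum (binom_coef 0 q) (RtoC (q ^ n) * v))%C).
  { intros n; rewrite (psum_qpochC 0 q M n v hq hc hv).
    replace (RtoC 0 * v)%C with (RtoC 0) by ring.
    rewrite qpochC_0; ring. }
  set (E := psum (binom_coef 0 q) v) in *.
  assert (HE0 : E <> 0%C).
  { intros H0.
    assert (H1 : filterlim (fun _ : nat => RtoC 0) eventually (locally (RtoC 1))).
    { eapply filterlim_ext; [|exact H].
      intros n; simpl; rewrite <- HE, H0; ring. }
    assert (H2 : RtoC 1 = RtoC 0).
    { eapply (filterlim_locally_unique (F := eventually) (V := C_NormedModule));
        [exact H1|apply filterlim_const]. }
    apply RtoC_inj in H2; lra. }
  assert (HL : filterlim (qpochC v q) eventually (locally (/ E)%C)).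
  { replace (/ E)%C with (RtoC 1 * / E)%C by ring.
    eapply filterlim_ext; [|exact (filterlim_C_mult _ _ _ _ H (filterlim_const (/ E)%C))].
    intros n; simpl; rewrite <- HE; field; exact HE0. }
  assert (HI : qpochC_inf v q = (/ E)%C) by exact (C_lim_unique _ _ HL).
  rewrite HI; split; [exact HL|].
  intros H0.
  assert (H1 : (E * / E = 0)%C) by (rewrite H0; ring).
  rewrite Cinv_r in H1 by exact HE0.
  apply RtoC_inj in H1; lra.
Qed.

(** Limit of [psum_qpochC], since the series at [q ^ n * v] tends to [1]. The range of [c] keeps
    [- c * v] inside the unit disc, where [qpochC_cv] gives convergence of the product on the
    right. *)
Lemma q_binomial (c q : R) (v : C) : 0 < q < 1 -> 0 <= c <= 1 -> Cmod v < 1 ->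
  (qpochC_inf v q * psum (binom_coef (- c) q) v = qpochC_inf (RtoC (- c) * v) q)%C.
Proof.
  intros hq hcc hv.
  set (M := exp (c / (1 - q)) / qpoch_lower q).
  assert (hc : forall k, Rabs (binom_coef (- c) q k) <= M)
    by (intros k; apply binom_coef_bound; lra).
  assert (hcv : Cmod (RtoC (- c) * v) < 1).
  { rewrite Cmod_mult, Cmod_R, Rabs_Ropp, Rabs_pos_eq by lra.
    pose proof (Cmod_ge_0 v); nra. }
  pose proof (psum_scaled_cv _ q M v hq hc hv) as H.
  destruct (qpochC_cv q v hq hv) as [H1 _].
  destruct (qpochC_cv q _ hq hcv) as [H2 _].
  eapply (filterlim_locally_unique (F := eventually) (V := C_NormedModule)).
  - exact (filterlim_C_mult _ _ _ _ H1 (filterlim_const (psum (binom_coef (- c) q) v))).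
  - replace (qpochC_inf (RtoC (- c) * v) q) with (qpochC_inf (RtoC (- c) * v) q * RtoC 1)%C by ring.
    eapply filterlim_ext; [|exact (filterlim_C_mult _ _ _ _ H2 H)].
    intros n; simpl; symmetry; apply (psum_qpochC _ q M n v hq hc hv).
Qed.

(** * The weight *)

Lemma qpochC_RtoC (a q : R) (n : nat) : qpochC (RtoC a) q n = RtoC (qpoch a q n).
Proof.
  induction n as [|n IH]; [reflexivity|].
  simpl; rewrite IH, RtoC_mult, RtoC_minus, RtoC_mult; reflexivity.
Qed.

(** Real products are read as complex ones with zero imaginary part, so convergence and
    non-vanishing are inherited from [qpochC_cv]. *)
Lemma qpoch_cv (a q : R) : 0 < q < 1 -> Rabs a < 1 ->
  is_lim_seq (qpoch a q) (qpoch_inf a q) /\ qpochC_inf (RtoC a) q = RtoC (qpoch_inf a q)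
  /\ qpoch_inf a q <> 0.
Proof.
  intros hq ha.
  destruct (qpochC_cv q (RtoC a) hq) as [H H0]; [rewrite Cmod_R; exact ha|].
  apply filterlim_C_components in H; destruct H as [H1 H2].
  assert (H3 : is_lim_seq (qpoch a q) (fst (qpochC_inf (RtoC a) q))).
  { eapply is_lim_seq_ext; [|exact H1].
    intros n; cbv beta; rewrite qpochC_RtoC; reflexivity. }
  assert (H4 : snd (qpochC_inf (RtoC a) q) = 0).
  { assert (H5 : Finite (snd (qpochC_inf (RtoC a) q)) = Finite 0).
    { rewrite <- (is_lim_seq_unique _ _ H2), <- (Lim_seq_const 0).
      apply Lim_seq_ext; intros n; cbv beta; rewrite qpochC_RtoC; reflexivity. }
    injection H5; auto. }
  assert (H5 : qpoch_inf a q = fst (qpochC_inf (RtoC a) q)).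
  { unfold qpoch_inf.
    rewrite (is_lim_seq_unique (fun n => qpoch a q n) _ H3); reflexivity. }
  assert (H6 : qpochC_inf (RtoC a) q = RtoC (qpoch_inf a q)).
  { rewrite H5; destruct (qpochC_inf (RtoC a) q) as [x y]; simpl in *.
    rewrite H4; reflexivity. }
  split; [rewrite H5; exact H3|split; [exact H6|]].
  intros H7; apply H0; rewrite H6, H7; reflexivity.
Qed.

Lemma Cexpi_plus (x y : R) : Cexpi (x + y) = (Cexpi x * Cexpi y)%C.
Proof.
  unfold Cexpi, Cmult; simpl; rewrite cos_plus, sin_plus; f_equal; ring.
Qed.

Lemma Cexpi_pow (x : R) (n : nat) : (Cexpi x ^ n)%C = Cexpi (INR n * x).
Proof.
  induction n as [|n IH].
  - simpl; unfold Cexpi; rewrite Rmult_0_l, cos_0, sin_0; reflexivity.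
  - rewrite S_INR, Rmult_plus_distr_r, Rmult_1_l, Rplus_comm, Cexpi_plus, <- IH.
    reflexivity.
Qed.

Lemma Cmod_Cexpi (x : R) : Cmod (Cexpi x) = 1.
Proof.
  unfold Cmod, Cexpi; simpl.
  replace (cos x * (cos x * 1) + sin x * (sin x * 1)) with (Rsqr (sin x) + Rsqr (cos x))
    by (unfold Rsqr; ring).
  rewrite sin2_cos2; apply sqrt_1.
Qed.

(* Taylor coefficients of [(q u; q)_oo / (- q u; q)_oo] in [u]. *)
Definition acoef (q : R) (j : nat) : R := (- q) ^ j * binom_coef (- (1)) q j.

(** With [X = cosm th] and [X = sinm th] these are the real and imaginary parts of the series at
    [u = exp (2 i th)]. Leaving the sequence [X] free lets one argument serve both. *)
Definition aseries (q : R) (X : nat -> R) : R := Series (fun j => acoef q j * X (2 * j)%nat).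

Definition cosm (th : R) (m : nat) : R := cos (INR m * th).
Definition sinm (th : R) (m : nat) : R := sin (INR m * th).

(** The product of all [gam_n], as [Aprod_cv] shows. *)
Definition Ainf (q : R) : R := qpoch_inf q q / qpoch_inf (- q) q.

(** The products that depend on [th] have the quotient [(- v; q)_oo / (v; q)_oo] with
    [v = - q exp (2 i th)]. By [q_binomial] with [c = 1] this is the series [F], and the remaining
    products give [Ainf q]. *)
Lemma weight_eq (q th : R) : 0 < q < 1 ->
  weight q th = Ainf q ^ 2 * (aseries q (cosm th) ^ 2 + aseries q (sinm th) ^ 2).
Proof.
  intros hq.
  set (v := (RtoC (- q) * Cexpi (2 * th))%C).
  assert (hv : Cmod v < 1).
  { unfold v; rewrite Cmod_mult, Cmod_R, Cmod_Cexpi, Rabs_Ropp, Rabs_pos_eq by lra; lra. }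
  destruct (qpoch_cv q q hq) as [_ [E1 N1]]; [rewrite Rabs_pos_eq; lra|].
  destruct (qpoch_cv (- q) q hq) as [_ [E2 N2]]; [rewrite Rabs_Ropp, Rabs_pos_eq; lra|].
  destruct (qpochC_cv q v hq hv) as [_ N3].
  pose proof (q_binomial 1 q v hq ltac:(lra) hv) as E3.
  assert (hb : forall k, Rabs (binom_coef (- (1)) q k) <= exp (1 / (1 - q)) / qpoch_lower q)
    by (intros k; apply binom_coef_bound; lra).
  pose proof (psum_correct _ _ v hb hv) as HS.
  set (F := psum (binom_coef (- (1)) q) v) in *.
  assert (Hv : forall k, (RtoC (binom_coef (- (1)) q k) * v ^ k)%C
                = (acoef q k * cosm th (2 * k), acoef q k * sinm th (2 * k))).
  { intros k; unfold v; rewrite Cpow_mult_l, Cexpi_pow, <- RtoC_pow.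
    unfold acoef, cosm, sinm, Cexpi, Cmult, RtoC; simpl fst; simpl snd.
    rewrite mult_INR; simpl (INR 2).
    replace ((1 + 1) * INR k * th) with (INR k * (2 * th)) by ring.
    f_equal; ring. }
  assert (HF : F = (aseries q (cosm th), aseries q (sinm th))).
  { rewrite (surjective_pairing F); unfold aseries.
    f_equal; symmetry; apply is_series_unique.
    - eapply is_series_ext; [|exact (is_series_fst _ _ HS)].
      intros k; cbv beta; rewrite Hv; reflexivity.
    - eapply is_series_ext; [|exact (is_series_snd _ _ HS)].
      intros k; cbv beta; rewrite Hv; reflexivity. }
  unfold weight; fold v.
  replace (RtoC q * Cexpi (2 * th))%C with (RtoC (- (1)) * v)%C
    by (unfold v; rewrite !RtoC_opp; ring).
  rewrite <- E3, E1, E2.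
  assert (RtoC (qpoch_inf (- q) q) <> 0%C)
    by (intros H; apply N2, RtoC_inj; exact H).
  replace (RtoC (qpoch_inf q q) * (qpochC_inf v q * F) / (RtoC (qpoch_inf (- q) q) * qpochC_inf v q))%C
    with (RtoC (Ainf q) * F)%C.
  2:{ unfold Ainf; rewrite RtoC_div by exact N2; field; auto. }
  rewrite Cmod_mult, Rpow_mult_distr, Cmod_R, Cmod2_alt, HF.
  rewrite <- Rsqr_pow2, <- Rsqr_abs, Rsqr_pow2; reflexivity.
Qed.

(** * The solution of the recurrence that decays inside the unit disc *)

(** [tanh (kappa n)] written in [q = exp (- 2 kappa)], see [gam_gq]; the recurrences become rational
    identities in powers of [q]. *)
Definition gq (q : R) (n : nat) : R := (1 - q ^ n) / (1 + q ^ n).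

Lemma gq_S_bounds (q : R) (n : nat) : 0 < q < 1 -> 0 < gq q (S n) < 1.
Proof.
  intros hq; unfold gq; pose proof (pow_S_lt_1 q n hq).
  split; [apply Rdiv_lt_0_compat; lra|].
  apply Rmult_lt_reg_r with (1 + q ^ S n); [lra|].
  unfold Rdiv; rewrite Rmult_assoc, Rinv_l; lra.
Qed.

Lemma gq_0 (q : R) : gq q 0 = 0.
Proof. unfold gq; simpl; field. Qed.

Definition Aprod (q : R) (n : nat) : R := qpoch q q n / qpoch (- q) q n.

Lemma Aprod_S (q : R) (n : nat) : 0 < q < 1 -> Aprod q (S n) = gq q (S n) * Aprod q n.
Proof.
  intros hq; unfold Aprod, gq; simpl qpoch; simpl pow.
  pose proof (qpoch_opp_ge_1 q q n hq ltac:(lra)).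
  pose proof (pow_S_lt_1 q n hq) as H1; simpl in H1.
  field; lra.
Qed.

Lemma Aprod_bounds (q : R) (n : nat) : 0 < q < 1 -> 0 < Aprod q n <= 1.
Proof.
  intros hq; induction n as [|n IH]; [unfold Aprod; simpl; lra|].
  rewrite Aprod_S by exact hq; pose proof (gq_S_bounds q n hq); nra.
Qed.

Lemma Aprod_cv (q : R) : 0 < q < 1 -> is_lim_seq (Aprod q) (Ainf q).
Proof.
  intros hq.
  destruct (qpoch_cv q q hq) as [L1 [_ N1]]; [rewrite Rabs_pos_eq; lra|].
  destruct (qpoch_cv (- q) q hq) as [L2 [_ N2]]; [rewrite Rabs_Ropp, Rabs_pos_eq; lra|].
  apply is_lim_seq_div' with (1 := L1) (2 := L2); exact N2.
Qed.

Definition Rratio (q : R) (n j : nat) : R := qpoch (q ^ n) q j / qpoch (- q ^ S n) q j.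

(** Each factor [(1 - x) / (1 + x q)] with [x = q ^ (n + j)] lies between [1 - 2 x] and [1], so the
    product loses at most twice a geometric sum. The loss is of order [q ^ n] uniformly in [j]. *)
Lemma Rratio_bounds (q : R) (n j : nat) : 0 < q < 1 ->
  0 <= Rratio q n j <= 1 /\ 1 - Rratio q n j <= 2 * q ^ n * (1 - q ^ j) / (1 - q).
Proof.
  intros hq; induction j as [|j IH].
  - unfold Rratio; simpl.
    replace (2 * q ^ n * (1 - 1) / (1 - q)) with 0 by (field; lra); lra.
  - set (x := q ^ n * q ^ j).
    assert (hx : 0 < x <= 1).
    { unfold x; rewrite <- pow_add; apply pow_unit_interval, hq. }
    assert (E : Rratio q n (S j) = Rratio q n j * ((1 - x) / (1 + x * q))).
    { unfold Rratio; simpl qpoch; simpl pow.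
      pose proof (qpoch_opp_ge_1 (q ^ S n) q j hq) as H.
      pose proof (pow_S_lt_1 q n hq) as H1; simpl in H, H1.
      unfold x in *; field; split; [|lra]. nra. }
    assert (F : 1 - 2 * x <= (1 - x) / (1 + x * q)).
    { apply Rmult_le_reg_r with (1 + x * q); [nra|].
      unfold Rdiv; rewrite Rmult_assoc, Rinv_l by nra; nra. }
    assert (F2 : 0 <= (1 - x) / (1 + x * q) <= 1).
    { split; [apply Rdiv_le_0_compat; nra|].
      apply Rmult_le_reg_r with (1 + x * q); [nra|].
      unfold Rdiv; rewrite Rmult_assoc, Rinv_l by nra; nra. }
    replace (2 * q ^ n * (1 - q ^ S j) / (1 - q))
      with (2 * q ^ n * (1 - q ^ j) / (1 - q) + 2 * x) by (unfold x; simpl; field; lra).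
    rewrite E; destruct IH as [IH1 IH2]; split; [nra|].
    set (f := (1 - x) / (1 + x * q)) in *. nra.
Qed.

Definition Rcoef (q : R) (n j : nat) : R := Aprod q n * acoef q j * Rratio q n j.

Lemma acoef_S (q : R) (j : nat) : 0 < q < 1 ->
  acoef q (S j) * (1 - q ^ S j) = - (q + q ^ S j) * acoef q j.
Proof.
  intros hq; unfold acoef; simpl pow at 1.
  transitivity (- q * (- q) ^ j * (binom_coef (- (1)) q (S j) * (1 - q ^ S j))); [ring|].
  rewrite (binom_coef_S _ q j hq); simpl; ring.
Qed.

(** Coefficient of the lowest power [z ^ n] in [(z + 1/z) R_(n+1) = gam_(n+1) (R_(n+2) + R_n)]. *)
Lemma Rcoef_0 (q : R) (n : nat) : 0 < q < 1 ->
  Rcoef q (S n) 0 = gq q (S n) * Rcoef q n 0.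
Proof.
  intros hq; unfold Rcoef; rewrite Aprod_S by exact hq.
  unfold Rratio; simpl; field.
Qed.

(** Coefficient of [z ^ (n + 2 k + 2)] in the same recurrence. *)
Lemma Rcoef_S (q : R) (n k : nat) : 0 < q < 1 ->
  Rcoef q (S n) (S k) + Rcoef q (S n) k
  = gq q (S n) * (Rcoef q n (S k) + Rcoef q (S (S n)) k).
Proof.
  intros hq; unfold Rcoef.
  rewrite (Aprod_S q (S n)), (Aprod_S q n) by exact hq.
  pose proof (gq_S_bounds q n hq) as Hg; pose proof (Aprod_bounds q n hq) as HA.
  enough (H : acoef q (S k) * Rratio q (S n) (S k) + acoef q k * Rratio q (S n) k
     = acoef q (S k) * Rratio q n (S k)
       + gq q (S n) * gq q (S (S n)) * (acoef q k * Rratio q (S (S n)) k)).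
  { transitivity (gq q (S n) * Aprod q n *
      (acoef q (S k) * Rratio q (S n) (S k) + acoef q k * Rratio q (S n) k)); [ring|].
    rewrite H; ring. }
  unfold Rratio.
  pose proof (acoef_S q k hq) as Ha.
  rewrite (qpoch_S_l (q ^ n)), (qpoch_S_l (- q ^ S n)).
  replace (q ^ n * q) with (q ^ S n) by (simpl; ring).
  replace (- q ^ S n * q) with (- q ^ S (S n)) by (simpl; ring).
  pose proof (qpoch_S_l (q ^ S n) q k) as E1.
  pose proof (qpoch_S_l (- q ^ S (S n)) q k) as E2.
  replace (q ^ S n * q) with (q ^ S (S n)) in E1 by (simpl; ring).
  replace (- q ^ S (S n) * q) with (- q ^ S (S (S n))) in E2 by (simpl; ring).
  pose proof (pow_S_lt_1 q n hq) as B1.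
  pose proof (pow_S_lt_1 q (S n) hq) as B2.
  pose proof (pow_S_lt_1 q k hq) as B3.
  pose proof (qpoch_opp_ge_1 (q ^ S (S n)) q k hq ltac:(lra)) as P2.
  pose proof (qpoch_opp_ge_1 (q ^ S (S (S n))) q k hq
                ltac:(pose proof (pow_S_lt_1 q (S (S n)) hq); lra)) as P3.
  change (qpoch (q ^ S n) q (S k)) with (qpoch (q ^ S n) q k * (1 - q ^ S n * q ^ k))
    in E1 |- *.
  change (qpoch (- q ^ S (S n)) q (S k))
    with (qpoch (- q ^ S (S n)) q k * (1 - - q ^ S (S n) * q ^ k)) in E2 |- *.
  set (U := qpoch (q ^ S n) q k) in *.
  set (U2 := qpoch (q ^ S (S n)) q k) in *.
  set (V := qpoch (- q ^ S (S n)) q k) in *.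
  set (V3 := qpoch (- q ^ S (S (S n))) q k) in *.
  (* All shifted products are expressed through [U], [V] and [acoef q k], which leaves a rational
     identity in [q], [a = q ^ n] and [b = q ^ k]. *)
  assert (HU2 : U2 = U * (1 - q ^ S n * q ^ k) / (1 - q ^ S n)).
  { apply Rmult_eq_reg_l with (1 - q ^ S n); [|lra]. rewrite <- E1; field; lra. }
  assert (HV3 : V3 = V * (1 - - q ^ S (S n) * q ^ k) / (1 + q ^ S (S n))).
  { apply Rmult_eq_reg_l with (1 - - q ^ S (S n)); [|lra]. rewrite <- E2; field; lra. }
  assert (Hak : acoef q (S k) = - (q + q ^ S k) * acoef q k / (1 - q ^ S k)).
  { rewrite <- Ha; field; lra. }
  rewrite HU2, HV3, Hak; unfold gq; simpl pow in *.
  pose proof (pow_unit_interval q n hq); pose proof (pow_unit_interval q k hq).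
  set (a := q ^ n) in *; set (b := q ^ k) in *.
  assert (0 < a * b) by (apply Rmult_lt_0_compat; lra).
  assert (0 < q * (q * a) * b) by (repeat apply Rmult_lt_0_compat; lra).
  field; repeat split; nra.
Qed.

(** * Convergence and recurrence of the series [R_n] *)

Definition amax (q : R) : R := exp (1 / (1 - q)) / qpoch_lower q.

Lemma amax_pos (q : R) : 0 < amax q.
Proof. apply Rdiv_lt_0_compat; apply exp_pos. Qed.

Lemma acoef_bound (q : R) (j : nat) : 0 < q < 1 -> Rabs (acoef q j) <= amax q * q ^ j.
Proof.
  intros hq; unfold acoef.
  rewrite Rabs_mult, <- RPow_abs, Rabs_Ropp, (Rabs_pos_eq q), Rmult_comm by lra.
  apply Rmult_le_compat_r; [apply pow_le; lra|].
  apply binom_coef_bound; lra.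
Qed.

Lemma Rcoef_bound (q : R) (n j : nat) : 0 < q < 1 -> Rabs (Rcoef q n j) <= amax q * q ^ j.
Proof.
  intros hq; unfold Rcoef.
  pose proof (Aprod_bounds q n hq); destruct (Rratio_bounds q n j hq) as [H1 _].
  pose proof (acoef_bound q j hq); pose proof (Rabs_pos (acoef q j)).
  rewrite !Rabs_mult, (Rabs_pos_eq (Aprod q n)), (Rabs_pos_eq (Rratio q n j)) by lra.
  assert (Aprod q n * Rabs (acoef q j) <= Rabs (acoef q j)) by nra.
  assert (0 <= Aprod q n * Rabs (acoef q j)) by nra. nra.
Qed.

Lemma ex_series_geom_dominated (b : nat -> R) (M q : R) :
  0 < q < 1 -> (forall j, Rabs (b j) <= M * q ^ j) -> ex_series (fun j => Rabs (b j)).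
Proof.
  intros hq H; apply (ex_series_le (V := R_CompleteNormedModule)) with (b := fun j => M * q ^ j).
  - intros j; change (Rabs (Rabs (b j)) <= M * q ^ j); rewrite Rabs_Rabsolu; apply H.
  - apply (ex_series_scal (V := R_NormedModule)), ex_series_geom; rewrite Rabs_pos_eq; lra.
Qed.

Lemma Series_geom_dominated (b : nat -> R) (M q : R) :
  0 < q < 1 -> (forall j, Rabs (b j) <= M * q ^ j) -> Rabs (Series b) <= M / (1 - q).
Proof.
  intros hq H.
  eapply Rle_trans; [apply Series_Rabs, (ex_series_geom_dominated b M q hq H)|].
  unfold Rdiv; rewrite <- (Series_geom q) by (rewrite Rabs_pos_eq; lra).
  rewrite <- Series_scal_l.
  apply Series_le.
  - intros j; split; [apply Rabs_pos|apply H].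
  - apply (ex_series_scal (V := R_NormedModule)), ex_series_geom; rewrite Rabs_pos_eq; lra.
Qed.

Lemma bounded_mult_dominated (b X : nat -> R) (M q : R) (s : nat -> nat) :
  (forall j, Rabs (b j) <= M * q ^ j) -> (forall m, Rabs (X m) <= 1) ->
  forall j, Rabs (b j * X (s j)) <= M * q ^ j.
Proof.
  intros H HX j; rewrite Rabs_mult.
  specialize (H j); specialize (HX (s j)).
  pose proof (Rabs_pos (b j)); pose proof (Rabs_pos (X (s j))); nra.
Qed.

(** The series [R_n] with [z ^ m] replaced by [X m]; cosines and sines give its real and imaginary
    parts. *)
Definition Rser (q : R) (n : nat) (X : nat -> R) : R :=
  Series (fun j => Rcoef q n j * X (n + 2 * j)%nat).

(** The index map [s] is free because the recurrence also involves sums with shifted frequencies. *)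
Lemma ex_Rser (q : R) (n : nat) (X : nat -> R) (s : nat -> nat) :
  0 < q < 1 -> (forall m, Rabs (X m) <= 1) ->
  ex_series (fun j => Rcoef q n j * X (s j)).
Proof.
  intros hq HX; apply ex_series_Rabs, (ex_series_geom_dominated _ (amax q) q hq).
  apply bounded_mult_dominated; [intros j; apply Rcoef_bound, hq|exact HX].
Qed.

Lemma ex_aseries (q : R) (X : nat -> R) (s : nat -> nat) :
  0 < q < 1 -> (forall m, Rabs (X m) <= 1) ->
  ex_series (fun j => acoef q j * X (s j)).
Proof.
  intros hq HX; apply ex_series_Rabs, (ex_series_geom_dominated _ (amax q) q hq).
  apply bounded_mult_dominated; [intros j; apply acoef_bound, hq|exact HX].
Qed.

(** The hypothesis on [c] is the action of [z + 1/z = 2 cos th] on the powers of [z]. Lining up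
    equal frequencies reduces the claim to [Rcoef_0] and [Rcoef_S]. *)
Lemma Rser_rec (q c : R) (n : nat) (X : nat -> R) :
  0 < q < 1 -> (forall m, Rabs (X m) <= 1) ->
  (forall m, c * X (S m) = X m + X (S (S m))) ->
  c * Rser q (S n) X = gq q (S n) * (Rser q (S (S n)) X + Rser q n X).
Proof.
  intros hq HX Hc; unfold Rser.
  assert (L : c * Series (fun j => Rcoef q (S n) j * X (S n + 2 * j)%nat)
     = Series (fun j => Rcoef q (S n) j * X (n + 2 * j)%nat)
       + Series (fun j => Rcoef q (S n) j * X (S (S n) + 2 * j)%nat)).
  { rewrite <- Series_scal_l, <- Series_plus by (apply ex_Rser; assumption).
    apply Series_ext; intros j.
    transitivity (Rcoef q (S n) j * (c * X (S (n + 2 * j)))); [simpl; ring|].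
    rewrite Hc; simpl; ring. }
  rewrite L.
  rewrite (Series_incr_1 (fun j => Rcoef q (S n) j * X (n + 2 * j)%nat)) by (apply ex_Rser; assumption).
  rewrite (Series_incr_1 (fun j => Rcoef q n j * X (n + 2 * j)%nat)) by (apply ex_Rser; assumption).
  assert (S2 : forall m, Series (fun j => Rcoef q m (S j) * X (n + 2 * S j)%nat)
                 = Series (fun j => Rcoef q m (S j) * X (S (S n) + 2 * j)%nat)).
  { intros m; apply Series_ext; intros j; f_equal; f_equal; lia. }
  rewrite !S2.
  assert (X1 : forall m, ex_series (fun j => Rcoef q m (S j) * X (S (S n) + 2 * j)%nat)).
  { intros m.
    apply (ex_series_ext (fun j => Rcoef q m (S j) * X (n + 2 * S j)%nat)).
    - intros j; f_equal; f_equal; lia.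
    - apply (ex_series_incr_1 (V := R_NormedModule) (fun j => Rcoef q m j * X (n + 2 * j)%nat)).
      apply ex_Rser; assumption. }
  rewrite Rcoef_0 by exact hq.
  rewrite Rplus_assoc, <- Series_plus by (apply X1 || apply ex_Rser; assumption).
  replace (gq q (S n) * (Series (fun j => Rcoef q (S (S n)) j * X (S (S n) + 2 * j)%nat)
      + (Rcoef q n 0 * X (n + 2 * 0)%nat
         + Series (fun j => Rcoef q n (S j) * X (S (S n) + 2 * j)%nat))))
    with (gq q (S n) * Rcoef q n 0 * X (n + 2 * 0)%nat
      + gq q (S n) * (Series (fun j => Rcoef q n (S j) * X (S (S n) + 2 * j)%nat)
         + Series (fun j => Rcoef q (S (S n)) j * X (S (S n) + 2 * j)%nat))) by ring.
  f_equal.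
  rewrite <- Series_plus, <- Series_scal_l by (apply X1 || apply ex_Rser; assumption).
  apply Series_ext; intros j.
  rewrite <- !Rmult_plus_distr_r, Rcoef_S by exact hq; ring.
Qed.

(** For [n = 0] and [j >= 1] the factor [(q ^ n; q)_j = (1; q)_j] vanishes, so only the first term
    is left. *)
Lemma Rser_0 (q : R) (X : nat -> R) : Rser q 0 X = X 0%nat.
Proof.
  unfold Rser.
  assert (H : forall j, Rcoef q 0 (S j) = 0).
  { intros j; unfold Rcoef, Rratio; rewrite (qpoch_S_l (q ^ 0)); simpl (q ^ 0).
    unfold Rdiv; ring. }
  assert (HS : is_series (fun j => Rcoef q 0 j * X (0 + 2 * j)%nat) (X 0%nat)).
  { apply (is_lim_seq_ext (fun _ => X 0%nat) _ (X 0%nat)); [|apply is_lim_seq_const].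
    intros n; induction n as [|n IH].
    - rewrite sum_O; unfold Rcoef, Aprod, Rratio, acoef, binom_coef; simpl; field.
    - rewrite sum_Sn, <- IH, H; unfold plus; simpl; ring. }
  exact (is_series_unique _ _ HS).
Qed.

(** [Rratio] tends to [1] as [n] grows, so [R_n] approaches [A_n z ^ n] times the series of the
    weight, with an error of order [q ^ n]. *)
Lemma Rser_approx (q : R) (n : nat) (X : nat -> R) :
  0 < q < 1 -> (forall m, Rabs (X m) <= 1) ->
  Rabs (Rser q n X - Aprod q n * Series (fun j => acoef q j * X (n + 2 * j)%nat))
  <= 2 * amax q / (1 - q) ^ 2 * q ^ n.
Proof.
  intros hq HX; unfold Rser.
  rewrite <- Series_scal_l, <- Series_minus.
  2: apply ex_Rser; assumption.
  2: apply (ex_series_scal (V := R_NormedModule)), ex_aseries; assumption.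
  replace (2 * amax q / (1 - q) ^ 2 * q ^ n)
    with (2 * q ^ n / (1 - q) * amax q / (1 - q)) by (field; lra).
  apply Series_geom_dominated; [exact hq|].
  intros j.
  replace (Rcoef q n j * X (n + 2 * j)%nat - Aprod q n * (acoef q j * X (n + 2 * j)%nat))
    with (- ((1 - Rratio q n j) * (Aprod q n * (acoef q j * X (n + 2 * j)%nat))))
    by (unfold Rcoef; ring).
  pose proof (Aprod_bounds q n hq); destruct (Rratio_bounds q n j hq) as [H1 H2].
  pose proof (bounded_mult_dominated _ X (amax q) q (fun j => (n + 2 * j)%nat)
     (fun j => acoef_bound q j hq) HX j) as H3; cbv beta in H3.
  set (y := acoef q j * X (n + 2 * j)%nat) in *.
  rewrite Rabs_Ropp, !Rabs_mult, (Rabs_pos_eq (1 - _)), (Rabs_pos_eq (Aprod q n)) by lra.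
  replace (2 * q ^ n / (1 - q) * amax q * q ^ j)
    with (2 * q ^ n / (1 - q) * (amax q * q ^ j)) by ring.
  pose proof (Rabs_pos y); pose proof (pow_unit_interval q n hq); pose proof (pow_unit_interval q j hq).
  apply Rmult_le_compat; try nra.
  eapply Rle_trans; [exact H2|].
  apply Rmult_le_compat_r; [left; apply Rinv_0_lt_compat; lra|nra].
Qed.

(** * The Wronskian identity for the weight *)

Lemma cosm_bound (th : R) (m : nat) : Rabs (cosm th m) <= 1.
Proof. unfold cosm; apply Rabs_le; destruct (COS_bound (INR m * th)); lra. Qed.

Lemma sinm_bound (th : R) (m : nat) : Rabs (sinm th m) <= 1.
Proof. unfold sinm; apply Rabs_le; destruct (SIN_bound (INR m * th)); lra. Qed.

Lemma cosm_rec (th : R) (m : nat) :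
  2 * cos th * cosm th (S m) = cosm th m + cosm th (S (S m)).
Proof.
  unfold cosm; rewrite !S_INR.
  replace (INR m * th) with ((INR m + 1) * th - th) by ring.
  replace ((INR m + 1 + 1) * th) with ((INR m + 1) * th + th) by ring.
  rewrite cos_minus, cos_plus; ring.
Qed.

Lemma sinm_rec (th : R) (m : nat) :
  2 * cos th * sinm th (S m) = sinm th m + sinm th (S (S m)).
Proof.
  unfold sinm; rewrite !S_INR.
  replace (INR m * th) with ((INR m + 1) * th - th) by ring.
  replace ((INR m + 1 + 1) * th) with ((INR m + 1) * th + th) by ring.
  rewrite sin_minus, sin_plus; ring.
Qed.

(** Real part of [z ^ n F], with [F] the series of the weight; the next lemma is the imaginary
    part. *)
Lemma aseries_shift_cos (q th : R) (n : nat) : 0 < q < 1 ->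
  Series (fun j => acoef q j * cosm th (n + 2 * j))
  = cosm th n * aseries q (cosm th) - sinm th n * aseries q (sinm th).
Proof.
  intros hq; unfold aseries; rewrite <- !Series_scal_l, <- Series_minus.
  2: apply (ex_series_scal (V := R_NormedModule)), ex_aseries; [exact hq|apply cosm_bound].
  2: apply (ex_series_scal (V := R_NormedModule)), ex_aseries; [exact hq|apply sinm_bound].
  apply Series_ext; intros j; unfold cosm, sinm.
  rewrite plus_INR, Rmult_plus_distr_r, cos_plus; ring.
Qed.

Lemma aseries_shift_sin (q th : R) (n : nat) : 0 < q < 1 ->
  Series (fun j => acoef q j * sinm th (n + 2 * j))
  = sinm th n * aseries q (cosm th) + cosm th n * aseries q (sinm th).
Proof.
  intros hq; unfold aseries; rewrite <- !Series_scal_l, <- Series_plus.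
  2: apply (ex_series_scal (V := R_NormedModule)), ex_aseries; [exact hq|apply cosm_bound].
  2: apply (ex_series_scal (V := R_NormedModule)), ex_aseries; [exact hq|apply sinm_bound].
  apply Series_ext; intros j; unfold cosm, sinm.
  rewrite plus_INR, Rmult_plus_distr_r, sin_plus; ring.
Qed.

(** In the recurrence both neighbours carry the same coefficient [gq q (S n)], so the determinant of
    two solutions is the same at every step. At [n = 0] it is evaluated by [R_0 = 1]. *)
Lemma Rser_wronskian (q th : R) (n : nat) : 0 < q < 1 ->
  Rser q (S n) (sinm th) * Rser q n (cosm th) - Rser q (S n) (cosm th) * Rser q n (sinm th)
  = Rser q 1 (sinm th).
Proof.
  intros hq; induction n as [|n IH].
  - assert (E1 : cosm th 0 = 1) by (unfold cosm; simpl; rewrite Rmult_0_l; apply cos_0).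
    assert (E2 : sinm th 0 = 0) by (unfold sinm; simpl; rewrite Rmult_0_l; apply sin_0).
    rewrite !Rser_0, E1, E2; ring.
  - rewrite <- IH.
    pose proof (Rser_rec q (2 * cos th) n (cosm th) hq (cosm_bound th) (cosm_rec th)) as Hc.
    pose proof (Rser_rec q (2 * cos th) n (sinm th) hq (sinm_bound th) (sinm_rec th)) as Hs.
    pose proof (gq_S_bounds q n hq).
    apply Rmult_eq_reg_l with (gq q (S n)); [|lra].
    transitivity ((gq q (S n) * (Rser q (S (S n)) (sinm th) + Rser q n (sinm th)))
                   * Rser q (S n) (cosm th)
      - (gq q (S n) * (Rser q (S (S n)) (cosm th) + Rser q n (cosm th))) * Rser q (S n) (sinm th)
      + gq q (S n) * (Rser q (S n) (sinm th) * Rser q n (cosm th)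
                      - Rser q (S n) (cosm th) * Rser q n (sinm th))); [ring|].
    rewrite <- Hc, <- Hs; ring.
Qed.

Lemma sin_weight_eq (q th : R) : 0 < q < 1 ->
  sin th * weight q th = Rser q 1 (sinm th).
Proof.
  intros hq; rewrite weight_eq by exact hq.
  set (Fc := aseries q (cosm th)); set (Fs := aseries q (sinm th)).
  set (Q := Fc ^ 2 + Fs ^ 2).
  set (B := amax q / (1 - q)); set (K := 2 * amax q / (1 - q) ^ 2).
  pose proof (amax_pos q) as HM.
  assert (HB : 0 <= B) by (apply Rdiv_le_0_compat; lra).
  assert (HK : 0 <= K) by (apply Rdiv_le_0_compat; [lra|apply pow_lt; lra]).
  (* [ec] and [es] are the leading parts of [Re R_n] and [Im R_n] for large [n]. *)
  set (ec := fun n => Aprod q n * (cosm th n * Fc - sinm th n * Fs)).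
  set (es := fun n => Aprod q n * (sinm th n * Fc + cosm th n * Fs)).
  assert (Hec : forall n, Rabs (Rser q n (cosm th) - ec n) <= K * q ^ n).
  { intros n; unfold ec, Fc, Fs; rewrite <- aseries_shift_cos by exact hq.
    apply Rser_approx; [exact hq|apply cosm_bound]. }
  assert (Hes : forall n, Rabs (Rser q n (sinm th) - es n) <= K * q ^ n).
  { intros n; unfold es, Fc, Fs; rewrite <- aseries_shift_sin by exact hq.
    apply Rser_approx; [exact hq|apply sinm_bound]. }
  assert (Bc : forall n, Rabs (Rser q n (cosm th)) <= B).
  { intros n; apply Series_geom_dominated; [exact hq|].
    apply bounded_mult_dominated; [intros j; apply Rcoef_bound, hq|apply cosm_bound]. }
  assert (Bs : forall n, Rabs (Rser q n (sinm th)) <= B).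
  { intros n; apply Series_geom_dominated; [exact hq|].
    apply bounded_mult_dominated; [intros j; apply Rcoef_bound, hq|apply sinm_bound]. }
  (* The Wronskian of the leading parts is exact, because [z ^ (n + 1)] times the conjugate of
     [z ^ n] is [z]. *)
  assert (He : forall n, es (S n) * ec n - ec (S n) * es n = Aprod q n * Aprod q (S n) * (Q * sin th)).
  { intros n; unfold es, ec, Q.
    replace (sin th) with (sinm th (S n) * cosm th n - cosm th (S n) * sinm th n).
    - pose proof (sin2_cos2 (INR n * th)); unfold Rsqr in *; ring.
    - unfold sinm, cosm; rewrite S_INR, <- sin_minus; f_equal; ring. }
  (* Replacing the leading parts by [R_n] changes four factors in turn. Each change costs at most
     [K * q ^ n], times a cofactor of size at most [B + K]. *)
  assert (Hd : forall n, Rabs (Aprod q n * Aprod q (S n) * (Q * sin th) - Rser q 1 (sinm th))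
                         <= 4 * K * (B + K) * q ^ n).
  { intros n; rewrite <- He, <- (Rser_wronskian q th n hq).
    set (s1 := Rser q (S n) (sinm th)) in *; set (c0 := Rser q n (cosm th)) in *.
    set (c1 := Rser q (S n) (cosm th)) in *; set (s0 := Rser q n (sinm th)) in *.
    pose proof (pow_unit_interval q n hq) as Hq.
    pose proof (Hec n) as A1; pose proof (Hes n) as A2.
    pose proof (Hec (S n)) as A3; pose proof (Hes (S n)) as A4.
    pose proof (Bc n) as B1; pose proof (Bs n) as B2.
    pose proof (Bc (S n)) as B3; pose proof (Bs (S n)) as B4.
    fold s0 in A2, B2; fold s1 in A4, B4; fold c0 in A1, B1; fold c1 in A3, B3.
    assert (HqS : q ^ S n <= q ^ n) by (simpl; nra).
    assert (A3' : Rabs (c1 - ec (S n)) <= K * q ^ n) by nra.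
    assert (A4' : Rabs (s1 - es (S n)) <= K * q ^ n) by nra.
    set (y := K * q ^ n) in *.
    assert (hy : 0 <= y <= K) by (unfold y; nra).
    replace (es (S n) * ec n - ec (S n) * es n - (s1 * c0 - c1 * s0))
      with (- (s1 - es (S n)) * c0 - es (S n) * (c0 - ec n)
            + (c1 - ec (S n)) * s0 + ec (S n) * (s0 - es n)) by ring.
    assert (E1 : Rabs (es (S n)) <= B + K).
    { replace (es (S n)) with (s1 - (s1 - es (S n))) by ring.
      unfold Rminus at 1; eapply Rle_trans; [apply Rabs_triang|].
      rewrite Rabs_Ropp; lra. }
    assert (E2 : Rabs (ec (S n)) <= B + K).
    { replace (ec (S n)) with (c1 - (c1 - ec (S n))) by ring.
      unfold Rminus at 1; eapply Rle_trans; [apply Rabs_triang|].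
      rewrite Rabs_Ropp; lra. }
    assert (T : forall a b, Rabs a <= y -> Rabs b <= B + K -> Rabs (a * b) <= y * (B + K)).
    { intros a b Ha Hb; rewrite Rabs_mult.
      apply Rmult_le_compat; auto using Rabs_pos. }
    replace (4 * K * (B + K) * q ^ n)
      with (y * (B + K) + y * (B + K) + y * (B + K) + y * (B + K)) by (unfold y; ring).
    eapply Rle_trans; [apply Rabs_triang|]; apply Rplus_le_compat.
    2:{ rewrite Rmult_comm; apply T; auto. }
    eapply Rle_trans; [apply Rabs_triang|]; apply Rplus_le_compat.
    2:{ apply T; lra. }
    unfold Rminus at 1; eapply Rle_trans; [apply Rabs_triang|]; apply Rplus_le_compat.
    - apply T; [rewrite Rabs_Ropp; exact A4'|lra].
    - rewrite Rabs_Ropp, Rmult_comm; apply T; auto. }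
  assert (L1 : is_lim_seq (fun n => Aprod q n * Aprod q (S n) * (Q * sin th))
                 (Ainf q * Ainf q * (Q * sin th))).
  { apply (is_lim_seq_mult' _ _ _ _).
    - apply (is_lim_seq_mult' _ _ _ _); [apply Aprod_cv, hq|].
      apply (is_lim_seq_incr_1 (Aprod q)), Aprod_cv, hq.
    - apply is_lim_seq_const. }
  assert (L2 : is_lim_seq (fun n => Aprod q n * Aprod q (S n) * (Q * sin th)) (Rser q 1 (sinm th))).
  { apply is_lim_seq_spec; intros eps.
    assert (Lq : is_lim_seq (fun n => 4 * K * (B + K) * q ^ n) 0).
    { replace (Finite 0) with (Rbar_mult (4 * K * (B + K)) 0) by (simpl; f_equal; ring).
      apply is_lim_seq_scal_l, is_lim_seq_geom; rewrite Rabs_pos_eq; lra. }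
    apply is_lim_seq_spec in Lq; destruct (Lq eps) as [N HN]; exists N; intros n Hn.
    specialize (HN n Hn); rewrite Rminus_0_r in HN.
    eapply Rle_lt_trans; [apply Hd|].
    eapply Rle_lt_trans; [apply Rle_abs|exact HN]. }
  (* One sequence with two limits: [Ainf q ^ 2 * Q * sin th], which is [sin th] times the weight,
     and [Im R_1]. *)
  apply is_lim_seq_unique in L1; apply is_lim_seq_unique in L2.
  rewrite L1 in L2; injection L2; intros E; rewrite <- E; ring.
Qed.

(** * The polynomials *)

(** With these coefficients [pn q (S N)] is the Rogers (continuous q-ultraspherical) polynomial of
    degree [N] in [cos th], with parameter [beta = - q]. *)
Definition pcoef (q : R) (k : nat) : R := binom_coef (- q) q k.

(* [pn q n] is [P_n] without the factor [sqrt (gam_1 / gam_n)], extended by [pn q 0 = 0]. *)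
Definition pn (q : R) (n : nat) (th : R) : R :=
  match n with
  | O => 0
  | S N => sum_f_R0 (fun k => pcoef q k * pcoef q (N - k) * cos ((2 * INR k - INR N) * th)) N
  end.

Lemma pcoef_S (q : R) (k : nat) : 0 < q < 1 ->
  pcoef q (S k) = (1 + q ^ S k) / (1 - q ^ S k) * pcoef q k.
Proof.
  intros hq; unfold pcoef; pose proof (pow_S_lt_1 q k hq).
  apply Rmult_eq_reg_r with (1 - q ^ S k); [|lra].
  rewrite (binom_coef_S _ q k hq); simpl in *; field; lra.
Qed.

(** An addition formula: [(1 + q ^ m) / (1 - q ^ m)] is [coth (kappa m)], and [coth x + coth y =
    tanh (x + y) (1 + coth x coth y)]. *)
Lemma pcoef_rec (q : R) (k l : nat) : 0 < q < 1 ->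
  pcoef q k * pcoef q (S l) + pcoef q (S k) * pcoef q l
  = gq q (S (S (k + l))) * (pcoef q (S k) * pcoef q (S l) + pcoef q k * pcoef q l).
Proof.
  intros hq; rewrite !pcoef_S by exact hq.
  pose proof (pow_S_lt_1 q k hq); pose proof (pow_S_lt_1 q l hq).
  unfold gq; replace (q ^ S (S (k + l))) with (q ^ S k * q ^ S l)
    by (simpl; rewrite pow_add; ring).
  set (a := q ^ S k) in *; set (b := q ^ S l) in *.
  assert (0 < a * b < 1) by nra.
  field; lra.
Qed.

Lemma cos_mult_two (x th : R) :
  2 * cos th * cos (x * th) = cos ((x + 1) * th) + cos ((x - 1) * th).
Proof.
  rewrite Rmult_plus_distr_r, Rmult_minus_distr_r, Rmult_1_l, cos_plus, cos_minus; ring.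
Qed.

(** Multiplication by [2 cos th] shifts each frequency by one in both directions. Inner frequencies
    are matched by [pcoef_rec], the two extreme ones by [Hend]; [N = 0] is separate because [pn q 0]
    is not a sum. *)
Lemma pn_rec (q th : R) (N : nat) : 0 < q < 1 ->
  2 * cos th * pn q (S N) th = gq q (S N) * (pn q (S (S N)) th + pn q N th).
Proof.
  intros hq; pose proof (pow_S_lt_1 q N hq) as HN.
  assert (Hend : pcoef q N = gq q (S N) * pcoef q (S N)).
  { rewrite pcoef_S by exact hq; unfold gq; field; lra. }
  assert (H0 : pcoef q 0 = 1) by (unfold pcoef, binom_coef; simpl; field).
  destruct N as [|M].
  - rewrite H0 in Hend; simpl pn; rewrite H0.
    replace ((2 * 0 - 0) * th) with 0 by ring.
    replace ((2 * 0 - 1) * th) with (- th) by ring.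
    replace ((2 * 1 - 1) * th) with th by ring.
    rewrite cos_neg, cos_0.
    transitivity (2 * cos th * (gq q 1 * pcoef q 1)); [rewrite <- Hend; ring|ring].
  - set (N := S M) in *.
    set (Y := fun x : R => cos (x * th)).
    set (c := fun n k => pcoef q k * pcoef q (n - k)).
    assert (E1 : 2 * cos th * pn q (S N) th
       = sum_f_R0 (fun k => c N k * Y (2 * INR k + 1 - INR N)) N
         + sum_f_R0 (fun k => c N k * Y (2 * INR k - 1 - INR N)) N).
    { unfold pn; rewrite scal_sum, <- sum_plus; apply sum_eq; intros k _.
      unfold c, Y.
      transitivity (pcoef q k * pcoef q (N - k) * (2 * cos th * cos ((2 * INR k - INR N) * th))); [ring|].
      rewrite cos_mult_two.
      replace (2 * INR k - INR N + 1) with (2 * INR k + 1 - INR N) by ring.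
      replace (2 * INR k - INR N - 1) with (2 * INR k - 1 - INR N) by ring.
      ring. }
    assert (E2 : sum_f_R0 (fun k => c N k * Y (2 * INR k + 1 - INR N)) N
       = sum_f_R0 (fun k => c N k * Y (2 * INR k + 1 - INR N)) M + c N N * Y (INR N + 1)).
    { etransitivity; [exact (tech5 _ M)|]; fold N; cbv beta; do 3 f_equal; ring. }
    assert (E3 : sum_f_R0 (fun k => c N k * Y (2 * INR k - 1 - INR N)) N
       = c N 0%nat * Y (- 1 - INR N)
         + sum_f_R0 (fun k => c N (S k) * Y (2 * INR k + 1 - INR N)) M).
    { rewrite decomp_sum by (unfold N; lia).
      replace (Init.Nat.pred N) with M by reflexivity.
      f_equal; [f_equal; f_equal; simpl (INR 0); ring|].
      apply sum_eq; intros k _; f_equal; f_equal; rewrite S_INR; ring. }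
    assert (E4 : pn q (S (S N)) th
       = c (S N) 0%nat * Y (- 1 - INR N)
         + sum_f_R0 (fun k => c (S N) (S k) * Y (2 * INR k + 1 - INR N)) M
         + c (S N) (S N) * Y (INR N + 1)).
    { unfold pn; fold N; rewrite tech5.
      rewrite decomp_sum by (unfold N; lia).
      replace (Init.Nat.pred N) with M by reflexivity.
      unfold c, Y; f_equal; [f_equal|].
      - f_equal; f_equal; rewrite S_INR; simpl (INR 0); ring.
      - apply sum_eq; intros k _; f_equal; f_equal; rewrite !S_INR; ring.
      - f_equal; f_equal; rewrite !S_INR; ring. }
    assert (E5 : pn q N th = sum_f_R0 (fun k => c M k * Y (2 * INR k + 1 - INR N)) M).
    { unfold pn, N; apply sum_eq; intros k _; unfold c, Y; f_equal; f_equal.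
      rewrite S_INR; ring. }
    rewrite E1, E2, E3, E4, E5.
    assert (E6 : sum_f_R0 (fun k => c N k * Y (2 * INR k + 1 - INR N)) M
       + sum_f_R0 (fun k => c N (S k) * Y (2 * INR k + 1 - INR N)) M
       = gq q (S N) * (sum_f_R0 (fun k => c (S N) (S k) * Y (2 * INR k + 1 - INR N)) M
       + sum_f_R0 (fun k => c M k * Y (2 * INR k + 1 - INR N)) M)).
    { rewrite <- !sum_plus, scal_sum; apply sum_eq; intros k Hk; unfold c, N.
      replace (S M - k)%nat with (S (M - k)) by lia.
      replace (S M - S k)%nat with (M - k)%nat by lia.
      replace (S (S M) - S k)%nat with (S (M - k)) by lia.
      rewrite <- !Rmult_plus_distr_r, (pcoef_rec q k (M - k) hq).
      replace (k + (M - k))%nat with M by lia.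
      ring. }
    assert (C0 : c N 0%nat = gq q (S N) * c (S N) 0%nat).
    { unfold c; rewrite !Nat.sub_0_r, H0, Hend; ring. }
    assert (CN : c N N = gq q (S N) * c (S N) (S N)).
    { unfold c; rewrite !Nat.sub_diag, H0, Hend; ring. }
    transitivity (c N 0%nat * Y (- 1 - INR N) + c N N * Y (INR N + 1) +
      (sum_f_R0 (fun k => c N k * Y (2 * INR k + 1 - INR N)) M
       + sum_f_R0 (fun k => c N (S k) * Y (2 * INR k + 1 - INR N)) M)); [ring|].
    rewrite E6, C0, CN; ring.
Qed.

Lemma pn_1 (q th : R) : pn q 1 th = 1.
Proof.
  unfold pn, pcoef, binom_coef; simpl.
  replace ((2 * 0 - 0) * th) with 0 by ring; rewrite cos_0; field.
Qed.

(** As functions of [n] both sides satisfy the same three-term recurrence, and they agree at [n = 0]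
    and [n = 1]. *)
Lemma sin_weight_pn (q th : R) (n : nat) : 0 < q < 1 ->
  sin th * weight q th * pn q n th = Rser q n (sinm th).
Proof.
  intros hq.
  enough (H : sin th * weight q th * pn q n th = Rser q n (sinm th)
           /\ sin th * weight q th * pn q (S n) th = Rser q (S n) (sinm th)) by apply H.
  induction n as [|n [IH1 IH2]].
  - rewrite pn_1, Rmult_1_r, sin_weight_eq, Rser_0 by exact hq.
    split; [|reflexivity].
    unfold sinm; simpl; rewrite Rmult_0_l, sin_0; ring.
  - split; [exact IH2|].
    pose proof (Rser_rec q (2 * cos th) n (sinm th) hq (sinm_bound th) (sinm_rec th)) as Hs.
    pose proof (pn_rec q th n hq) as Hp.
    pose proof (gq_S_bounds q n hq).
    apply Rmult_eq_reg_l with (gq q (S n)); [|lra].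
    transitivity (sin th * weight q th * (gq q (S n) * (pn q (S (S n)) th + pn q n th))
      - gq q (S n) * (sin th * weight q th * pn q n th)); [ring|].
    rewrite <- Hp, IH1.
    transitivity (2 * cos th * (sin th * weight q th * pn q (S n) th)
      - gq q (S n) * Rser q n (sinm th)); [ring|].
    rewrite IH2, Hs; ring.
Qed.

(** * Regularity of the weight *)

Lemma Rabs_sin_le (x : R) : Rabs (sin x) <= Rabs x.
Proof.
  assert (P : forall y, 0 <= y -> Rabs (sin y) <= y).
  { intros y [Hy|Hy]; [|subst; rewrite sin_0, Rabs_R0; lra].
    pose proof (sin_lt_x y Hy); pose proof PI2_1.
    destruct (Rle_dec y 1) as [H1|H1].
    - pose proof (sin_gt_0 y Hy ltac:(unfold Rdiv in *; lra)); rewrite Rabs_pos_eq; lra.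
    - destruct (SIN_bound y); apply Rabs_le; lra. }
  destruct (Rle_dec 0 x) as [H|H].
  - rewrite (Rabs_pos_eq x) by exact H; apply P, H.
  - rewrite <- (Rabs_Ropp x), <- (Rabs_Ropp (sin x)), <- sin_neg.
    rewrite (Rabs_pos_eq (- x)) by lra; apply P; lra.
Qed.

Lemma one_minus_cos (x : R) : 1 - cos x = 2 * sin (x / 2) ^ 2.
Proof.
  replace x with (2 * (x / 2)) at 1 by field.
  rewrite cos_2a_sin; ring.
Qed.

Lemma one_minus_cos_le (x : R) : 0 <= 1 - cos x <= x ^ 2 / 2.
Proof.
  rewrite one_minus_cos.
  assert (H1 : sin (x / 2) ^ 2 <= (x / 2) ^ 2).
  { rewrite <- (pow2_abs (sin _)), <- (pow2_abs (x / 2)).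
    apply pow_incr; split; [apply Rabs_pos|apply Rabs_sin_le]. }
  split; [pose proof (pow2_ge_0 (sin (x / 2))); lra|].
  replace (x ^ 2 / 2) with (2 * (x / 2) ^ 2) by field; lra.
Qed.

Lemma cos_lipschitz (x y : R) : Rabs (cos x - cos y) <= Rabs (x - y).
Proof.
  rewrite form2, !Rabs_mult.
  pose proof (Rabs_sin_le ((x - y) / 2)) as H1.
  assert (H2 : Rabs (sin ((x + y) / 2)) <= 1)
    by (apply Rabs_le; destruct (SIN_bound ((x + y) / 2)); lra).
  pose proof (Rabs_pos (sin ((x - y) / 2))); pose proof (Rabs_pos (sin ((x + y) / 2))).
  assert (E2 : Rabs ((x - y) / 2) = Rabs (x - y) / 2)
    by (unfold Rdiv; rewrite Rabs_mult, (Rabs_pos_eq (/ 2)); lra).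
  rewrite E2 in H1.
  assert (Rabs (sin ((x - y) / 2)) * Rabs (sin ((x + y) / 2)) <= Rabs (sin ((x - y) / 2))) by nra.
  replace (Rabs (-2)) with 2 by (rewrite Rabs_left; lra); lra.
Qed.

Lemma sin_lipschitz (x y : R) : Rabs (sin x - sin y) <= Rabs (x - y).
Proof.
  rewrite <- !cos_shift.
  replace (x - y) with (- ((PI / 2 - x) - (PI / 2 - y))) by ring.
  rewrite Rabs_Ropp; apply cos_lipschitz.
Qed.

Lemma INR_mult_pow_bounded (s : R) (j : nat) : 0 < s < 1 -> 0 <= INR j * s ^ j <= 1 / (1 - s).
Proof.
  intros hs; pose proof (pow_unit_interval s j hs); pose proof (pos_INR j).
  split; [nra|].
  apply Rmult_le_reg_r with (1 - s); [lra|].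
  unfold Rdiv; rewrite Rmult_assoc, (Rmult_assoc 1), Rinv_l, Rmult_1_r by lra.
  (* The sum [(1 - s ^ j) / (1 - s)] has [j] terms, each at least [s ^ j]. *)
  enough (INR j * s ^ j * (1 - s) <= 1 - s ^ j) by nra.
  induction j as [|j IH]; [simpl; lra|].
  pose proof (pow_unit_interval s j hs).
  specialize (IH ltac:(lra) (pos_INR j)).
  rewrite S_INR; simpl.
  apply (Rmult_le_compat_l s) in IH; [|lra].
  assert (0 <= (1 - s) * (1 - s * s ^ j)) by (apply Rmult_le_pos; nra).
  lra.
Qed.

(** With [s] the fourth root of [q] and [r = s ^ 2], one has [q ^ j = r ^ j s ^ j s ^ j], and each
    [s ^ j] absorbs one factor [j]. The square is what a second-order estimate of the cosines
    requires. *)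
Lemma acoef_square_dominated (q : R) : 0 < q < 1 ->
  exists B r, 0 <= B /\ 0 < r < 1 /\ forall j, Rabs (acoef q j) * INR j ^ 2 <= B * r ^ j.
Proof.
  intros hq.
  assert (sq : forall x, 0 < x < 1 -> 0 < sqrt x < 1).
  { intros x hx; split; [apply sqrt_lt_R0; lra|].
    rewrite <- sqrt_1; apply sqrt_lt_1; lra. }
  set (r := sqrt q); set (s := sqrt r).
  pose proof (sq q hq) as hr; fold r in hr.
  pose proof (sq r hr) as hs; fold s in hs.
  assert (Er : q = r * r) by (unfold r; rewrite sqrt_sqrt; lra).
  assert (Es : r = s * s) by (unfold s; rewrite sqrt_sqrt; lra).
  pose proof (amax_pos q).
  exists (amax q * (1 / (1 - s)) ^ 2), r.
  split; [apply Rmult_le_pos; [lra|apply pow2_ge_0]|split; [exact hr|]].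
  intros j; pose proof (acoef_bound q j hq).
  pose proof (INR_mult_pow_bounded s j hs) as [H1 H2].
  assert (H3 : (INR j * s ^ j) ^ 2 <= (1 / (1 - s)) ^ 2) by (apply pow_incr; lra).
  assert (E : q ^ j * INR j ^ 2 = (INR j * s ^ j) ^ 2 * r ^ j).
  { replace (q ^ j) with (r ^ j * r ^ j) by (rewrite <- Rpow_mult_distr, <- Er; reflexivity).
    replace (r ^ j) with (s ^ j * s ^ j) at 1 by (rewrite <- Rpow_mult_distr, <- Es; reflexivity).
    ring. }
  pose proof (pow_lt r j (proj1 hr)); pose proof (pow2_ge_0 (INR j)).
  apply Rle_trans with (amax q * q ^ j * INR j ^ 2); [nra|].
  rewrite Rmult_assoc, E.
  replace (amax q * (1 / (1 - s)) ^ 2 * r ^ j) with (amax q * ((1 / (1 - s)) ^ 2 * r ^ j)) by ring.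
  apply Rmult_le_compat_l; nra.
Qed.

(* [ring] does not see through the carriers of Coquelicot's structures on [R]. *)
Ltac Rring := match goal with |- ?a = ?b => change (@eq R a b) end; ring.

Lemma continuous_lipschitz (f : R -> R) (K : R) :
  (forall x y, Rabs (f x - f y) <= K * Rabs (x - y)) -> forall x, continuous f x.
Proof.
  intros H x.
  assert (HK : 0 <= K).
  { pose proof (H 1 0) as H1; rewrite Rminus_0_r, Rabs_R1 in H1.
    pose proof (Rabs_pos (f 1 - f 0)); lra. }
  apply (filterlim_locally f (f x)); intros eps.
  assert (Hd : 0 < eps / (K + 1)) by (apply Rdiv_lt_0_compat; [apply cond_pos|lra]).
  exists (mkposreal _ Hd); intros y Hy.
  change (Rabs (f y - f x) < eps); change (Rabs (y - x) < eps / (K + 1)) in Hy.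
  eapply Rle_lt_trans; [apply H|].
  apply Rle_lt_trans with ((K + 1) * Rabs (y - x)).
  - pose proof (Rabs_pos (y - x)); nra.
  - apply Rmult_lt_reg_r with (/ (K + 1)); [apply Rinv_0_lt_compat; lra|].
    replace ((K + 1) * Rabs (y - x) * / (K + 1)) with (Rabs (y - x)) by (field; lra).
    exact Hy.
Qed.

Lemma continuous_Rmult (f g : R -> R) (x : R) :
  continuous f x -> continuous g x -> continuous (fun y => f y * g y) x.
Proof. exact (continuous_mult (K := R_AbsRing) f g x). Qed.

Lemma continuous_Rplus (f g : R -> R) (x : R) :
  continuous f x -> continuous g x -> continuous (fun y => f y + g y) x.
Proof. exact (continuous_plus (V := R_NormedModule) f g x). Qed.

Lemma continuous_derivable (f : R -> R) (x : R) : ex_derive f x -> continuous f x.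
Proof. exact (ex_derive_continuous (V := R_NormedModule) f x). Qed.

Lemma continuous_sum_f_R0 (f : nat -> R -> R) (N : nat) (x : R) :
  (forall k, continuous (f k) x) -> continuous (fun y => sum_f_R0 (fun k => f k y) N) x.
Proof.
  intros H; induction N as [|N IH]; [apply H|].
  exact (continuous_Rplus _ _ x IH (H (S N))).
Qed.

Lemma aseries_diff_bound (q D r : R) (X Y : nat -> R) : 0 < q < 1 -> 0 < r < 1 ->
  (forall m, Rabs (X m) <= 1) -> (forall m, Rabs (Y m) <= 1) ->
  (forall j, Rabs (acoef q j) * Rabs (X (2 * j)%nat - Y (2 * j)%nat) <= D * r ^ j) ->
  Rabs (aseries q X - aseries q Y) <= D / (1 - r).
Proof.
  intros hq hr HX HY H; unfold aseries.
  rewrite <- Series_minus by (apply ex_aseries; assumption).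
  apply Series_geom_dominated; [exact hr|].
  intros j; rewrite <- Rmult_minus_distr_l, Rabs_mult; apply H.
Qed.

Lemma INR_le_square (j : nat) : INR j <= INR j ^ 2.
Proof.
  destruct j as [|j]; [simpl; lra|].
  pose proof (pos_INR j); rewrite S_INR; nra.
Qed.

Lemma aseries_lipschitz (q : R) : 0 < q < 1 ->
  exists K, forall x y,
    Rabs (aseries q (cosm x) - aseries q (cosm y)) <= K * Rabs (x - y) /\
    Rabs (aseries q (sinm x) - aseries q (sinm y)) <= K * Rabs (x - y).
Proof.
  intros hq; destruct (acoef_square_dominated q hq) as [B [r [hB [hr H]]]].
  exists (2 * B / (1 - r)); intros x y.
  replace (2 * B / (1 - r) * Rabs (x - y)) with (2 * Rabs (x - y) * B / (1 - r)) by (field; lra).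
  assert (E : forall j, Rabs (acoef q j) * Rabs (INR (2 * j) * x - INR (2 * j) * y)
             <= 2 * Rabs (x - y) * B * r ^ j).
  { intros j; rewrite <- Rmult_minus_distr_l, Rabs_mult, mult_INR.
    pose proof (pos_INR j); simpl (INR 2).
    rewrite (Rabs_pos_eq ((1 + 1) * INR j)) by lra.
    specialize (H j); pose proof (INR_le_square j); pose proof (Rabs_pos (acoef q j)).
    pose proof (Rabs_pos (x - y)).
    assert (Rabs (acoef q j) * INR j <= B * r ^ j) by nra.
    replace (Rabs (acoef q j) * ((1 + 1) * INR j * Rabs (x - y)))
      with (2 * Rabs (x - y) * (Rabs (acoef q j) * INR j)) by ring.
    rewrite (Rmult_assoc (2 * Rabs (x - y))).
    apply Rmult_le_compat_l; lra. }
  split; apply aseries_diff_bound; auto using cosm_bound, sinm_bound; intros j;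
    (eapply Rle_trans; [|apply E]); apply Rmult_le_compat_l; auto using Rabs_pos.
  - apply cos_lipschitz.
  - apply sin_lipschitz.
Qed.

(** Each cosine differs from [1] by at most half the square of its argument, so there is no linear
    term at [0]; the Lipschitz bound would be too weak for the asymptotics. *)
Lemma aseries_cos_flat (q : R) : 0 < q < 1 ->
  exists K, forall x, Rabs (aseries q (cosm x) - aseries q (cosm 0)) <= K * x ^ 2.
Proof.
  intros hq; destruct (acoef_square_dominated q hq) as [B [r [hB [hr H]]]].
  exists (2 * B / (1 - r)); intros x.
  replace (2 * B / (1 - r) * x ^ 2) with (2 * x ^ 2 * B / (1 - r)) by (field; lra).
  apply aseries_diff_bound; auto using cosm_bound; intros j.
  unfold cosm; rewrite Rmult_0_r, cos_0, Rabs_minus_sym.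
  destruct (one_minus_cos_le (INR (2 * j) * x)) as [H1 H2].
  rewrite (Rabs_pos_eq (1 - _)) by exact H1.
  rewrite mult_INR in *; simpl (INR 2) in *.
  specialize (H j); pose proof (Rabs_pos (acoef q j)); pose proof (pow2_ge_0 x).
  apply Rle_trans with (Rabs (acoef q j) * (((1 + 1) * INR j * x) ^ 2 / 2)).
  - apply Rmult_le_compat_l; assumption.
  - replace (Rabs (acoef q j) * (((1 + 1) * INR j * x) ^ 2 / 2))
      with (2 * x ^ 2 * (Rabs (acoef q j) * INR j ^ 2)) by field.
    rewrite (Rmult_assoc (2 * x ^ 2)); apply Rmult_le_compat_l; lra.
Qed.

(** Continuity is read off the Lipschitz series in [weight_eq], not off the infinite products. *)
Lemma weight_continuous (q : R) : 0 < q < 1 -> forall th, continuous (weight q) th.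
Proof.
  intros hq th; destruct (aseries_lipschitz q hq) as [K HK].
  assert (Cc : continuous (fun x => aseries q (cosm x)) th)
    by exact (continuous_lipschitz _ K (fun x y => proj1 (HK x y)) th).
  assert (Cs : continuous (fun x => aseries q (sinm x)) th)
    by exact (continuous_lipschitz _ K (fun x y => proj2 (HK x y)) th).
  apply (continuous_ext (fun x => Ainf q ^ 2 * (aseries q (cosm x) * aseries q (cosm x)
                                    + aseries q (sinm x) * aseries q (sinm x)))).
  - intros x; rewrite weight_eq by exact hq.
    Rring.
  - apply continuous_Rmult; [apply continuous_const|].
    apply continuous_Rplus; apply continuous_Rmult; assumption.
Qed.

Lemma weight_ge_0 (q th : R) : 0 <= weight q th.
Proof. apply pow2_ge_0. Qed.

(** * Orthogonality *)

Definition Lint (q : R) (f : R -> R) : R :=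
  RInt (fun th => f th * (sin th ^ 2 * weight q th)) 0 PI.

Lemma mu_continuous (q : R) : 0 < q < 1 ->
  forall th, continuous (fun x => sin x ^ 2 * weight q x) th.
Proof.
  intros hq th; apply continuous_Rmult; [|apply weight_continuous, hq].
  apply continuous_derivable; auto_derive; auto.
Qed.

Lemma ex_Lint (q : R) (f : R -> R) : 0 < q < 1 -> (forall x, continuous f x) ->
  ex_RInt (fun th => f th * (sin th ^ 2 * weight q th)) 0 PI.
Proof.
  intros hq Hf; apply (ex_RInt_continuous (V := R_CompleteNormedModule)); intros x _.
  apply continuous_Rmult; [apply Hf|apply mu_continuous, hq].
Qed.

Lemma Lint_ext (q : R) (f g : R -> R) : (forall x, f x = g x) -> Lint q f = Lint q g.
Proof.
  intros H; apply RInt_ext; intros x _; rewrite H; reflexivity.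
Qed.

Lemma Lint_plus (q : R) (f g : R -> R) : 0 < q < 1 ->
  (forall x, continuous f x) -> (forall x, continuous g x) ->
  Lint q (fun x => f x + g x) = Lint q f + Lint q g.
Proof.
  intros hq Hf Hg; unfold Lint.
  rewrite <- (RInt_plus (V := R_CompleteNormedModule)) by (apply ex_Lint; assumption).
  apply RInt_ext; intros x _; unfold plus; simpl; Rring.
Qed.

Lemma Lint_scal (q c : R) (f : R -> R) : 0 < q < 1 -> (forall x, continuous f x) ->
  Lint q (fun x => c * f x) = c * Lint q f.
Proof.
  intros hq Hf; unfold Lint.
  rewrite <- (RInt_scal (V := R_CompleteNormedModule)) by (apply ex_Lint; assumption).
  apply RInt_ext; intros x _; unfold scal; simpl; unfold mult; simpl; Rring.
Qed.

Lemma Lint_abs_le (q : R) (f g : R -> R) : 0 < q < 1 ->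
  (forall x, continuous f x) -> (forall x, continuous g x) ->
  (forall x, Rabs (f x) <= g x) -> Rabs (Lint q f) <= Lint q g.
Proof.
  intros hq Hf Hg H.
  apply (norm_RInt_le (V := R_NormedModule)
           (fun th => f th * (sin th ^ 2 * weight q th))
           (fun th => g th * (sin th ^ 2 * weight q th)) 0 PI).
  - left; apply PI_RGT_0.
  - intros x _; change (Rabs (f x * (sin x ^ 2 * weight q x)) <= g x * (sin x ^ 2 * weight q x)).
    assert (0 <= sin x ^ 2 * weight q x)
      by (apply Rmult_le_pos; [apply pow2_ge_0|apply weight_ge_0]).
    rewrite Rabs_mult, (Rabs_pos_eq (sin x ^ 2 * _)) by assumption.
    apply Rmult_le_compat_r; auto.
  - apply (RInt_correct (V := R_CompleteNormedModule)), ex_Lint; assumption.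
  - apply (RInt_correct (V := R_CompleteNormedModule)), ex_Lint; assumption.
Qed.

Lemma pn_continuous (q : R) (n : nat) (x : R) : continuous (pn q n) x.
Proof.
  destruct n as [|N]; [apply continuous_const|].
  apply (continuous_sum_f_R0 (fun k th => pcoef q k * pcoef q (N - k) * cos ((2 * INR k - INR N) * th))).
  intros k; apply continuous_derivable; auto_derive; auto.
Qed.

Definition expw (t th : R) : R := exp (- t * (1 - cos th)).

Lemma expw_continuous (t x : R) : continuous (expw t) x.
Proof. apply continuous_derivable; unfold expw; auto_derive; auto. Qed.

(** Meant for the side conditions of [Lint_plus], [Lint_scal] and the like: the range of [q] by
    assumption, continuity by the shape of the integrand. *)
Ltac Rcont :=
  intros; try assumption;
  repeat lazymatch goal with
  | |- continuous (fun x => @?f x * @?g x) ?y => apply (continuous_Rmult f g y)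
  | |- continuous (fun x => @?f x + @?g x) ?y => apply (continuous_Rplus f g y)
  | |- continuous (fun x => pn ?q ?n x) ?y => exact (pn_continuous q n y)
  | |- continuous (fun x => expw ?t x) ?y => exact (expw_continuous t y)
  | |- continuous (fun _ => ?c) ?y => exact (continuous_const c y)
  end.

Definition sin_int (m : nat) : R := if Nat.eqb m 1 then PI / 2 else 0.

Lemma sin_INR_PI (m : nat) : sin (INR m * PI) = 0.
Proof.
  apply sin_eq_0_1; exists (Z.of_nat m); rewrite INR_IZR_INZ; reflexivity.
Qed.

Lemma is_RInt_sin_sinm (m : nat) : is_RInt (fun th => sin th * sinm th m) 0 PI (sin_int m).
Proof.
  unfold sin_int; destruct m as [|[|m]]; simpl Nat.eqb; cbv iota.
  - apply (is_RInt_ext (fun _ => 0)).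
    + intros x _; unfold sinm; simpl; rewrite Rmult_0_l, sin_0; Rring.
    + pose proof (is_RInt_const (V := R_NormedModule) 0 PI (0 : R)) as H.
      change (is_RInt (fun _ : R => 0) 0 PI ((PI - 0) * 0)) in H.
      rewrite Rmult_0_r in H; exact H.
  - replace (PI / 2) with (minus ((PI - sin PI * cos PI) / 2) ((0 - sin 0 * cos 0) / 2)).
    + apply (is_RInt_derive (V := R_CompleteNormedModule) (fun x => (x - sin x * cos x) / 2)).
      * intros x _; auto_derive; auto.
        unfold sinm; simpl INR; rewrite (Rmult_1_l x).
        pose proof (sin2_cos2 x); unfold Rsqr in *; nra.
      * intros x _; apply continuous_derivable; unfold sinm; auto_derive; auto.
    + unfold minus, plus, opp; simpl; rewrite sin_PI, sin_0; field.
  (* Here the frequency is [a + 1], so the product of sines is half the difference of the cosines of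
     frequencies [a] and [a + 2], both positive. *)
  - set (a := INR (S m)).
    assert (Ha : 0 < a) by (apply lt_0_INR; lia).
    set (F := fun x => (sin (a * x) / a - sin ((a + 2) * x) / (a + 2)) / 2).
    replace 0 with (minus (F PI) (F 0)) at 2.
    + apply (is_RInt_derive (V := R_CompleteNormedModule) F).
      * intros x _; unfold F; auto_derive; [auto|].
        unfold sinm; change (INR (S (S m))) with (INR (S m) + 1); fold a.
        replace (a * x) with ((a + 1) * x - x) by ring.
        replace ((a + 2) * x) with ((a + 1) * x + x) by ring.
        rewrite cos_plus, cos_minus; field; lra.
      * intros x _; apply continuous_derivable; unfold sinm; auto_derive; auto.
    + unfold minus, plus, opp, F; simpl.
      assert (E : a + 2 = INR (S (S (S m)))) by (unfold a; rewrite !S_INR; ring).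
      rewrite E; unfold a; rewrite !sin_INR_PI, !Rmult_0_r, sin_0; unfold Rdiv; ring.
Qed.

(** The integrand is [sin th * Im R_n], a sine series with frequencies [n + 2 j], of which only
    frequency [1] survives; it occurs just for [n = 1], [j = 0]. A tail bound uniform in [th]
    justifies integrating termwise. *)
Lemma Lint_pn (q : R) (n : nat) : 0 < q < 1 ->
  Lint q (pn q n) = Rcoef q n 0 * sin_int n.
Proof.
  intros hq.
  set (S_ := fun N th => sum_f_R0 (fun j => Rcoef q n j * sinm th (n + 2 * j)) N).
  assert (E1 : Lint q (pn q n) = RInt (fun th => sin th * Rser q n (sinm th)) 0 PI).
  { apply RInt_ext; intros x _; rewrite <- sin_weight_pn by exact hq; Rring. }
  assert (E2 : forall N, is_RInt (fun th => sin th * S_ N th) 0 PI (Rcoef q n 0 * sin_int n)).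
  { induction N as [|N IH].
    - apply (is_RInt_ext (fun th => scal (Rcoef q n 0) (sin th * sinm th n))).
      + intros x _; unfold S_, scal; simpl; unfold mult; simpl.
        rewrite Nat.add_0_r; Rring.
      + apply (is_RInt_scal (V := R_NormedModule)), is_RInt_sin_sinm.
    - replace (Rcoef q n 0 * sin_int n)
        with (plus (Rcoef q n 0 * sin_int n) (scal (Rcoef q n (S N)) (sin_int (n + 2 * S N)))).
      + apply (is_RInt_ext (fun th => plus (sin th * S_ N th)
                    (scal (Rcoef q n (S N)) (sin th * sinm th (n + 2 * S N))))).
        * intros x _; unfold S_; rewrite tech5; unfold plus, scal; simpl; unfold mult; simpl; Rring.
        * apply (is_RInt_plus (V := R_NormedModule)); [exact IH|].
          apply (is_RInt_scal (V := R_NormedModule)), is_RInt_sin_sinm.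
      + unfold sin_int at 2; destruct (Nat.eqb_spec (n + 2 * S N) 1); [lia|].
        unfold plus, scal; simpl; unfold mult; simpl; ring. }
  assert (E3 : forall N th, Rabs (Rser q n (sinm th) - S_ N th) <= amax q * q ^ S N / (1 - q)).
  { intros N th; unfold Rser, S_.
    rewrite (Series_incr_n _ (S N)); [|lia|apply ex_Rser; [exact hq|apply sinm_bound]].
    simpl Init.Nat.pred.
    match goal with |- Rabs (?a + ?b - ?a) <= _ => replace (a + b - a) with b by ring end.
    apply Series_geom_dominated; [exact hq|]; intros j.
    rewrite Rmult_assoc, <- pow_add.
    exact (bounded_mult_dominated _ _ _ _ (fun j => (n + 2 * j)%nat)
       (fun j => Rcoef_bound q n j hq) (sinm_bound th) (S N + j)%nat). }
  assert (E4 : forall N, Rabs (Lint q (pn q n) - Rcoef q n 0 * sin_int n)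
                 <= PI * (amax q / (1 - q)) * q ^ S N).
  { intros N; rewrite E1, <- (is_RInt_unique _ _ _ _ (E2 N)).
    pose proof PI_RGT_0.
    assert (X1 : ex_RInt (fun th => sin th * Rser q n (sinm th)) 0 PI).
    { apply (ex_RInt_ext (fun th => pn q n th * (sin th ^ 2 * weight q th))).
      - intros x _; rewrite <- sin_weight_pn by exact hq; Rring.
      - apply ex_Lint; [exact hq|apply pn_continuous]. }
    assert (X2 : ex_RInt (fun th => sin th * S_ N th) 0 PI) by (eexists; apply E2).
    rewrite <- (RInt_minus (V := R_CompleteNormedModule)) by assumption.
    replace (PI * (amax q / (1 - q)) * q ^ S N) with ((PI - 0) * (amax q * q ^ S N / (1 - q)))
      by (field; lra).
    apply abs_RInt_le_const; [lra| |].
    - apply (ex_RInt_minus (V := R_NormedModule)); assumption.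
    - intros th _.
      change (Rabs (sin th * Rser q n (sinm th) - sin th * S_ N th) <= amax q * q ^ S N / (1 - q)).
      replace (sin th * Rser q n (sinm th) - sin th * S_ N th)
        with (sin th * (Rser q n (sinm th) - S_ N th)) by ring.
      rewrite Rabs_mult; specialize (E3 N th).
      assert (Rabs (sin th) <= 1) by (apply Rabs_le; destruct (SIN_bound th); lra).
      pose proof (Rabs_pos (sin th)); pose proof (Rabs_pos (Rser q n (sinm th) - S_ N th)); nra. }
  assert (L : is_lim_seq (fun N => PI * (amax q / (1 - q)) * q ^ S N) 0).
  { replace (Finite 0) with (Rbar_mult (PI * (amax q / (1 - q))) 0) by (simpl; f_equal; ring).
    apply is_lim_seq_scal_l, (is_lim_seq_incr_1 (fun N => q ^ N)), is_lim_seq_geom.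
    rewrite Rabs_pos_eq; lra. }
  pose proof (is_lim_seq_le _ _ _ _ E4 (is_lim_seq_const _) L) as H; simpl in H.
  apply Rminus_diag_uniq; apply Rabs_eq_0.
  pose proof (Rabs_pos (Lint q (pn q n) - Rcoef q n 0 * sin_int n)); lra.
Qed.

Lemma pn_prod_continuous (q : R) (n k : nat) (x : R) :
  continuous (fun th => pn q n th * pn q k th) x.
Proof. apply continuous_Rmult; apply pn_continuous. Qed.

(** Multiplication by [2 cos th] is symmetric for [Lint], so the recurrence in [k] can be traded for
    the one in [n]; this is a two-step induction on [k]. *)
Lemma pn_orthogonal (q : R) (k n : nat) : 0 < q < 1 ->
  Lint q (fun th => pn q n th * pn q k th)
  = if Nat.eqb n k then PI / 2 * gq q n else 0.
Proof.
  intros hq; revert n.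
  assert (Z0 : Lint q (fun _ => 0) = 0).
  { rewrite (Lint_ext q _ (fun x => 0 * 0)) by (intros; ring).
    rewrite (Lint_scal q 0 (fun _ => 0)); [ring|exact hq|intros; apply continuous_const]. }
  assert (P0 : forall n, Lint q (fun th => pn q n th * pn q 0 th)
                 = if Nat.eqb n 0 then PI / 2 * gq q n else 0).
  { intros n; rewrite (Lint_ext q _ (fun _ => 0)) by (intros; simpl; ring).
    rewrite Z0; destruct n; simpl Nat.eqb; cbv iota; [rewrite gq_0; ring|reflexivity]. }
  assert (P1 : forall n, Lint q (fun th => pn q n th * pn q 1 th)
                 = if Nat.eqb n 1 then PI / 2 * gq q n else 0).
  { intros n; rewrite (Lint_ext q _ (pn q n)) by (intros; rewrite pn_1; ring).
    rewrite Lint_pn by exact hq; unfold sin_int.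
    destruct (Nat.eqb_spec n 1) as [->|]; [|ring].
    rewrite Rcoef_0 by exact hq.
    unfold Rcoef, Aprod, acoef, binom_coef, Rratio; simpl; field. }
  enough (H : (forall n, Lint q (fun th => pn q n th * pn q k th)
                 = if Nat.eqb n k then PI / 2 * gq q n else 0) /\
              (forall n, Lint q (fun th => pn q n th * pn q (S k) th)
                 = if Nat.eqb n (S k) then PI / 2 * gq q n else 0)) by apply H.
  induction k as [|k [IH1 IH2]]; [split; assumption|].
  split; [exact IH2|]; intros [|m].
  - rewrite (Lint_ext q _ (fun _ => 0)) by (intros; simpl; ring); exact Z0.
  - pose proof (gq_S_bounds q k hq) as Hk.
    apply Rmult_eq_reg_l with (gq q (S k)); [|lra].
    transitivity (gq q (S m) * (Lint q (fun th => pn q (S (S m)) th * pn q (S k) th)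
                                + Lint q (fun th => pn q m th * pn q (S k) th))
       - gq q (S k) * Lint q (fun th => pn q (S m) th * pn q k th)).
    + rewrite <- Lint_plus by Rcont; rewrite <- !Lint_scal by Rcont.
      set (f := fun x => gq q (S k) * (pn q (S m) x * pn q (S (S k)) x)).
      set (g := fun x => gq q (S k) * (pn q (S m) x * pn q k x)).
      assert (E : Lint q (fun x => f x + g x) = Lint q f + Lint q g).
      { apply Lint_plus; unfold f, g; Rcont. }
      apply Rplus_eq_reg_r with (Lint q g); rewrite <- E.
      match goal with |- _ = ?a - ?b + ?c => replace (a - b + c) with a by ring end.
      apply Lint_ext; intros x; unfold f, g.
      pose proof (pn_rec q x m hq) as R1; pose proof (pn_rec q x k hq) as R2.
      transitivity (pn q (S m) x * (gq q (S k) * (pn q (S (S k)) x + pn q k x))); [ring|].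
      rewrite <- R2.
      transitivity (2 * cos x * pn q (S m) x * pn q (S k) x); [ring|].
      rewrite R1; ring.
    + rewrite !IH2, IH1.
      change (Nat.eqb (S (S m)) (S k)) with (Nat.eqb (S m) k).
      change (Nat.eqb (S m) (S (S k))) with (Nat.eqb m (S k)).
      destruct (Nat.eqb_spec (S m) k) as [<-|].
      (* Here the first index [S m] equals [k]: the contributions of the pairs [(k + 1, k + 1)] and
         [(k, k)] cancel. *)
      * destruct (Nat.eqb_spec m (S (S m))); [lia|]; ring.
      * destruct (Nat.eqb_spec m (S k)) as [->|]; ring.
Qed.

(** * The kernel *)

Definition qof (kappa : R) : R := exp (- 2 * kappa).

Lemma qof_bounds (kappa : R) : 0 < kappa -> 0 < qof kappa < 1.
Proof.
  intros h; unfold qof; split; [apply exp_pos|].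
  rewrite <- exp_0; apply exp_increasing; lra.
Qed.

Lemma gam_gq (kappa : R) (n : nat) : gam kappa n = gq (qof kappa) n.
Proof.
  unfold gam, gq, Defs.tanh, qof.
  assert (E : exp (- 2 * kappa) ^ n = exp (- (kappa * INR n)) * exp (- (kappa * INR n))).
  { induction n as [|n IH].
    - simpl; rewrite Rmult_0_r, Ropp_0, exp_0; ring.
    - simpl pow; rewrite IH, <- !exp_plus, S_INR; f_equal; ring. }
  rewrite E, exp_Ropp.
  pose proof (exp_pos (kappa * INR n)).
  field; repeat split; nra.
Qed.

Lemma Ppoly_pn (kappa : R) (n : nat) (th : R) : (1 <= n)%nat ->
  Ppoly kappa n th = sqrt (gam kappa 1 / gam kappa n) * pn (qof kappa) n th.
Proof.
  intros hn; destruct n as [|N]; [lia|].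
  unfold Ppoly; cbv zeta; fold (qof kappa); f_equal; unfold pn.
  replace (S N - 1)%nat with N by lia.
  apply sum_eq; intros k _; unfold pcoef, binom_coef.
  rewrite S_INR.
  replace (2 * INR k - (INR N + 1) + 1) with (2 * INR k - INR N) by ring.
  f_equal; unfold Rdiv; rewrite Rinv_mult; ring.
Qed.

(** The kernel with its square roots cancelled: [sqrt (gam_n / gam_k)] times the prefactors of [P_n]
    and [P_k] is [gam_1 / gam_k]. It vanishes at [n = 0], as the boundary condition requires. *)
Definition kern (kappa : R) (k n : nat) (t : R) : R :=
  2 / (PI * gam kappa k)
  * Lint (qof kappa) (fun th => expw t th * (pn (qof kappa) n th * pn (qof kappa) k th)).

Lemma kernel_kern (kappa : R) (k n : nat) (t : R) :
  0 < kappa -> (1 <= k)%nat -> (1 <= n)%nat -> kernel kappa k n t = kern kappa k n t.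
Proof.
  intros h hk hn; pose proof (qof_bounds kappa h) as hq.
  assert (pos : forall m, (1 <= m)%nat -> 0 < gam kappa m).
  { intros [|m] hm; [lia|]; rewrite gam_gq; apply gq_S_bounds, hq. }
  pose proof (pos 1%nat (le_n 1)); pose proof (pos k hk); pose proof (pos n hn).
  pose proof PI_RGT_0.
  unfold kernel, kern; cbv zeta; fold (qof kappa).
  set (s := sqrt (gam kappa 1 / gam kappa n) * sqrt (gam kappa 1 / gam kappa k)).
  assert (Hs : sqrt (gam kappa n / gam kappa k) * s = gam kappa 1 / gam kappa k).
  { unfold s; rewrite <- !sqrt_mult_alt by (apply Rdiv_le_0_compat; lra).
    replace (gam kappa n / gam kappa k * (gam kappa 1 / gam kappa n * (gam kappa 1 / gam kappa k)))
      with (Rsqr (gam kappa 1 / gam kappa k)) by (unfold Rsqr; field; lra).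
    apply sqrt_Rsqr, Rdiv_le_0_compat; lra. }
  rewrite (RInt_ext _ (fun th => scal s (expw t th * (pn (qof kappa) n th * pn (qof kappa) k th)
                            * (sin th ^ 2 * weight (qof kappa) th)))).
  2:{ intros x _; rewrite !Ppoly_pn by assumption; unfold expw, s, scal; simpl; unfold mult; simpl.
      ring. }
  rewrite (RInt_scal (V := R_CompleteNormedModule)).
  2:{ apply (ex_Lint _ (fun th => expw t th * (pn (qof kappa) n th * pn (qof kappa) k th)) hq).
      intros x; apply continuous_Rmult; [|apply pn_prod_continuous].
      apply continuous_derivable; unfold expw; auto_derive; auto. }
  unfold Lint, scal; simpl; unfold mult; simpl.
  match goal with |- _ * _ * (s * ?I) = _ =>
    transitivity (2 / (PI * gam kappa 1) * (sqrt (gam kappa n / gam kappa k) * s) * I); [ring|] end.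
  rewrite Hs; field; lra.
Qed.

Lemma Lint_expw_derive (q : R) (f : R -> R) (t : R) : 0 < q < 1 -> (forall x, continuous f x) ->
  is_derive (fun u => Lint q (fun th => expw u th * f th)) t
    (Lint q (fun th => - (1 - cos th) * (expw t th * f th))).
Proof.
  intros hq Hf; unfold Lint.
  set (m := fun th => sin th ^ 2 * weight q th).
  set (F := fun u th => expw u th * f th * m th).
  assert (HD : forall u th, is_derive (fun u => F u th) u (- (1 - cos th) * (expw u th * f th) * m th)).
  { intros u th; unfold F, expw; auto_derive; auto; ring. }
  assert (E : RInt (fun th => - (1 - cos th) * (expw t th * f th) * (sin th ^ 2 * weight q th)) 0 PI
              = RInt (fun th => Derive (fun u => F u th) t) 0 PI).
  { apply RInt_ext; intros x _; symmetry; apply is_derive_unique, HD. }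
  rewrite E.
  apply (is_derive_RInt_param F 0 PI t).
  - exists (mkposreal 1 Rlt_0_1); intros u _ x _; eexists; apply HD.
  - intros x _.
    apply (continuity_2d_pt_ext (fun u v => (- (1 - cos v) * expw u v) * (f v * m v))).
    + intros u v; symmetry; etransitivity; [exact (is_derive_unique _ _ _ (HD u v))|ring].
    + assert (C1 : continuity_2d_pt (fun u v => 1 - cos v) t x).
      { apply (continuity_1d_2d_pt_comp (fun v => 1 - cos v) (fun u v => v)).
        - apply continuity_pt_filterlim, (continuous_derivable (fun v => 1 - cos v)).
          auto_derive; auto.
        - apply continuity_2d_pt_id2. }
      apply continuity_2d_pt_mult; [apply continuity_2d_pt_mult|].
      * apply continuity_2d_pt_opp, C1.
      * apply (continuity_1d_2d_pt_comp exp (fun u v => - u * (1 - cos v))).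
        -- apply continuity_pt_filterlim, (continuous_derivable exp); auto_derive; auto.
        -- apply continuity_2d_pt_mult; [|exact C1].
           apply continuity_2d_pt_opp, continuity_2d_pt_id1.
      * apply (continuity_1d_2d_pt_comp (fun v => f v * m v) (fun u v => v)).
        -- apply continuity_pt_filterlim, (continuous_Rmult f m); [apply Hf|apply mu_continuous, hq].
        -- apply continuity_2d_pt_id2.
  - exists (mkposreal 1 Rlt_0_1); intros u _.
    apply (ex_Lint q (fun th => expw u th * f th) hq).
    intros x; apply continuous_Rmult; [apply expw_continuous|apply Hf].
Qed.


Lemma kern_derive (kappa : R) (k n : nat) (t : R) : 0 < kappa ->
  is_derive (kern kappa k (S n)) t
    (- kern kappa k (S n) t + gam kappa (S n) / 2 * (kern kappa k n t + kern kappa k (S (S n)) t)).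
Proof.
  intros h; pose proof (qof_bounds kappa h) as hq; set (q := qof kappa) in *.
  set (c := 2 / (PI * gam kappa k)).
  set (J := fun j => Lint q (fun th => expw t th * (pn q j th * pn q k th))).
  pose proof (Lint_expw_derive q (fun th => pn q (S n) th * pn q k th) t hq
                (pn_prod_continuous q (S n) k)) as H.
  assert (E : Lint q (fun th => - (1 - cos th) * (expw t th * (pn q (S n) th * pn q k th)))
     = - J (S n) + gam kappa (S n) / 2 * (J n + J (S (S n)))).
  { unfold J.
    rewrite <- Lint_plus by Rcont.
    replace (- Lint q (fun th => expw t th * (pn q (S n) th * pn q k th)))
      with (-1 * Lint q (fun th => expw t th * (pn q (S n) th * pn q k th))) by ring.
    rewrite <- !Lint_scal, <- Lint_plus by Rcont.
    apply Lint_ext; intros x; rewrite gam_gq; fold q.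
    pose proof (pn_rec q x n hq) as R1.
    transitivity (- 1 * (expw t x * (pn q (S n) x * pn q k x))
      + expw t x * (2 * cos x * pn q (S n) x) * pn q k x / 2); [field|].
    rewrite R1; field. }
  cbv beta in H; rewrite E in H.
  replace (- kern kappa k (S n) t + gam kappa (S n) / 2 * (kern kappa k n t + kern kappa k (S (S n)) t))
    with (scal c (- J (S n) + gam kappa (S n) / 2 * (J n + J (S (S n))))).
  - exact (is_derive_scal _ t c _ H).
  - unfold kern; fold q; fold c; fold (J n); fold (J (S n)); fold (J (S (S n))).
    unfold scal; simpl; unfold mult; simpl; ring.
Qed.

Lemma kern_n_0 (kappa : R) (k : nat) (t : R) : 0 < kappa -> kern kappa k 0 t = 0.
Proof.
  intros h; pose proof (qof_bounds kappa h) as hq; unfold kern.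
  rewrite (Lint_ext _ _ (fun x => 0 * 0)) by (intros; simpl; ring).
  rewrite (Lint_scal _ 0 (fun _ => 0)); [ring|exact hq|intros; apply continuous_const].
Qed.

(** At [t = 0] the exponential is [1], and the prefactor [2 / (PI gam_k)] is the reciprocal of the
    squared norm in [pn_orthogonal]. *)
Lemma kern_initial (kappa : R) (k n : nat) : 0 < kappa -> (1 <= k)%nat ->
  kern kappa k n 0 = if Nat.eqb n k then 1 else 0.
Proof.
  intros h hk; pose proof (qof_bounds kappa h) as hq; unfold kern.
  rewrite (Lint_ext _ _ (fun x => pn (qof kappa) n x * pn (qof kappa) k x)).
  - rewrite pn_orthogonal by exact hq.
    destruct (Nat.eqb_spec n k) as [->|]; [|ring].
    destruct k as [|k]; [lia|].
    rewrite gam_gq; pose proof (gq_S_bounds _ k hq); pose proof PI_RGT_0; field; lra.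
  - intros x; unfold expw; rewrite Ropp_0, Rmult_0_l, exp_0; ring.
Qed.

(** The exponential is at most [1], [|p_n p_k|] is at most the mean of the two squares, and the
    squared norms are at most [PI / 2]. Uniformity in [n] puts the kernel in the uniqueness
    class. *)
Lemma kern_bound (kappa : R) (k n : nat) (t : R) : 0 < kappa -> (1 <= k)%nat -> 0 <= t ->
  Rabs (kern kappa k n t) <= / gam kappa k.
Proof.
  intros h hk ht; pose proof (qof_bounds kappa h) as hq; unfold kern.
  set (q := qof kappa) in *.
  assert (Hg : forall m, 0 <= gq q m <= 1).
  { intros [|m]; [rewrite gq_0; lra|pose proof (gq_S_bounds q m hq); lra]. }
  assert (Hk : 0 < gam kappa k).
  { destruct k as [|k]; [lia|]; rewrite gam_gq; apply gq_S_bounds, hq. }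
  pose proof PI_RGT_0.
  assert (B : Rabs (Lint q (fun th => expw t th * (pn q n th * pn q k th)))
     <= Lint q (fun th => / 2 * (pn q n th * pn q n th + pn q k th * pn q k th))).
  { apply Lint_abs_le; [exact hq|..].
    - Rcont.
    - Rcont.
    - intros x; rewrite Rabs_mult.
      assert (He : 0 <= expw t x <= 1).
      { unfold expw; split; [left; apply exp_pos|].
        destruct (COS_bound x).
        apply Rle_trans with (exp 0); [apply exp_monotone; nra|rewrite exp_0; lra]. }
      rewrite (Rabs_pos_eq (expw t x)) by apply He.
      set (a := pn q n x); set (b := pn q k x).
      assert (Rabs (a * b) <= / 2 * (a * a + b * b)).
      { apply Rabs_le; pose proof (pow2_ge_0 (a - b)); pose proof (pow2_ge_0 (a + b)); lra. }
      pose proof (Rabs_pos (a * b)); nra. }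
  rewrite Lint_scal, Lint_plus, !pn_orthogonal, !Nat.eqb_refl in B by Rcont.
  rewrite Rabs_mult, Rabs_pos_eq by (apply Rdiv_le_0_compat; nra).
  apply Rle_trans with (2 / (PI * gam kappa k) * (PI / 2)).
  - apply Rmult_le_compat_l; [apply Rdiv_le_0_compat; nra|].
    eapply Rle_trans; [exact B|]; pose proof (Hg n); pose proof (Hg k); nra.
  - right; field; lra.
Qed.

(** * Bounded solutions of the system *)

Definition rhs (kappa : R) (x : nat -> R -> R) (n : nat) (t : R) : R :=
  - x n t + gam kappa n / 2 * (x (n - 1)%nat t + x (S n) t).

Lemma gam_bounds (kappa : R) (n : nat) : 0 < kappa -> 0 <= gam kappa n <= 1.
Proof.
  intros h; rewrite gam_gq; destruct n as [|n]; [rewrite gq_0; lra|].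
  pose proof (gq_S_bounds _ n (qof_bounds kappa h)); lra.
Qed.

(** Since [gam n <= 1], the right-hand side has norm at most [1 + 1] on bounded sequences; this is
    the rate in [exp (2 t)]. *)
Lemma rhs_bound (kappa : R) (x : nat -> R -> R) (n : nat) (t D : R) : 0 < kappa ->
  (forall m, Rabs (x m t) <= D) -> Rabs (rhs kappa x n t) <= 2 * D.
Proof.
  intros h H; unfold rhs; pose proof (gam_bounds kappa n h).
  pose proof (H n) as H1; pose proof (H (n - 1)%nat) as H2; pose proof (H (S n)) as H3.
  apply Rabs_le_between in H1; apply Rabs_le_between in H2; apply Rabs_le_between in H3.
  apply Rabs_le; split; nra.
Qed.

(** Both [g - f] and [g + f] have nonnegative derivative. *)
Lemma increment_le (f g df dg : R -> R) (a b : R) : a <= b ->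
  (forall s, a <= s <= b -> is_derive f s (df s)) ->
  (forall s, a <= s <= b -> is_derive g s (dg s)) ->
  (forall s, a <= s <= b -> Rabs (df s) <= dg s) ->
  Rabs (f b - f a) <= g b - g a.
Proof.
  intros hab Hf Hg Hd.
  assert (P : forall (u du : R -> R), (forall s, a <= s <= b -> is_derive u s (du s)) ->
            (forall s, a <= s <= b -> 0 <= du s) -> u a <= u b).
  { intros u du Hu Hp.
    destruct (MVT_gen u a b du) as [c [Hc E]].
    - intros s; rewrite Rmin_left, Rmax_right by exact hab; intros Hs; apply Hu; lra.
    - intros s; rewrite Rmin_left, Rmax_right by exact hab; intros Hs.
      apply continuity_pt_filterlim, (continuous_derivable u); eexists; apply Hu, Hs.
    - rewrite Rmin_left, Rmax_right in Hc by exact hab.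
      specialize (Hp c Hc); nra. }
  assert (P1 : g a - f a <= g b - f b).
  { apply (P (fun s => g s - f s) (fun s => dg s - df s)).
    - intros s Hs; exact (is_derive_minus (V := R_NormedModule) g f s _ _ (Hg s Hs) (Hf s Hs)).
    - intros s Hs; specialize (Hd s Hs); apply Rabs_le_between in Hd; lra. }
  assert (P2 : g a + f a <= g b + f b).
  { apply (P (fun s => g s + f s) (fun s => dg s + df s)).
    - intros s Hs; exact (is_derive_plus (V := R_NormedModule) g f s _ _ (Hg s Hs) (Hf s Hs)).
    - intros s Hs; specialize (Hd s Hs); apply Rabs_le_between in Hd; lra. }
  apply Rabs_le; lra.
Qed.

(** [is_solution] gives derivatives for positive times and right continuity at [0], so the previous
    lemma is applied on [[e, b]] with [e] small. *)
Lemma increment_le_right (f g df dg : R -> R) (b : R) : 0 <= b ->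
  filterlim f (at_right 0) (locally (f 0)) ->
  (forall s, 0 < s <= b -> is_derive f s (df s)) ->
  (forall s, 0 <= s <= b -> is_derive g s (dg s)) ->
  (forall s, 0 < s <= b -> Rabs (df s) <= dg s) ->
  Rabs (f b - f 0) <= g b - g 0.
Proof.
  intros [hb|<-] Hf0 Hf Hg Hd; [|rewrite !Rminus_diag, Rabs_R0; lra].
  apply le_epsilon; intros eps heps.
  assert (heps2 : 0 < eps / 2) by lra.
  destruct (proj1 (filterlim_locally f (f 0)) Hf0 (mkposreal _ heps2)) as [d1 H1].
  assert (Hg0 : continuous g 0) by (apply continuous_derivable; eexists; apply Hg; lra).
  destruct (proj1 (filterlim_locally g (g 0)) Hg0 (mkposreal _ heps2)) as [d2 H2].
  set (e := Rmin b (Rmin (d1 / 2) (d2 / 2))).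
  assert (he : 0 < e /\ e <= b /\ e < d1 /\ e < d2).
  { pose proof (cond_pos d1); pose proof (cond_pos d2); unfold e; repeat split.
    - repeat apply Rmin_glb_lt; lra.
    - apply Rmin_l.
    - eapply Rle_lt_trans; [apply Rmin_r|]; eapply Rle_lt_trans; [apply Rmin_l|]; lra.
    - eapply Rle_lt_trans; [apply Rmin_r|]; eapply Rle_lt_trans; [apply Rmin_r|]; lra. }
  destruct he as [he0 [heb [hed1 hed2]]].
  assert (Hb : forall d : posreal, e < d -> ball 0 d e).
  { intros d hd; change (Rabs (e - 0) < d); rewrite Rminus_0_r, Rabs_pos_eq; lra. }
  specialize (H1 e (Hb d1 hed1) he0); specialize (H2 e (Hb d2 hed2)).
  change (Rabs (f e - f 0) < eps / 2) in H1; change (Rabs (g e - g 0) < eps / 2) in H2.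
  assert (H3 : Rabs (f b - f e) <= g b - g e).
  { apply (increment_le f g df dg); [exact heb|..]; intros s Hs;
      [apply Hf|apply Hg|apply Hd]; lra. }
  apply Rabs_lt_between in H1; apply Rabs_lt_between in H2; apply Rabs_le_between in H3.
  apply Rabs_le; lra.
Qed.

(* Iterating the integral inequality improves the trivial bound [M] to
   [B exp (2 s) + M (2 s)^m / m!] for every [m]. *)
Lemma solution_bound (kappa B : R) (x : nat -> R -> R) : 0 < kappa -> 0 <= B ->
  is_solution kappa x -> locally_bounded x -> (forall n, (1 <= n)%nat -> Rabs (x n 0) <= B) ->
  forall n t, 0 <= t -> Rabs (x n t) <= B * exp (2 * t).
Proof.
  intros h hB [Hx0 Hx] Hb Hi n t ht.
  destruct (Hb t ht) as [M HM].
  assert (hM : 0 <= M) by (eapply Rle_trans; [apply Rabs_pos|apply (HM 0%nat t); lra]).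
  (* Chosen so that [g (S m)] has derivative [2 * g m] and value [B] at [0], while [g 0] is at least
     [M]. *)
  set (g := fun m s => B * exp (2 * s) + M * ((2 * s) ^ m / INR (fact m))).
  assert (Hg0 : forall m s, 0 <= s -> 0 <= g m s).
  { intros m s hs; pose proof (exp_pos (2 * s)); pose proof (lt_0_INR _ (lt_O_fact m)).
    unfold g; apply Rplus_le_le_0_compat; apply Rmult_le_pos; try lra.
    apply Rdiv_le_0_compat; [apply pow_le; lra|lra]. }
  assert (Hm : forall m n s, 0 <= s <= t -> Rabs (x n s) <= g m s).
  { induction m as [|m IH]; intros j s hs.
    - eapply Rle_trans; [apply HM, hs|].
      unfold g; simpl; pose proof (exp_pos (2 * s)).
      assert (0 <= B * exp (2 * s)) by (apply Rmult_le_pos; lra); lra.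
    - destruct j as [|j].
      + rewrite Hx0, Rabs_R0; apply Hg0; lra.
      + destruct (Hx (S j) ltac:(lia)) as [H1 H2].
        assert (H3 : Rabs (x (S j) s - x (S j) 0) <= g (S m) s - g (S m) 0).
        { apply (increment_le_right (x (S j)) (g (S m)) (rhs kappa x (S j)) (fun u => 2 * g m u));
            [lra|exact H1|..].
          - intros u hu; apply H2; lra.
          - intros u hu; unfold g; auto_derive; [auto|].
            change (match m with O => 1 | S _ => INR m + 1 end) with (INR (S m)).
            change (fact m + m * fact m)%nat with (S m * fact m)%nat.
            rewrite mult_INR, S_INR.
            pose proof (lt_0_INR _ (lt_O_fact m)); pose proof (pos_INR m); field; lra.
          - intros u hu; apply rhs_bound; [exact h|]; intros i; apply IH; lra. }
        assert (E0 : g (S m) 0 = B).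
        { unfold g; rewrite Rmult_0_r, exp_0; simpl pow; unfold Rdiv; ring. }
        specialize (Hi (S j) ltac:(lia)).
        replace (x (S j) s) with ((x (S j) s - x (S j) 0) + x (S j) 0) by ring.
        eapply Rle_trans; [apply Rabs_triang|]; lra. }
  assert (L : is_lim_seq (fun m => g m t) (B * exp (2 * t) + M * 0)).
  { apply (is_lim_seq_plus' (fun _ => B * exp (2 * t))); [apply is_lim_seq_const|].
    apply (is_lim_seq_scal_l _ M 0), is_lim_seq_Reals, cv_speed_pow_fact. }
  rewrite Rmult_0_r, Rplus_0_r in L.
  exact (is_lim_seq_le _ _ _ _ (fun m => Hm m n t (conj ht (Rle_refl t))) (is_lim_seq_const _) L).
Qed.

Lemma is_solution_plus (kappa : R) (x y : nat -> R -> R) :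
  is_solution kappa x -> is_solution kappa y -> is_solution kappa (fun n t => x n t + y n t).
Proof.
  intros [Hx0 Hx] [Hy0 Hy]; split; [intros t; rewrite Hx0, Hy0; ring|].
  intros n hn; destruct (Hx n hn) as [A1 A2]; destruct (Hy n hn) as [B1 B2]; split.
  - eapply filterlim_comp_2; [exact A1|exact B1|].
    exact (filterlim_plus (V := R_NormedModule) (x n 0) (y n 0)).
  - intros t ht.
    match goal with |- is_derive _ _ ?l => replace l with (plus (rhs kappa x n t) (rhs kappa y n t)) end.
    + exact (is_derive_plus (V := R_NormedModule) _ _ _ _ _ (A2 t ht) (B2 t ht)).
    + unfold plus, rhs; simpl; ring.
Qed.

Lemma is_solution_scal (kappa c : R) (x : nat -> R -> R) :
  is_solution kappa x -> is_solution kappa (fun n t => x n t * c).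
Proof.
  intros [Hx0 Hx]; split; [intros t; rewrite Hx0; ring|].
  intros n hn; destruct (Hx n hn) as [A1 A2]; split.
  - rewrite Rmult_comm; apply (filterlim_ext (fun t => scal c (x n t))).
    + intros t; apply Rmult_comm.
    + exact (filterlim_comp _ _ _ _ _ _ _ _ A1 (filterlim_scal_r (V := R_NormedModule) c _)).
  - intros t ht; apply (is_derive_ext (fun t => c * x n t)); [intros; apply Rmult_comm|].
    replace (- (x n t * c) + gam kappa n / 2 * (x (n - 1)%nat t * c + x (S n) t * c))
      with (c * rhs kappa x n t) by (unfold rhs; ring).
    exact (is_derive_scal _ _ c _ (A2 t ht)).
Qed.

Lemma locally_bounded_plus (x y : nat -> R -> R) :
  locally_bounded x -> locally_bounded y -> locally_bounded (fun n t => x n t + y n t).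
Proof.
  intros Hx Hy T hT; destruct (Hx T hT) as [M HM]; destruct (Hy T hT) as [N HN].
  exists (M + N); intros n t ht; eapply Rle_trans; [apply Rabs_triang|].
  apply Rplus_le_compat; auto.
Qed.

Lemma locally_bounded_scal (c : R) (x : nat -> R -> R) :
  locally_bounded x -> locally_bounded (fun n t => x n t * c).
Proof.
  intros Hx T hT; destruct (Hx T hT) as [M HM].
  exists (M * Rabs c); intros n t ht; rewrite Rabs_mult.
  apply Rmult_le_compat_r; auto using Rabs_pos.
Qed.

(** The difference has zero initial data, so [solution_bound] applies with [B = 0]. *)
Lemma solution_unique (kappa : R) (x y : nat -> R -> R) : 0 < kappa ->
  is_solution kappa x -> locally_bounded x -> is_solution kappa y -> locally_bounded y ->
  (forall n, (1 <= n)%nat -> x n 0 = y n 0) -> forall n t, 0 <= t -> x n t = y n t.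
Proof.
  intros h Hx Bx Hy By Hi n t ht.
  assert (H : Rabs (x n t + y n t * -1) <= 0 * exp (2 * t)).
  { apply (solution_bound kappa 0 (fun n t => x n t + y n t * -1)); auto; [lra|..].
    - apply is_solution_plus; [exact Hx|apply is_solution_scal, Hy].
    - apply locally_bounded_plus; [exact Bx|apply locally_bounded_scal, By].
    - intros m hm; rewrite (Hi m hm).
      replace (y m 0 + y m 0 * -1) with 0 by ring; rewrite Rabs_R0; lra. }
  rewrite Rmult_0_l in H; apply Rabs_le_between in H; lra.
Qed.

(** * Superposition of the kernels *)

Lemma kern_derive_rhs (kappa : R) (k n : nat) (t : R) : 0 < kappa -> (1 <= n)%nat ->
  is_derive (kern kappa k n) t (rhs kappa (kern kappa k) n t).
Proof.
  intros h hn; destruct n as [|n]; [lia|].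
  unfold rhs; replace (S n - 1)%nat with n by lia; apply kern_derive, h.
Qed.

Lemma kern_solution (kappa : R) (k : nat) : 0 < kappa -> is_solution kappa (kern kappa k).
Proof.
  intros h; split; [intros t; apply kern_n_0, h|].
  intros n hn; split.
  - assert (C : continuous (kern kappa k n) 0)
      by (apply continuous_derivable; eexists; apply kern_derive_rhs; assumption).
    intros P HP; apply filter_le_within, C, HP.
  - intros t _; apply kern_derive_rhs; assumption.
Qed.

Lemma kern_locally_bounded (kappa : R) (k : nat) : 0 < kappa -> (1 <= k)%nat ->
  locally_bounded (kern kappa k).
Proof.
  intros h hk T hT; exists (/ gam kappa k); intros n t ht; apply kern_bound; auto; lra.
Qed.

(** Indices are shifted by one: [c j] is the initial value at site [j + 1]. *)
Definition ksum (kappa : R) (c : nat -> R) (N n : nat) (t : R) : R :=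
  sum_f_R0 (fun j => kern kappa (S j) n t * c j) N.

Lemma ksum_solution (kappa : R) (c : nat -> R) (N : nat) : 0 < kappa ->
  is_solution kappa (ksum kappa c N) /\ locally_bounded (ksum kappa c N).
Proof.
  intros h; induction N as [|N [IH1 IH2]].
  - split; [apply (is_solution_scal kappa (c 0%nat)), kern_solution, h|].
    apply (locally_bounded_scal (c 0%nat)), kern_locally_bounded; [exact h|lia].
  - split.
    + apply (is_solution_plus kappa _ _ IH1).
      apply (is_solution_scal kappa (c (S N))), kern_solution, h.
    + apply (locally_bounded_plus _ _ IH2).
      apply (locally_bounded_scal (c (S N))), kern_locally_bounded; [exact h|lia].
Qed.

Lemma ksum_derive (kappa : R) (c : nat -> R) (N n : nat) (t : R) : 0 < kappa -> (1 <= n)%nat ->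
  is_derive (ksum kappa c N n) t (rhs kappa (ksum kappa c N) n t).
Proof.
  intros h hn.
  assert (D : forall j, is_derive (fun t => kern kappa (S j) n t * c j) t
                (rhs kappa (kern kappa (S j)) n t * c j)).
  { intros j; apply (is_derive_ext (fun t => c j * kern kappa (S j) n t)); [intros; apply Rmult_comm|].
    rewrite Rmult_comm.
    exact (is_derive_scal _ _ (c j) _ (kern_derive_rhs kappa (S j) n t h hn)). }
  induction N as [|N IH].
  - replace (rhs kappa (ksum kappa c 0) n t) with (rhs kappa (kern kappa 1) n t * c 0%nat)
      by (unfold rhs, ksum; simpl; ring).
    apply (D 0%nat).
  - replace (rhs kappa (ksum kappa c (S N)) n t)
      with (plus (rhs kappa (ksum kappa c N) n t) (rhs kappa (kern kappa (S (S N))) n t * c (S N))).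
    + exact (is_derive_plus (V := R_NormedModule) _ _ _ _ _ IH (D (S N))).
    + unfold rhs, ksum; rewrite !tech5; unfold plus; simpl; ring.
Qed.

Lemma ksum_initial (kappa : R) (c : nat -> R) (N n : nat) : 0 < kappa ->
  ksum kappa c N n 0 = if (Nat.leb 1 n && Nat.leb n (S N))%bool then c (n - 1)%nat else 0.
Proof.
  intros h; unfold ksum.
  assert (E : forall j, kern kappa (S j) n 0 = if Nat.eqb n (S j) then 1 else 0)
    by (intros j; apply kern_initial; [exact h|lia]).
  induction N as [|N IH].
  - simpl sum_f_R0; rewrite E.
    destruct n as [|[|n]]; simpl; ring.
  - rewrite tech5, IH, E.
    destruct n as [|n]; [simpl; ring|].
    change (Nat.leb 1 (S n)) with true; rewrite ?andb_true_l.
    destruct (Nat.eqb_spec (S n) (S (S N))) as [Hn|Hn].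
    + rewrite (proj2 (Nat.leb_gt (S n) (S N))), (proj2 (Nat.leb_le (S n) (S (S N)))) by lia.
      replace (S n - 1)%nat with (S N) by lia; ring.
    + destruct (Nat.leb_spec (S n) (S N)) as [H1|H1].
      * rewrite (proj2 (Nat.leb_le (S n) (S (S N)))) by lia; ring.
      * rewrite (proj2 (Nat.leb_gt (S n) (S (S N)))) by lia; ring.
Qed.

(** The initial data are [c] cut off after [N + 1] sites, so [solution_bound] applies with [B = 1]
    whatever [N] is. *)
Lemma ksum_bound (kappa : R) (c : nat -> R) (N n : nat) (t : R) : 0 < kappa -> 0 <= t ->
  (forall j, Rabs (c j) <= 1) -> Rabs (ksum kappa c N n t) <= exp (2 * t).
Proof.
  intros h ht Hc; rewrite <- (Rmult_1_l (exp _)).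
  destruct (ksum_solution kappa c N h) as [H1 H2].
  apply (solution_bound kappa 1 _ h Rle_0_1 H1 H2); [|exact ht].
  intros m _; rewrite ksum_initial by exact h.
  destruct (Nat.leb 1 m && Nat.leb m (S N))%bool; [apply Hc|rewrite Rabs_R0; lra].
Qed.

(** A duality argument: for fixed [n] and [t], the signs of the kernel are taken as initial data.
    The superposition at that point is then the sum of absolute values, and [ksum_bound] bounds
    it. *)
Lemma kern_abs_summable (kappa : R) (n : nat) (t : R) : 0 < kappa -> 0 <= t ->
  ex_series (fun j => Rabs (kern kappa (S j) n t)).
Proof.
  intros h ht.
  set (c := fun j => if Rle_dec 0 (kern kappa (S j) n t) then 1 else -1).
  assert (Hc : forall j, Rabs (c j) <= 1).
  { intros j; unfold c; destruct (Rle_dec _ _); apply Rabs_le; lra. }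
  assert (E : forall N, ksum kappa c N n t = sum_f_R0 (fun j => Rabs (kern kappa (S j) n t)) N).
  { intros N; apply sum_eq; intros j _; unfold c; destruct (Rle_dec _ _) as [H|H].
    - rewrite Rabs_pos_eq by exact H; ring.
    - rewrite Rabs_left by lra; ring. }
  destruct (ex_finite_lim_seq_incr (sum_f_R0 (fun j => Rabs (kern kappa (S j) n t))) (exp (2 * t)))
    as [l Hl].
  - intros N; rewrite tech5; pose proof (Rabs_pos (kern kappa (S (S N)) n t)); lra.
  - intros N; rewrite <- E; eapply Rle_trans; [apply Rle_abs|apply ksum_bound; auto].
  - exists l; apply (is_lim_seq_ext (sum_f_R0 (fun j => Rabs (kern kappa (S j) n t))) _ l).
    + intros N; symmetry; apply sum_n_Reals.
    + exact Hl.
Qed.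

Lemma kern_series_ex (kappa : R) (c : nat -> R) (n : nat) (t : R) : 0 < kappa -> 0 <= t ->
  (forall j, Rabs (c j) <= 1) -> ex_series (fun j => kern kappa (S j) n t * c j).
Proof.
  intros h ht Hc.
  apply (ex_series_le (V := R_CompleteNormedModule)) with (b := fun j => Rabs (kern kappa (S j) n t)).
  - intros j; change (Rabs (kern kappa (S j) n t * c j) <= Rabs (kern kappa (S j) n t)).
    rewrite Rabs_mult; specialize (Hc j); pose proof (Rabs_pos (kern kappa (S j) n t)); nra.
  - apply kern_abs_summable; assumption.
Qed.

Definition kser (kappa : R) (c : nat -> R) (n : nat) (t : R) : R :=
  Series (fun j => kern kappa (S j) n t * c j).

Lemma kser_lim (kappa : R) (c : nat -> R) (n : nat) (t : R) : 0 < kappa -> 0 <= t ->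
  (forall j, Rabs (c j) <= 1) -> is_lim_seq (fun N => ksum kappa c N n t) (kser kappa c n t).
Proof.
  intros h ht Hc; pose proof (Series_correct _ (kern_series_ex kappa c n t h ht Hc)) as H.
  apply (is_lim_seq_ext (sum_n (fun j => kern kappa (S j) n t * c j)) _ (kser kappa c n t)).
  - intros N; apply sum_n_Reals.
  - exact H.
Qed.

Lemma kser_bound (kappa : R) (c : nat -> R) (n : nat) (t : R) : 0 < kappa -> 0 <= t ->
  (forall j, Rabs (c j) <= 1) -> Rabs (kser kappa c n t) <= exp (2 * t).
Proof.
  intros h ht Hc; pose proof (is_lim_seq_abs _ _ (kser_lim kappa c n t h ht Hc)) as L.
  exact (is_lim_seq_le _ _ _ _ (fun N => ksum_bound kappa c N n t h ht Hc) L (is_lim_seq_const _)).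
Qed.

(* Both bounds are uniform in [N], so they survive the limit [N -> oo]. *)
Lemma ksum_taylor (kappa : R) (c : nat -> R) (N n : nat) (T s u : R) : 0 < kappa ->
  (forall j, Rabs (c j) <= 1) -> (1 <= n)%nat -> 0 <= s <= T -> 0 <= u <= T ->
  Rabs (ksum kappa c N n u - ksum kappa c N n s) <= 2 * exp (2 * T) * Rabs (u - s) /\
  Rabs (ksum kappa c N n u - ksum kappa c N n s - (u - s) * rhs kappa (ksum kappa c N) n s)
  <= 4 * exp (2 * T) * (u - s) ^ 2.
Proof.
  intros h Hc hn hs hu; set (z := ksum kappa c N); set (E := exp (2 * T)).
  assert (hE : 0 < E) by apply exp_pos.
  assert (Hz : forall m v, 0 <= v <= T -> Rabs (z m v) <= E).
  { intros m v hv; eapply Rle_trans; [apply ksum_bound; [exact h|lra|exact Hc]|].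
    apply exp_monotone; lra. }
  assert (MV : forall m, (1 <= m)%nat -> forall v w, 0 <= v <= T -> 0 <= w <= T -> exists x,
     0 <= x <= T /\ Rabs (x - w) <= Rabs (v - w) /\ z m v - z m w = rhs kappa z m x * (v - w)).
  { intros m hm v w hv hw.
    destruct (MVT_gen (z m) w v (rhs kappa z m)) as [x [Hx Ex]].
    - intros y _; apply ksum_derive; assumption.
    - intros y _; apply continuity_pt_filterlim, (continuous_derivable (z m)).
      eexists; apply ksum_derive; assumption.
    - exists x; split; [|split; [|exact Ex]].
      + revert Hx; unfold Rmin, Rmax; destruct (Rle_dec w v); lra.
      + revert Hx; unfold Rmin, Rmax; destruct (Rle_dec w v); intros Hx.
        * rewrite !Rabs_pos_eq; lra.
        * rewrite !Rabs_left1; lra. }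
  assert (Lip : forall m v w, 0 <= v <= T -> 0 <= w <= T ->
     Rabs (z m v - z m w) <= 2 * E * Rabs (v - w)).
  { intros m v w hv hw; destruct m as [|m].
    (* Site [0] obeys no differential equation, but there the solution vanishes. *)
    - replace (z 0%nat v - z 0%nat w) with 0.
      + rewrite Rabs_R0; pose proof (Rabs_pos (v - w)); nra.
      + destruct (ksum_solution kappa c N h) as [[H0 _] _]; unfold z; rewrite !H0; ring.
    - destruct (MV (S m) ltac:(lia) v w hv hw) as [x [Hx [_ Ex]]].
      rewrite Ex, Rabs_mult; apply Rmult_le_compat_r; [apply Rabs_pos|].
      apply rhs_bound; [exact h|]; intros i; apply Hz, Hx. }
  split; [apply Lip; assumption|].
  destruct (MV n hn u s hu hs) as [x [Hx [Hd Ex]]].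
  rewrite Ex.
  replace (rhs kappa z n x * (u - s) - (u - s) * rhs kappa z n s)
    with ((rhs kappa z n x - rhs kappa z n s) * (u - s)) by ring.
  rewrite Rabs_mult, <- pow2_abs.
  assert (HR : Rabs (rhs kappa z n x - rhs kappa z n s) <= 2 * (2 * E * Rabs (x - s))).
  (* By linearity the increment of [rhs] is [rhs] of the increments, viewed as constant in time with
     dummy time [0]; the Lipschitz bound then supplies the second factor [u - s]. *)
  { replace (rhs kappa z n x - rhs kappa z n s)
      with (rhs kappa (fun m _ => z m x - z m s) n 0) by (unfold rhs; ring).
    apply rhs_bound; [exact h|]; intros m; apply Lip; assumption. }
  pose proof (Rabs_pos (u - s)); pose proof (Rabs_pos (x - s)).
  apply Rle_trans with (4 * E * Rabs (u - s) * Rabs (u - s)); [|right; ring].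
  apply Rmult_le_compat_r; [lra|nra].
Qed.

Lemma kser_taylor (kappa : R) (c : nat -> R) (n : nat) (T s u : R) : 0 < kappa ->
  (forall j, Rabs (c j) <= 1) -> (1 <= n)%nat -> 0 <= s <= T -> 0 <= u <= T ->
  Rabs (kser kappa c n u - kser kappa c n s) <= 2 * exp (2 * T) * Rabs (u - s) /\
  Rabs (kser kappa c n u - kser kappa c n s - (u - s) * rhs kappa (kser kappa c) n s)
  <= 4 * exp (2 * T) * (u - s) ^ 2.
Proof.
  intros h Hc hn hs hu.
  assert (L : forall m v, 0 <= v <= T -> is_lim_seq (fun N => ksum kappa c N m v) (kser kappa c m v))
    by (intros m v hv; apply kser_lim; [exact h|lra|exact Hc]).
  assert (L1 : is_lim_seq (fun N => ksum kappa c N n u - ksum kappa c N n s)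
                 (kser kappa c n u - kser kappa c n s)) by (apply is_lim_seq_minus'; auto).
  assert (L2 : is_lim_seq (fun N => rhs kappa (ksum kappa c N) n s) (rhs kappa (kser kappa c) n s)).
  { unfold rhs; apply is_lim_seq_plus'.
    - apply (is_lim_seq_opp _ (kser kappa c n s)), L, hs.
    - apply (is_lim_seq_scal_l _ (gam kappa n / 2) (kser kappa c (n - 1) s + kser kappa c (S n) s)).
      apply is_lim_seq_plus'; apply L, hs. }
  assert (L3 : is_lim_seq
     (fun N => ksum kappa c N n u - ksum kappa c N n s - (u - s) * rhs kappa (ksum kappa c N) n s)
     (kser kappa c n u - kser kappa c n s - (u - s) * rhs kappa (kser kappa c) n s)).
  { apply is_lim_seq_minus'; [exact L1|].
    apply (is_lim_seq_scal_l _ (u - s) (rhs kappa (kser kappa c) n s)), L2. }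
  split.
  - exact (is_lim_seq_le _ _ _ _ (fun N => proj1 (ksum_taylor kappa c N n T s u h Hc hn hs hu))
             (is_lim_seq_abs _ _ L1) (is_lim_seq_const _)).
  - exact (is_lim_seq_le _ _ _ _ (fun N => proj2 (ksum_taylor kappa c N n T s u h Hc hn hs hu))
             (is_lim_seq_abs _ _ L3) (is_lim_seq_const _)).
Qed.

(** Turns the second-order bound of [kser_taylor] into a derivative, in place of uniform convergence
    of differentiated series. *)
Lemma is_derive_quadratic (f : R -> R) (x l d K : R) : 0 < d -> 0 <= K ->
  (forall y, Rabs (y - x) < d -> Rabs (f y - f x - (y - x) * l) <= K * (y - x) ^ 2) ->
  is_derive f x l.
Proof.
  intros hd hK H; apply is_derive_Reals; intros eps heps.
  assert (he : 0 < Rmin d (eps / (K + 1))) by (apply Rmin_glb_lt; [lra|apply Rdiv_lt_0_compat; lra]).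
  exists (mkposreal _ he); intros y hy hyd; simpl in hyd.
  assert (h1 : Rabs y < d) by (eapply Rlt_le_trans; [exact hyd|apply Rmin_l]).
  assert (h2 : Rabs y < eps / (K + 1)) by (eapply Rlt_le_trans; [exact hyd|apply Rmin_r]).
  specialize (H (x + y)); replace (x + y - x) with y in H by ring; specialize (H h1).
  replace ((f (x + y) - f x) / y - l) with ((f (x + y) - f x - y * l) * / y) by (field; exact hy).
  rewrite Rabs_mult, Rabs_inv; pose proof (Rabs_pos_lt y hy) as hy0.
  apply Rle_lt_trans with (K * y ^ 2 * / Rabs y).
  - apply Rmult_le_compat_r; [left; apply Rinv_0_lt_compat, hy0|exact H].
  - rewrite <- pow2_abs.
    replace (K * Rabs y ^ 2 * / Rabs y) with (K * Rabs y) by (field; lra).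
    apply Rle_lt_trans with ((K + 1) * Rabs y); [nra|].
    apply Rmult_lt_reg_r with (/ (K + 1)); [apply Rinv_0_lt_compat; lra|].
    replace ((K + 1) * Rabs y * / (K + 1)) with (Rabs y) by (field; lra).
    exact h2.
Qed.

Lemma kser_0 (kappa : R) (c : nat -> R) (t : R) : 0 < kappa -> kser kappa c 0 t = 0.
Proof.
  intros h; unfold kser.
  rewrite (Series_ext _ (fun _ => 0 * 0)).
  - rewrite Series_scal_l; ring.
  - intros j; rewrite kern_n_0 by exact h; ring.
Qed.

Lemma kser_solution (kappa : R) (c : nat -> R) : 0 < kappa -> (forall j, Rabs (c j) <= 1) ->
  is_solution kappa (kser kappa c).
Proof.
  intros h Hc; split; [intros t; apply kser_0, h|].
  intros n hn; split.
  - apply (filterlim_locally (F := at_right 0)); intros eps.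
    set (E := exp (2 * 1)); assert (hE : 0 < E) by apply exp_pos.
    assert (hd : 0 < Rmin 1 (eps / (2 * E))).
    { apply Rmin_glb_lt; [lra|apply Rdiv_lt_0_compat; [apply cond_pos|lra]]. }
    exists (mkposreal _ hd); intros y hy hy0.
    change (Rabs (y - 0) < Rmin 1 (eps / (2 * E))) in hy.
    rewrite Rminus_0_r, Rabs_pos_eq in hy by lra.
    assert (h1 : y < 1) by (eapply Rlt_le_trans; [exact hy|apply Rmin_l]).
    assert (h2 : y < eps / (2 * E)) by (eapply Rlt_le_trans; [exact hy|apply Rmin_r]).
    change (Rabs (kser kappa c n y - kser kappa c n 0) < eps).
    eapply Rle_lt_trans;
      [apply (kser_taylor kappa c n 1 0 y h Hc hn); lra|].
    fold E; rewrite Rminus_0_r, Rabs_pos_eq by lra.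
    apply Rmult_lt_reg_r with (/ (2 * E)); [apply Rinv_0_lt_compat; lra|].
    assert (Ey : forall z : R, 2 * E * z * / (2 * E) = z) by (intros; field; lra).
    rewrite Ey; exact h2.
  - intros t ht.
    (* The radius [Rmin 1 t] keeps [y] positive and below the horizon [t + 1]. *)
    apply (is_derive_quadratic _ t _ (Rmin 1 t) (4 * exp (2 * (t + 1)))).
    + apply Rmin_glb_lt; lra.
    + pose proof (exp_pos (2 * (t + 1))); lra.
    + intros y hy.
      assert (h1 : Rabs (y - t) < 1) by (eapply Rlt_le_trans; [exact hy|apply Rmin_l]).
      assert (h2 : Rabs (y - t) < t) by (eapply Rlt_le_trans; [exact hy|apply Rmin_r]).
      apply Rabs_lt_between in h1; apply Rabs_lt_between in h2.
      apply (kser_taylor kappa c n (t + 1) t y h Hc hn); lra.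
Qed.

Lemma kser_locally_bounded (kappa : R) (c : nat -> R) : 0 < kappa -> (forall j, Rabs (c j) <= 1) ->
  locally_bounded (kser kappa c).
Proof.
  intros h Hc T hT; exists (exp (2 * T)); intros n t ht.
  eapply Rle_trans; [apply kser_bound; [exact h|lra|exact Hc]|apply exp_monotone; lra].
Qed.

Lemma kser_initial (kappa : R) (c : nat -> R) (n : nat) : 0 < kappa -> (forall j, Rabs (c j) <= 1) ->
  kser kappa c (S n) 0 = c n.
Proof.
  intros h Hc; pose proof (kser_lim kappa c (S n) 0 h (Rle_refl 0) Hc) as L.
  assert (L2 : is_lim_seq (fun N => ksum kappa c N (S n) 0) (c n)).
  { apply (is_lim_seq_ext_loc (fun _ => c n)); [|apply is_lim_seq_const].
    exists n; intros N HN; rewrite ksum_initial by exact h.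
    change (Nat.leb 1 (S n)) with true; rewrite ?andb_true_l.
    rewrite (proj2 (Nat.leb_le (S n) (S N))) by lia.
    f_equal; lia. }
  apply is_lim_seq_unique in L; apply is_lim_seq_unique in L2.
  rewrite L in L2; injection L2; auto.
Qed.

(** * The Gaussian integral *)

Definition gauss (x : R) : R := exp (- (x * x / 2)).
Definition Gint (X : R) : R := RInt gauss 0 X.
(** Companion of [Gint] in the classical evaluation of the Gaussian integral by differentiation
    under the integral sign: the derivatives of [Gint ^ 2] and [Hint] cancel. *)
Definition Hint (X : R) : R := RInt (fun u => 2 * exp (- (X * X * (1 + u * u) / 2)) / (1 + u * u)) 0 1.

Lemma gauss_continuous (x : R) : continuous gauss x.
Proof. apply continuous_derivable; unfold gauss; auto_derive; auto. Qed.

Lemma Gint_derive (X : R) : is_derive Gint X (gauss X).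
Proof.
  apply (is_derive_RInt (V := R_NormedModule) gauss Gint 0 X).
  - exists (mkposreal 1 Rlt_0_1); intros y _.
    apply (RInt_correct (V := R_CompleteNormedModule)).
    apply (ex_RInt_continuous (V := R_CompleteNormedModule)); intros; apply gauss_continuous.
  - apply gauss_continuous.
Qed.

Lemma one_plus_square_pos (u : R) : 0 < 1 + u * u.
Proof. nra. Qed.

Lemma Hint_integrand_continuous (X u : R) :
  continuous (fun u => 2 * exp (- (X * X * (1 + u * u) / 2)) / (1 + u * u)) u.
Proof.
  apply continuous_derivable; auto_derive.
  pose proof (one_plus_square_pos u); lra.
Qed.

Lemma Hint_derive (X : R) : is_derive Hint X (- 2 * gauss X * Gint X).
Proof.
  set (F := fun Y u => 2 * exp (- (Y * Y * (1 + u * u) / 2)) / (1 + u * u)).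
  assert (HD : forall Y u : R, is_derive (fun Y => F Y u) Y (- 2 * Y * exp (- (Y * Y * (1 + u * u) / 2)))).
  { intros Y u; pose proof (one_plus_square_pos u).
    unfold F; auto_derive; [lra|]; unfold Rdiv; field; lra. }
  assert (E : RInt (fun u => Derive (fun Y => F Y u) X) 0 1 = - 2 * gauss X * Gint X).
  { unfold Gint.
    (* The substitution [x = X u] brings the integral to [[0, 1]]. *)
    replace (RInt gauss 0 X) with (RInt gauss (X * 0 + 0) (X * 1 + 0)) by (f_equal; ring).
    assert (X1 : ex_RInt gauss (X * 0 + 0) (X * 1 + 0)).
    { apply (ex_RInt_continuous (V := R_CompleteNormedModule)); intros; apply gauss_continuous. }
    rewrite <- (RInt_comp_lin (V := R_CompleteNormedModule) gauss X 0 0 1 X1).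
    rewrite <- (RInt_scal (V := R_CompleteNormedModule) _ 0 1 (- 2 * gauss X)).
    - apply RInt_ext; intros u _.
      etransitivity; [exact (is_derive_unique _ _ _ (HD X u))|].
      unfold scal, gauss; simpl; unfold mult; simpl.
      replace (- (X * X * (1 + u * u) / 2))
        with (- (X * X / 2) + - ((X * u + 0) * (X * u + 0) / 2)) by field.
      rewrite exp_plus; Rring.
    - apply (ex_RInt_continuous (V := R_CompleteNormedModule)); intros u _.
      apply continuous_derivable; unfold scal, gauss; simpl; unfold mult; simpl; auto_derive; auto. }
  rewrite <- E.
  apply (is_derive_RInt_param F 0 1 X).
  - exists (mkposreal 1 Rlt_0_1); intros Y _ u _; eexists; apply HD.
  - intros u _.
    apply (continuity_2d_pt_ext (fun Y v => - 2 * Y * exp (- (Y * Y * (1 + v * v) / 2)))).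
    + intros Y v; symmetry; exact (is_derive_unique _ _ _ (HD Y v)).
    + assert (C2 : continuity_2d_pt (fun Y v => - 2 * Y) X u)
        by (apply continuity_2d_pt_mult; [apply continuity_2d_pt_const|apply continuity_2d_pt_id1]).
      apply continuity_2d_pt_mult; [exact C2|].
      apply (continuity_1d_2d_pt_comp exp (fun Y v => - (Y * Y * (1 + v * v) / 2))).
      * apply continuity_pt_filterlim, (continuous_derivable exp); auto_derive; auto.
      * apply continuity_2d_pt_opp, continuity_2d_pt_mult; [|apply continuity_2d_pt_const].
        apply continuity_2d_pt_mult.
        -- apply continuity_2d_pt_mult; apply continuity_2d_pt_id1.
        -- apply continuity_2d_pt_plus; [apply continuity_2d_pt_const|].
           apply continuity_2d_pt_mult; apply continuity_2d_pt_id2.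
  - exists (mkposreal 1 Rlt_0_1); intros Y _.
    apply (ex_RInt_continuous (V := R_CompleteNormedModule)); intros u _.
    apply Hint_integrand_continuous.
Qed.

(** The left side has zero derivative; at [X = 0] it is the integral of [2 / (1 + u^2)], that is
    [2 atan 1]. *)
Lemma Gint_square (X : R) : 0 <= X -> Gint X ^ 2 + Hint X = PI / 2.
Proof.
  intros hX.
  assert (H : Rabs ((Gint X ^ 2 + Hint X) - (Gint 0 ^ 2 + Hint 0)) <= 0 - 0).
  { apply (increment_le (fun Y => Gint Y ^ 2 + Hint Y) (fun _ => 0) (fun _ => 0) (fun _ => 0) 0 X hX).
    - intros Y _.
      replace 0 with (plus (2 * gauss Y * Gint Y) (- 2 * gauss Y * Gint Y))
        by (unfold plus; simpl; ring).
      apply (is_derive_plus (V := R_NormedModule)); [|apply Hint_derive].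
      replace (2 * gauss Y * Gint Y) with (INR 2 * gauss Y * Gint Y ^ Init.Nat.pred 2)
        by (simpl; ring).
      apply is_derive_pow, Gint_derive.
    - intros Y _; apply (is_derive_const (V := R_NormedModule)).
    - intros Y _; rewrite Rabs_R0; lra. }
  assert (G0 : Gint 0 = 0) by exact (RInt_point (V := R_CompleteNormedModule) 0 gauss).
  assert (H0 : Hint 0 = PI / 2).
  { apply is_RInt_unique.
    replace (PI / 2) with (minus (2 * atan 1) (2 * atan 0)).
    - apply (is_RInt_derive (V := R_CompleteNormedModule) (fun u => 2 * atan u)).
      + intros u _; auto_derive; [auto|].
        pose proof (one_plus_square_pos u).
        replace (- (0 * 0 * (1 + u * u) / 2)) with 0 by field.
        rewrite exp_0; unfold Rsqr; field; nra.
      + intros u _; apply Hint_integrand_continuous.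
    - unfold minus, plus, opp; simpl; rewrite atan_1, atan_0; field. }
  rewrite G0, H0 in H; apply Rabs_le_between in H; lra.
Qed.

Lemma Hint_bounds (X : R) : 0 <= Hint X <= 2 * gauss X.
Proof.
  assert (X1 : ex_RInt (fun u => 2 * exp (- (X * X * (1 + u * u) / 2)) / (1 + u * u)) 0 1).
  { apply (ex_RInt_continuous (V := R_CompleteNormedModule)); intros u _.
    apply Hint_integrand_continuous. }
  assert (B : forall u, 0 <= 2 * exp (- (X * X * (1 + u * u) / 2)) / (1 + u * u) <= 2 * gauss X).
  { intros u; pose proof (one_plus_square_pos u); pose proof (exp_pos (- (X * X * (1 + u * u) / 2))).
    split; [apply Rdiv_le_0_compat; lra|].
    assert (exp (- (X * X * (1 + u * u) / 2)) <= gauss X).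
    { unfold gauss; apply exp_monotone; pose proof (Rle_0_sqr (X * u)); unfold Rsqr in *; nra. }
    apply Rle_trans with (2 * exp (- (X * X * (1 + u * u) / 2)) / 1); [|lra].
    apply Rmult_le_compat_l; [lra|]; apply Rinv_le_contravar; nra. }
  split.
  - apply RInt_ge_0; [lra|exact X1|]; intros u _; apply B.
  - eapply Rle_trans; [apply Rle_abs|].
    replace (2 * gauss X) with ((1 - 0) * (2 * gauss X)) by ring.
    apply abs_RInt_le_const; [lra|exact X1|].
    intros u _; rewrite Rabs_pos_eq; apply B.
Qed.

Lemma Gint_ge_0 (X : R) : 0 <= X -> 0 <= Gint X.
Proof.
  intros hX; apply RInt_ge_0; [exact hX| |intros; left; apply exp_pos].
  apply (ex_RInt_continuous (V := R_CompleteNormedModule)); intros; apply gauss_continuous.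
Qed.

(** With [s = sqrt (PI / 2)], [(s - Gint X) (s + Gint X) = Hint X], and the second factor is at
    least [1]. *)
Lemma Gint_limit_rate (X : R) : 0 <= X -> Rabs (Gint X - sqrt (PI / 2)) <= 2 * gauss X.
Proof.
  intros hX; pose proof (Gint_square X hX) as E; pose proof (Hint_bounds X) as B.
  pose proof (Gint_ge_0 X hX) as G; pose proof PI2_1 as P.
  set (s := sqrt (PI / 2)).
  assert (hs : s * s = PI / 2) by (apply sqrt_sqrt; lra).
  assert (hs0 : 0 <= s) by apply sqrt_pos.
  assert (hs1 : 1 <= s) by nra.
  assert (D : (s - Gint X) * (s + Gint X) = Hint X) by (rewrite <- E in hs; nra).
  assert (0 <= s - Gint X) by nra.
  assert (s - Gint X <= Hint X) by nra.
  apply Rabs_le; lra.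
Qed.

(** Primitive of [x^2 exp (- x^2 / 2)] vanishing at [0], found by integration by parts. *)
Definition Kint (X : R) : R := Gint X - X * gauss X.

Lemma Kint_derive (X : R) : is_derive Kint X (X * X * gauss X).
Proof.
  unfold Kint.
  replace (X * X * gauss X) with (minus (gauss X) (gauss X - X * X * gauss X))
    by (unfold minus, plus, opp; simpl; ring).
  apply (is_derive_minus (V := R_NormedModule)); [apply Gint_derive|].
  unfold gauss; auto_derive; auto; unfold Rdiv; field.
Qed.

(** * Large-time asymptotics *)

(** No linear term at [0]: against [sin^2] and the exponential a linear term would give an error of
    order [t^(-2)], a quadratic one gives [t^(-5/2)]. *)
Definition flat (f : R -> R) : Prop :=
  exists C, 0 <= C /\ forall x, 0 <= x <= PI -> Rabs (f x - f 0) <= C * x ^ 2.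

Lemma flat_ext (f g : R -> R) : (forall x, f x = g x) -> flat f -> flat g.
Proof. intros E [C [hC H]]; exists C; split; [exact hC|]; intros x; rewrite <- !E; apply H. Qed.

Lemma flat_const (c : R) : flat (fun _ => c).
Proof.
  exists 0; split; [lra|]; intros x _; rewrite Rminus_diag, Rabs_R0; lra.
Qed.

Lemma flat_plus (f g : R -> R) : flat f -> flat g -> flat (fun x => f x + g x).
Proof.
  intros [C [hC H]] [D [hD K]]; exists (C + D); split; [lra|]; intros x hx.
  replace (f x + g x - (f 0 + g 0)) with ((f x - f 0) + (g x - g 0)) by ring.
  eapply Rle_trans; [apply Rabs_triang|]; specialize (H x hx); specialize (K x hx); lra.
Qed.

Lemma flat_mult (f g : R -> R) : flat f -> flat g -> flat (fun x => f x * g x).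
Proof.
  intros [C [hC H]] [D [hD K]].
  exists (C * (Rabs (g 0) + D * PI ^ 2) + Rabs (f 0) * D); split.
  { pose proof (Rabs_pos (g 0)); pose proof (Rabs_pos (f 0)); pose proof (pow2_ge_0 PI).
    assert (0 <= D * PI ^ 2) by nra.
    apply Rplus_le_le_0_compat; apply Rmult_le_pos; lra. }
  intros x hx; specialize (H x hx); specialize (K x hx).
  replace (f x * g x - f 0 * g 0) with ((f x - f 0) * g x + f 0 * (g x - g 0)) by ring.
  eapply Rle_trans; [apply Rabs_triang|]; rewrite !Rabs_mult.
  assert (Bg : Rabs (g x) <= Rabs (g 0) + D * PI ^ 2).
  { replace (g x) with (g 0 + (g x - g 0)) by ring.
    eapply Rle_trans; [apply Rabs_triang|].
    assert (x ^ 2 <= PI ^ 2) by (apply pow_incr; lra). nra. }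
  pose proof (Rabs_pos (g x)); pose proof (Rabs_pos (f 0)).
  pose proof (Rabs_pos (f x - f 0)); pose proof (Rabs_pos (g x - g 0)).
  rewrite Rmult_plus_distr_r; apply Rplus_le_compat.
  - apply Rle_trans with (C * x ^ 2 * (Rabs (g 0) + D * PI ^ 2)); [|right; ring].
    apply Rmult_le_compat; assumption.
  - rewrite Rmult_assoc; apply Rmult_le_compat_l; assumption.
Qed.

Lemma flat_cos (a : R) : flat (fun x => cos (a * x)).
Proof.
  exists (a ^ 2 / 2); split; [pose proof (pow2_ge_0 a); lra|]; intros x _.
  rewrite Rmult_0_r, cos_0, Rabs_minus_sym.
  destruct (one_minus_cos_le (a * x)); rewrite Rabs_pos_eq by assumption.
  eapply Rle_trans; [eassumption|]; right; field.
Qed.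

Lemma flat_sum (f : nat -> R -> R) (N : nat) :
  (forall k, flat (f k)) -> flat (fun x => sum_f_R0 (fun k => f k x) N).
Proof.
  intros H; induction N as [|N IH]; [apply H|exact (flat_plus _ _ IH (H (S N)))].
Qed.

Lemma flat_pn (q : R) (n : nat) : flat (pn q n).
Proof.
  destruct n as [|N]; [apply flat_const|].
  apply (flat_sum (fun k x => pcoef q k * pcoef q (N - k) * cos ((2 * INR k - INR N) * x))).
  intros k; apply flat_mult; [apply flat_const|apply flat_cos].
Qed.

(** The cosine series is flat. The sine series is only Lipschitz, but it vanishes at [0], so its
    square is quadratically small. *)
Lemma flat_weight (q : R) : 0 < q < 1 -> flat (weight q).
Proof.
  intros hq.
  apply (flat_ext (fun x => Ainf q ^ 2 * (aseries q (cosm x) * aseries q (cosm x)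
                                    + aseries q (sinm x) * aseries q (sinm x)))).
  { intros x; rewrite weight_eq by exact hq; ring. }
  apply flat_mult; [apply flat_const|apply flat_plus].
  - assert (flat (fun x => aseries q (cosm x))).
    { destruct (aseries_cos_flat q hq) as [K HK]; exists (Rabs K); split; [apply Rabs_pos|].
      intros x _; eapply Rle_trans; [apply HK|].
      apply Rmult_le_compat_r; [apply pow2_ge_0|apply Rle_abs]. }
    apply flat_mult; assumption.
  - destruct (aseries_lipschitz q hq) as [K HK].
    assert (S0 : aseries q (sinm 0) = 0).
    { unfold aseries; rewrite (Series_ext _ (fun _ => 0 * 0)).
      - rewrite Series_scal_l; ring.
      - intros j; unfold sinm; rewrite Rmult_0_r, sin_0; ring. }
    exists (K ^ 2); split; [apply pow2_ge_0|]; intros x _.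
    destruct (HK x 0) as [_ H]; rewrite S0 in *; rewrite !Rminus_0_r in H.
    replace (aseries q (sinm x) * aseries q (sinm x) - 0 * 0)
      with (Rsqr (aseries q (sinm x))) by (unfold Rsqr; ring).
    rewrite Rabs_pos_eq by apply Rle_0_sqr.
    rewrite Rsqr_abs; replace (K ^ 2 * x ^ 2) with (Rsqr (K * Rabs x))
      by (rewrite Rsqr_mult, <- Rsqr_abs; unfold Rsqr; ring).
    apply Rsqr_incr_1; [exact H|apply Rabs_pos|].
    eapply Rle_trans; [apply Rabs_pos|exact H].
Qed.

(** * Laplace's method *)

Lemma sin_ge_third (x : R) : 0 <= x <= 2 -> x / 3 <= sin x.
Proof.
  intros hx; pose proof PI2_1 as hP.
  destruct (SIN x) as [H _]; [lra|lra|].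
  eapply Rle_trans; [|exact H].
  unfold sin_lb, sin_approx, sin_term; simpl; unfold INR.
  (* The constant [1/3] is the value of [1 - y / 6] at [y = 4]; the two later Taylor terms have
     nonnegative sum. The range up to [2] covers [x / 2] for [x <= PI]. *)
  assert (A : 0 <= x * x <= 4) by nra.
  set (y := x * x) in *.
  match goal with |- _ <= ?r =>
    replace r with (x * (1 - y / 6 + y * y / 120 - y * y * y / 5040)) by (unfold y; field) end.
  assert (0 <= y * y * (42 - y)) by (apply Rmult_le_pos; nra).
  apply Rle_trans with (x * (/ 3)); [lra|].
  apply Rmult_le_compat_l; [lra|].
  replace (1 - y / 6 + y * y / 120 - y * y * y / 5040)
    with (1 - y / 6 + y * y * (42 - y) / 5040) by field.
  lra.
Qed.

Lemma one_minus_cos_ge (x : R) : 0 <= x <= PI -> x ^ 2 / 18 <= 1 - cos x.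
Proof.
  intros hx; rewrite one_minus_cos; pose proof PI_4.
  pose proof (sin_ge_third (x / 2) ltac:(lra)) as H1.
  assert (H2 : (x / 2 / 3) ^ 2 <= sin (x / 2) ^ 2) by (apply pow_incr; lra).
  replace (x ^ 2 / 18) with (2 * (x / 2 / 3) ^ 2) by field; lra.
Qed.

(** The right side integrates to an arctangent, of total order [t^(-5/2)], so no Gaussian moments
    are needed for the error. Here [54 = 3 * 18]: cubing [1 + y / 54 <= exp (y / 54)] gives growth
    [y^3], two powers for [x^4] and one for the denominator. *)
Lemma exp_times_quartic (t x : R) : 0 < t -> 0 <= x <= PI ->
  expw t x * x ^ 4 <= 54 ^ 3 / t ^ 2 * / (1 + t * (x * x)).
Proof.
  intros ht hx; set (y := t * (x * x)).
  assert (hy : 0 <= y) by (unfold y; nra).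
  assert (H : expw t x <= exp (- (y / 18))).
  { unfold expw; apply exp_monotone; pose proof (one_minus_cos_ge x hx); unfold y; nra. }
  assert (H1 : (1 + y / 54) ^ 3 <= exp (y / 18)).
  { replace (y / 18) with (y / 54 + y / 54 + y / 54) by field; rewrite !exp_plus.
    replace (exp (y / 54) * exp (y / 54) * exp (y / 54)) with (exp (y / 54) ^ 3) by ring.
    apply pow_incr; split; [lra|apply exp_ineq1_le]. }
  assert (H2 : y ^ 2 * (1 + y) <= 54 ^ 3 * exp (y / 18)).
  { apply Rle_trans with (54 ^ 3 * (1 + y / 54) ^ 3); [|apply Rmult_le_compat_l; [lra|exact H1]].
    replace (54 ^ 3 * (1 + y / 54) ^ 3) with ((54 + y) ^ 2 * (54 + y)) by field.
    apply Rmult_le_compat; [apply pow2_ge_0|lra|apply pow_incr; lra|lra]. }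
  assert (E : x ^ 4 = y ^ 2 / t ^ 2) by (unfold y; field; lra).
  pose proof (exp_pos (y / 18)) as P.
  apply Rle_trans with (exp (- (y / 18)) * x ^ 4).
  { apply Rmult_le_compat_r; [|exact H].
    replace (x ^ 4) with ((x ^ 2) ^ 2) by ring; apply pow2_ge_0. }
  rewrite E, exp_Ropp.
  assert (ht2 : 0 < t ^ 2) by (apply pow_lt, ht).
  apply Rmult_le_reg_r with (exp (y / 18) * t ^ 2 * (1 + y)).
  { repeat apply Rmult_lt_0_compat; lra. }
  replace (/ exp (y / 18) * (y ^ 2 / t ^ 2) * (exp (y / 18) * t ^ 2 * (1 + y)))
    with (y ^ 2 * (1 + y)) by (field; lra).
  replace (54 ^ 3 / t ^ 2 * / (1 + y) * (exp (y / 18) * t ^ 2 * (1 + y)))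
    with (54 ^ 3 * exp (y / 18)) by (field; lra).
  exact H2.
Qed.

Lemma RInt_arctan_bound (t : R) : 0 < t ->
  is_RInt (fun x => / (1 + t * (x * x))) 0 PI (atan (sqrt t * PI) / sqrt t).
Proof.
  intros ht; pose proof (sqrt_lt_R0 t ht) as hs; pose proof (sqrt_sqrt t ltac:(lra)) as E.
  set (s := sqrt t) in *.
  replace (atan (s * PI) / s) with (minus (atan (s * PI) / s) (atan (s * 0) / s)).
  - apply (is_RInt_derive (V := R_CompleteNormedModule) (fun x => atan (s * x) / s)).
    + intros x _; auto_derive; [auto|].
      rewrite <- E; pose proof (Rle_0_sqr (s * x)); unfold Rsqr in *.
      field; repeat split; nra.
    + intros x _; apply continuous_derivable; auto_derive; pose proof (Rle_0_sqr x); unfold Rsqr in *; nra.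
  - unfold minus, plus, opp; simpl; rewrite Rmult_0_r, atan_0; field; lra.
Qed.

(* Substituting [y = 2 sin (x / 2)], for which [1 - cos x = y^2 / 2]. *)
Lemma RInt_expw_main (t : R) : 0 < t ->
  is_RInt (fun x => expw t x * (4 * sin (x / 2) ^ 2 * cos (x / 2))) 0 PI
    (Kint (2 * sqrt t) / (t * sqrt t)).
Proof.
  intros ht; pose proof (sqrt_lt_R0 t ht) as hs; pose proof (sqrt_sqrt t ltac:(lra)) as E.
  set (s := sqrt t) in *.
  assert (K0 : Kint 0 = 0).
  { unfold Kint, Gint.
    assert (G0 : RInt gauss 0 0 = 0) by exact (RInt_point (V := R_CompleteNormedModule) 0 gauss).
    rewrite G0; ring. }
  set (F := fun x => Kint (2 * s * sin (x / 2)) / (t * s)).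
  replace (Kint (2 * s) / (t * s)) with (minus (F PI) (F 0)).
  - apply (is_RInt_derive (V := R_CompleteNormedModule) F).
    + intros x _.
      assert (D : is_derive (fun x => 2 * s * sin (x / 2)) x (s * cos (x / 2)))
        by (auto_derive; auto; unfold Rdiv; field).
      pose proof (is_derive_comp Kint (fun x => 2 * s * sin (x / 2)) x _ _ (Kint_derive _) D) as H.
      apply (is_derive_ext (fun x => / (t * s) * Kint (2 * s * sin (x / 2)))).
      { intros y; unfold F, Rdiv; Rring. }
      match goal with |- is_derive _ _ ?l =>
        replace l with (/ (t * s) * scal (s * cos (x / 2))
            (2 * s * sin (x / 2) * (2 * s * sin (x / 2)) * gauss (2 * s * sin (x / 2)))) end.
      * exact (is_derive_scal _ x (/ (t * s)) _ H).
      * unfold scal; simpl; unfold mult; simpl; unfold expw, gauss.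
        rewrite one_minus_cos.
        replace (- (2 * s * sin (x / 2) * (2 * s * sin (x / 2)) / 2))
          with (- (s * s) * (2 * sin (x / 2) ^ 2)) by field.
        rewrite <- E; field; lra.
    + intros x _; apply continuous_derivable; unfold expw; auto_derive; auto.
  - unfold minus, plus, opp, F; simpl.
    replace (0 / 2) with 0 by field.
    rewrite sin_PI2, sin_0, Rmult_0_r, Rmult_1_r, K0; unfold Rdiv; ring.
Qed.

(** The rate [1 / t] is all the asymptotics needs. From [gauss (2 s) = exp (- 2 t)] and
    [t^2 exp (- 2 t) <= 1], the Gaussian tail and the boundary term each contribute at most
    [2 / t]. *)
Lemma Kint_limit_rate (t : R) : 1 <= t -> Rabs (Kint (2 * sqrt t) - sqrt (PI / 2)) <= 4 / t.
Proof.
  intros ht; pose proof (sqrt_sqrt t ltac:(lra)) as E; pose proof (sqrt_pos t) as hs.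
  pose proof (Gint_limit_rate (2 * sqrt t) ltac:(lra)) as H.
  unfold Kint; set (s := sqrt t) in *.
  assert (hs1 : 1 <= s) by nra.
  assert (hst : s <= t) by nra.
  assert (Hg : t * t * gauss (2 * s) <= 1).
  { unfold gauss.
    replace (2 * s * (2 * s) / 2) with (t + t) by (rewrite <- E; field).
    rewrite exp_Ropp, exp_plus; pose proof (exp_ineq1_le t).
    apply Rmult_le_reg_r with (exp t * exp t); [nra|].
    rewrite Rmult_assoc, Rinv_l by nra; nra. }
  assert (Hp : 0 < gauss (2 * s)) by apply exp_pos.
  assert (Hb : t * gauss (2 * s) <= / t).
  { apply Rmult_le_reg_l with t; [lra|]; rewrite Rinv_r by lra; lra. }
  apply Rabs_le_between in H; apply Rabs_le.
  assert (gauss (2 * s) <= t * gauss (2 * s)) by nra.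
  assert (0 <= s * gauss (2 * s) <= t * gauss (2 * s)) by nra.
  unfold Rdiv; lra.
Qed.

Lemma laplace_asymptotics (g : R -> R) : (forall x, continuous g x) -> flat g ->
  exists C, forall t, 1 <= t ->
    Rabs (RInt (fun x => expw t x * (sin x ^ 2 * g x)) 0 PI - g 0 * sqrt (PI / 2) / (t * sqrt t))
    <= C / (t ^ 2 * sqrt t).
Proof.
  intros Cg Fg.
  (* In [sin x ^ 2 = 4 sin (x/2) ^ 2 cos (x/2) ^ 2] one cosine is the Jacobian of the substitution;
     the other is absorbed here. *)
  set (hh := fun x => cos (/ 2 * x) * g x).
  assert (Fh : flat hh) by (apply flat_mult; [apply flat_cos|exact Fg]).
  assert (h0 : hh 0 = g 0) by (unfold hh; rewrite Rmult_0_r, cos_0; ring).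
  destruct Fh as [C [hC HC]].
  (* The first term bounds the integral of [e], with [atan < PI / 2]; the second comes from
     [Kint_limit_rate]. *)
  exists (C * 54 ^ 3 * (PI / 2) + 4 * Rabs (g 0)); intros t ht.
  pose proof PI_RGT_0 as hPI.
  pose proof (sqrt_lt_R0 t ltac:(lra)) as hs; set (s := sqrt t) in *.
  set (m := fun x => 4 * sin (x / 2) ^ 2 * cos (x / 2)).
  set (e := fun x => expw t x * (m x * (hh x - hh 0))).
  assert (Ce : forall x, continuous e x).
  { intros x; unfold e; apply continuous_Rmult; [apply expw_continuous|].
    apply continuous_Rmult; [apply continuous_derivable; unfold m; auto_derive; auto|].
    apply (continuous_Rplus hh (fun _ => - hh 0)); [|apply continuous_const].
    unfold hh; apply continuous_Rmult; [apply continuous_derivable; auto_derive; auto|apply Cg]. }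
  assert (Xe : ex_RInt e 0 PI)
    by (apply (ex_RInt_continuous (V := R_CompleteNormedModule)); intros; apply Ce).
  pose proof (RInt_expw_main t ltac:(lra)) as Hm; fold s in Hm.
  assert (E : RInt (fun x => expw t x * (sin x ^ 2 * g x)) 0 PI
              = RInt e 0 PI + g 0 * (Kint (2 * s) / (t * s))).
  { apply is_RInt_unique.
    apply (is_RInt_ext (fun x => plus (e x) (scal (g 0) (expw t x * m x)))).
    - intros x _; unfold e, m, plus, scal; simpl; unfold mult; simpl; rewrite h0; unfold hh.
      replace (sin x) with (2 * sin (x / 2) * cos (x / 2))
        by (rewrite <- sin_2a; f_equal; field).
      replace (/ 2 * x) with (x / 2) by field.
      Rring.
    - apply (is_RInt_plus (V := R_NormedModule)).
      + apply (RInt_correct (V := R_CompleteNormedModule)), Xe.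
      + apply (is_RInt_scal (V := R_NormedModule)), Hm. }
  assert (Be : Rabs (RInt e 0 PI) <= C * (54 ^ 3 / t ^ 2) * (atan (s * PI) / s)).
  { apply (norm_RInt_le (V := R_NormedModule) e
             (fun x => C * (54 ^ 3 / t ^ 2) * / (1 + t * (x * x))) 0 PI); [lra|..].
    - intros x hx; change (Rabs (e x) <= C * (54 ^ 3 / t ^ 2) * / (1 + t * (x * x))).
      rewrite Rmult_assoc.
      apply Rle_trans with (C * (expw t x * x ^ 4)).
      2: apply Rmult_le_compat_l; [exact hC|apply exp_times_quartic; lra].
      unfold e; rewrite !Rabs_mult, (Rabs_pos_eq (expw t x)) by (left; apply exp_pos).
      assert (Hmx : Rabs (m x) <= x ^ 2).
      { unfold m; rewrite !Rabs_mult, (Rabs_pos_eq 4), <- RPow_abs by lra.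
        assert (Rabs (cos (x / 2)) <= 1) by (apply Rabs_le; destruct (COS_bound (x / 2)); lra).
        assert (Hs2 : Rabs (sin (x / 2)) ^ 2 <= Rabs (x / 2) ^ 2)
          by (apply pow_incr; split; [apply Rabs_pos|apply Rabs_sin_le]).
        rewrite (pow2_abs (x / 2)) in Hs2.
        pose proof (pow2_ge_0 (Rabs (sin (x / 2)))); pose proof (Rabs_pos (cos (x / 2))).
        replace (x ^ 2) with (4 * (x / 2) ^ 2 * 1) by field.
        apply Rmult_le_compat; lra. }
      specialize (HC x hx).
      replace (C * (expw t x * x ^ 4)) with (expw t x * (x ^ 2 * (C * x ^ 2))) by ring.
      apply Rmult_le_compat_l; [left; apply exp_pos|].
      apply Rmult_le_compat; auto using Rabs_pos.
    - apply (RInt_correct (V := R_CompleteNormedModule)), Xe.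
    - apply (is_RInt_scal (V := R_NormedModule)), RInt_arctan_bound; lra. }
  rewrite E.
  pose proof (Kint_limit_rate t ht) as HK; fold s in HK.
  replace (RInt e 0 PI + g 0 * (Kint (2 * s) / (t * s)) - g 0 * sqrt (PI / 2) / (t * s))
    with (RInt e 0 PI + g 0 * (Kint (2 * s) - sqrt (PI / 2)) / (t * s)) by (field; lra).
  replace ((C * 54 ^ 3 * (PI / 2) + 4 * Rabs (g 0)) / (t ^ 2 * s))
    with (C * (54 ^ 3 / t ^ 2) * (PI / 2 / s) + Rabs (g 0) * (4 / t) / (t * s)) by (field; lra).
  eapply Rle_trans; [apply Rabs_triang|]; apply Rplus_le_compat.
  - eapply Rle_trans; [exact Be|].
    assert (0 < t ^ 2) by (apply pow_lt; lra).
    apply Rmult_le_compat_l; [apply Rmult_le_pos; [exact hC|apply Rdiv_le_0_compat; lra]|].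
    apply Rmult_le_compat_r; [left; apply Rinv_0_lt_compat, hs|].
    destruct (atan_bound (s * PI)); lra.
  - unfold Rdiv at 1; rewrite !Rabs_mult.
    rewrite (Rabs_pos_eq (/ (t * s))) by (left; apply Rinv_0_lt_compat; nra).
    apply Rmult_le_compat_r; [left; apply Rinv_0_lt_compat; nra|].
    apply Rmult_le_compat_l; [apply Rabs_pos|exact HK].
Qed.

(** * The asymptotic formula for the kernel *)

Lemma weight_at_0 (q : R) : 0 < q < 1 -> weight q 0 = qpoch_inf q q ^ 4 / qpoch_inf (- q) q ^ 4.
Proof.
  intros hq.
  destruct (qpoch_cv q q hq) as [_ [E1 N1]]; [rewrite Rabs_pos_eq; lra|].
  destruct (qpoch_cv (- q) q hq) as [_ [E2 N2]]; [rewrite Rabs_Ropp, Rabs_pos_eq; lra|].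
  unfold weight.
  assert (Ex : Cexpi (2 * 0) = RtoC 1)
    by (unfold Cexpi; rewrite Rmult_0_r, cos_0, sin_0; reflexivity).
  rewrite Ex, !Cmult_1_r, E1, E2, <- !RtoC_mult, <- RtoC_div, Cmod_R.
  - rewrite <- Rsqr_pow2, <- Rsqr_abs; unfold Rsqr; field; exact N2.
  - apply Rmult_integral_contrapositive; split; exact N2.
Qed.

Lemma Rpower_three_halves (t : R) : 0 < t -> Rpower t (3 / 2) = t * sqrt t.
Proof.
  intros ht; replace (3 / 2) with (1 + / 2) by field.
  rewrite Rpower_plus, Rpower_1, Rpower_sqrt by exact ht; reflexivity.
Qed.

Lemma Rpower_minus_five_halves (t : R) : 0 < t -> Rpower t (- (5 / 2)) = / (t ^ 2 * sqrt t).
Proof.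
  intros ht; rewrite Rpower_Ropp; f_equal.
  replace (5 / 2) with (1 + (1 + / 2)) by field.
  rewrite !Rpower_plus, Rpower_1, Rpower_sqrt by exact ht; ring.
Qed.

(** The square roots cancel as in [kernel_kern], and [sqrt (2 / PI) = 2 / PI * sqrt (PI / 2)] brings
    in the Gaussian constant. *)
Lemma kernel_asympt_eq (kappa : R) (k n : nat) (t : R) :
  0 < kappa -> (1 <= k)%nat -> (1 <= n)%nat -> 0 < t ->
  kernel_asympt kappa k n t
  = 2 / (PI * gam kappa k)
    * ((pn (qof kappa) n 0 * pn (qof kappa) k 0 * weight (qof kappa) 0)
       * sqrt (PI / 2) / (t * sqrt t)).
Proof.
  intros h hk hn ht; pose proof (qof_bounds kappa h) as hq.
  assert (pos : forall m, (1 <= m)%nat -> 0 < gam kappa m).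
  { intros [|m] hm; [lia|]; rewrite gam_gq; apply gq_S_bounds, hq. }
  pose proof (pos 1%nat (le_n 1)); pose proof (pos k hk); pose proof (pos n hn).
  pose proof PI_RGT_0; pose proof (sqrt_lt_R0 t ht).
  unfold kernel_asympt; cbv zeta; fold (qof kappa).
  rewrite <- weight_at_0, Rpower_three_halves, !Ppoly_pn by assumption.
  set (s := sqrt (gam kappa 1 / gam kappa n) * sqrt (gam kappa 1 / gam kappa k)).
  assert (Hs : sqrt (2 / PI * (gam kappa n / gam kappa k)) * s
               = 2 / PI * sqrt (PI / 2) * (gam kappa 1 / gam kappa k)).
  { assert (P1 : 0 <= 2 / PI) by (apply Rdiv_le_0_compat; lra).
    assert (P2 : 0 <= gam kappa n / gam kappa k) by (apply Rdiv_le_0_compat; lra).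
    assert (P3 : 0 <= gam kappa 1 / gam kappa n) by (apply Rdiv_le_0_compat; lra).
    assert (P4 : 0 <= gam kappa 1 / gam kappa k) by (apply Rdiv_le_0_compat; lra).
    unfold s; rewrite <- !sqrt_mult_alt by (assumption || (apply Rmult_le_pos; assumption)).
    replace (2 / PI * (gam kappa n / gam kappa k)
             * (gam kappa 1 / gam kappa n * (gam kappa 1 / gam kappa k)))
      with ((2 / PI * (gam kappa 1 / gam kappa k)) * (2 / PI * (gam kappa 1 / gam kappa k)) * (PI / 2))
      by (field; lra).
    rewrite sqrt_mult_alt by (apply Rmult_le_pos; apply Rmult_le_pos; assumption).
    rewrite sqrt_square by (apply Rmult_le_pos; assumption); ring. }
  transitivity (1 / gam kappa 1 * (sqrt (2 / PI * (gam kappa n / gam kappa k)) * s)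
    * weight (qof kappa) 0 * (pn (qof kappa) n 0 * pn (qof kappa) k 0 / (t * sqrt t))).
  - unfold s; field; lra.
  - rewrite Hs; field; lra.
Qed.

Lemma kernel_asymptotics (kappa : R) (k n : nat) :
  0 < kappa -> (1 <= k)%nat -> (1 <= n)%nat ->
  exists C T, 0 < T /\ forall t, T <= t ->
    Rabs (kernel kappa k n t - kernel_asympt kappa k n t) <= C * Rpower t (- (5 / 2)).
Proof.
  intros h hk hn; pose proof (qof_bounds kappa h) as hq; set (q := qof kappa) in *.
  set (g := fun x => pn q n x * pn q k x * weight q x).
  destruct (laplace_asymptotics g) as [C HC].
  - intros x; unfold g; apply continuous_Rmult; [apply pn_prod_continuous|apply weight_continuous, hq].
  - apply flat_mult; [apply flat_mult; apply flat_pn|apply flat_weight, hq].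
  - exists (Rabs (2 / (PI * gam kappa k)) * C), 1; split; [lra|]; intros t ht.
    rewrite kernel_kern, kernel_asympt_eq, Rpower_minus_five_halves by (assumption || lra).
    unfold kern; fold q; rewrite <- Rmult_minus_distr_l, Rabs_mult, (Rmult_assoc _ C).
    apply Rmult_le_compat_l; [apply Rabs_pos|].
    eapply Rle_trans; [|apply HC, ht].
    right; f_equal; f_equal; unfold Lint; apply RInt_ext; intros x _; unfold g; Rring.
Qed.

(** An equality of functions, so that [is_solution] and [locally_bounded] transfer by rewriting. *)
Lemma kernel_ext (kappa : R) (k : nat) : 0 < kappa -> (1 <= k)%nat ->
  (fun n t => if Nat.eqb n 0 then 0 else kernel kappa k n t) = kern kappa k.
Proof.
  intros h hk; extensionality n; extensionality t.
  destruct n as [|n]; simpl Nat.eqb; cbv iota.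
  - symmetry; apply kern_n_0, h.
  - apply kernel_kern; [exact h|exact hk|lia].
Qed.

Lemma kernel_series_ext (kappa : R) (c : nat -> R) : 0 < kappa ->
  (fun n t => if Nat.eqb n 0 then 0 else Series (fun j => kernel kappa (S j) n t * c (S j)))
  = kser kappa (fun j => c (S j)).
Proof.
  intros h; extensionality n; extensionality t.
  destruct n as [|n]; simpl Nat.eqb; cbv iota.
  - symmetry; apply kser_0, h.
  - apply Series_ext; intros j; rewrite kernel_kern by (exact h || lia); reflexivity.
Qed.

Theorem theorem3p1 (kappa : R) (hkappa : 0 < kappa) (q0 : nat -> R)
  (hq0 : forall n, (1 <= n)%nat -> -1 <= q0 n <= 1) :
  (* q^{(k)} is given by the integral formula: it is a (locally bounded)
     solution with initial data delta_{k,n} *)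
  (forall k, (1 <= k)%nat ->
     is_solution kappa (fun n t => if Nat.eqb n 0 then 0 else kernel kappa k n t) /\
     locally_bounded (fun n t => if Nat.eqb n 0 then 0 else kernel kappa k n t) /\
     (forall n, (1 <= n)%nat -> kernel kappa k n 0 = if Nat.eqb n k then 1 else 0)) /\
  (* the series sum_{k>=1} q_n^{(k)}(t) q_{k,0} converges ... *)
  (forall n t, (1 <= n)%nat -> 0 <= t ->
     ex_series (fun j => kernel kappa (S j) n t * q0 (S j))) /\
  (* ... and defines a locally bounded solution with initial data q0 ... *)
  (let x := fun n t => if Nat.eqb n 0 then 0
                       else Series (fun j => kernel kappa (S j) n t * q0 (S j)) in
   is_solution kappa x /\ locally_bounded x /\
   (forall n, (1 <= n)%nat -> x n 0 = q0 n) /\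
   (* ... which is the unique such solution *)
   (forall y, is_solution kappa y -> locally_bounded y ->
      (forall n, (1 <= n)%nat -> y n 0 = q0 n) ->
      forall n t, 0 <= t -> y n t = x n t)) /\
  (* large-time asymptotics *)
  (forall n k, (1 <= n)%nat -> (1 <= k)%nat ->
     exists C T, 0 < T /\ forall t, T <= t ->
       Rabs (kernel kappa k n t - kernel_asympt kappa k n t) <= C * Rpower t (- (5 / 2))).
Proof.
  assert (Hc : forall j, Rabs (q0 (S j)) <= 1) by (intros j; apply Rabs_le, hq0; lia).
  pose proof (kser_solution kappa (fun j => q0 (S j)) hkappa Hc) as S1.
  pose proof (kser_locally_bounded kappa (fun j => q0 (S j)) hkappa Hc) as S2.
  assert (S3 : forall n, (1 <= n)%nat -> kser kappa (fun j => q0 (S j)) n 0 = q0 n).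
  { intros [|n] hn; [lia|]; apply (kser_initial kappa (fun j => q0 (S j))); assumption. }
  split; [|split; [|split]].
  - intros k hk; rewrite (kernel_ext kappa k hkappa hk); split; [|split].
    + apply kern_solution, hkappa.
    + apply kern_locally_bounded; assumption.
    + intros n hn; rewrite kernel_kern by assumption; apply kern_initial; assumption.
  - intros n t hn ht.
    apply (ex_series_ext (fun j => kern kappa (S j) n t * q0 (S j))).
    + intros j; rewrite kernel_kern by (assumption || lia); reflexivity.
    + apply (kern_series_ex kappa (fun j => q0 (S j))); assumption.
  - rewrite (kernel_series_ext kappa q0 hkappa); cbv zeta.
    split; [exact S1|split; [exact S2|split; [exact S3|]]].
    intros y Hy By Hi; apply (solution_unique kappa); auto.
    intros n hn; rewrite S3, Hi by exact hn; reflexivity.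
  - intros n k hn hk; apply kernel_asymptotics; assumption.
Qed.
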